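(* For every $0<\varepsilon\le1$ there exists a bandlimited orthogonal wavelet $\psi$ such that $$|\psi(x)|\le c\exp\left\{-\frac{c'\varepsilon|x|}{[\ln(e+|x|)]^{1+\varepsilon}}\right\},\qquad x\in\mathbb R,$$ where $c'>0$ is an absolute constant and $c$ depends only on $\varepsilon$. Furthermore, for each integer $\ell\ge1$ there exists a bandlimited orthogonal wavelet $\psi$ satisfying the same type of estimate with $[\ln(e+|x|)]^{1+\varepsilon}$ replaced by $$\prod_{i=1}^{\ell}\ln_i\big(\exp_i(1)+|x|\big)\cdot\big[\ln_{\ell+1}\big(\exp_{\ell+1}(1)+|x|\big)\big]^{1+\varepsilon}$$ (with constants possibly depending also on $\ell$).
   Context: A bandlimited orthogonal wavelet is a function $\psi\in L^2(\mathbb R)$ whose Fourier transform $\hat\psi$ is compactly supported and such that $\{2^{j/2}\psi(2^jx-k)\}_{j,k\in\mathbb Z}$ is an orthonormal basis of $L^2(\mathbb R)$. Here $\ln_i$ denotes the $i$-fold iterated natural logarithm and $\exp_i(1)$ the $i$-fold iterated exponential evaluated at $1$ (so $\exp_1(1)=e$, $\exp_2(1)=e^e$). *)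

(* Defs.v *)
(* R : realType, Lebesgue measure on R.
   Complex-valued functions R -> C are represented by their real and imaginary
   parts (u, v) : (R -> R) * (R -> R). *)
From HB Require Import structures.
From mathcomp Require Import all_boot all_order all_algebra.
From mathcomp Require Import all_classical all_reals all_analysis.
Set Implicit Arguments. Unset Strict Implicit. Unset Printing Implicit Defensive.
Import Order.TTheory GRing.Theory Num.Theory.
Import numFieldNormedType.Exports.
Local Open Scope classical_set_scope.
Local Open Scope ring_scope.

Section Wavelets.
Variable R : realType.
Local Notation mu := (@lebesgue_measure R).

Definition sqint (D : set R) (f : R -> R) : Prop :=
  measurable_fun D f /\ mu.-integrable D (fun x => ((f x) ^+ 2)%:E).

Definition cL2 (u v : R -> R) : Prop := sqint setT u /\ sqint setT v.

(* real and imaginary parts of <f, g> = \int f conj(g), f = u1 + i v1, g = u2 + i v2 *)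
Definition ipRe (u1 v1 u2 v2 : R -> R) : R :=
  Rintegral mu setT (fun x => u1 x * u2 x + v1 x * v2 x).
Definition ipIm (u1 v1 u2 v2 : R -> R) : R :=
  Rintegral mu setT (fun x => v1 x * u2 x - u1 x * v2 x).

Definition wjk (j k : int) (u : R -> R) : R -> R :=
  fun x => (Num.sqrt 2) ^ j * u ((2 : R) ^ j * x - k%:~R).

(* bandlimited: u + i v = inverse Fourier transform of some g = g1 + i g2 in
   L^2 with support in [-A, A] (normalising constant absorbed in g);
   the equality holds at every x, i.e. (u,v) is the continuous representative. *)
Definition bandlimited (u v : R -> R) : Prop :=
  exists (A : R) (g1 g2 : R -> R),
    sqint `[-A, A] g1 /\ sqint `[-A, A] g2 /\
    forall x : R,
      u x = Rintegral mu `[-A, A] (fun t => g1 t * cos (x * t) - g2 t * sin (x * t)) /\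
      v x = Rintegral mu `[-A, A] (fun t => g1 t * sin (x * t) + g2 t * cos (x * t)).

Definition wavelet_onb (u v : R -> R) : Prop :=
  cL2 u v /\
  (forall j k j' k' : int,
      ipRe (wjk j k u) (wjk j k v) (wjk j' k' u) (wjk j' k' v)
        = ((j == j') && (k == k'))%:R /\
      ipIm (wjk j k u) (wjk j k v) (wjk j' k' u) (wjk j' k' v) = 0) /\
  (forall f1 f2 : R -> R, cL2 f1 f2 ->
      (forall j k : int,
          ipRe f1 f2 (wjk j k u) (wjk j k v) = 0 /\
          ipIm f1 f2 (wjk j k u) (wjk j k v) = 0) ->
      {ae mu, forall x, f1 x = 0 /\ f2 x = 0}).

Definition bandlimited_orthogonal_wavelet (u v : R -> R) : Prop :=
  bandlimited u v /\ wavelet_onb u v.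

Definition cmod (u v : R -> R) (x : R) : R := Num.sqrt (u x ^+ 2 + v x ^+ 2).

Definition lnit (i : nat) (y : R) : R := iter i (@ln R) y.
Definition expit (i : nat) : R := iter i (@expR R) 1.

Definition denom0 (eps x : R) : R := (ln (expR 1 + `|x|)) `^ (1 + eps).

Definition denomL (l : nat) (eps x : R) : R :=
  (\prod_(1 <= i < l.+1) lnit i (expit i + `|x|)) *
  (lnit l.+1 (expit l.+1 + `|x|)) `^ (1 + eps).

End Wavelets.

(* Main.v *)
(** A Meyer wavelet is built from an angle [th] with [th = 0] on [|t| <= 1/3], [th = pi/2] on
    [|t| >= 2/3] and [th t + th (1 - t) = pi/2] in between (frequencies are normalised to unit
    period): the scaling function has multiplier [cos th], the wavelet has multiplier
    [b t = sin (th t) cos (th (t/2))] and is translated by [1/2].  All multipliers are real and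
    even, so only cosine transforms occur and the wavelet is real.

    Orthonormality follows from Plancherel by folding the support of [b] onto itself.
    Completeness uses the kernels [K_j x y = 2^j sum_k phi (2^j x - k) phi (2^j y - k)]:
    [K_(j+1) - K_j] is the sum of the wavelets of level [j], so if [f] is orthogonal to all of
    them then [\int f K_j] does not depend on [j]; it tends to [0] as [j -> -oo], hence vanishes,
    and the [K_j] are an approximate identity as [j -> +oo].

    For the decay, [th] is an infinite convolution of uniform densities of half-widths
    [a_i = del / ((i+1) lam (i+1))], where [lam] is the denominator in the exponent.  These widths
    are summable because [1 / (k lam k)] is dominated by an increment of
    [- (ln_(l+1) k) ^ (- eps) / eps], and the [n]-th derivative of [b] is then at most
    [n! D^n lam(1) ... lam(n)] with [D] proportional to [1 / eps].  Integrating by parts [n] times, with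
    [n] about [|x| / (e D lam |x|)], gives the estimate. *)
Require Import Defs.
From HB Require Import structures.
From mathcomp Require Import all_boot all_order all_algebra.
From mathcomp Require Import all_classical all_reals all_analysis.
From mathcomp Require Import measurable_realfun.
From mathcomp Require Import zify ring lra.
Import Order.TTheory GRing.Theory Num.Theory.
Import numFieldNormedType.Exports.
Set Implicit Arguments. Unset Strict Implicit. Unset Printing Implicit Defensive.
Local Open Scope classical_set_scope.
Local Open Scope ring_scope.

(** * Integration *)

Section Integration.
Variable R : realType.
Local Notation mu := (@lebesgue_measure R).
Implicit Types (f g F G : R -> R) (a b c d x y : R).

(** The [k]-th derivative of the angle is at most of order [k! del^-k weight k]. The factorial keeps
    this class closed, up to a change of rate, under products and under sine and cosine, while
    summability of the widths is the Denjoy-Carleman condition that still permits compact support.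
    The widths have to fit into a transition zone of fixed length; this forces [del] to be
    proportional to [eps] and is how [eps] enters the exponent linearly.

    The Fourier analysis is needed only pointwise and for even multipliers of class C^2 with compact
    support. Poisson summation, inversion and Plancherel all rest on Bessel's inequality, through
    sampling by the Dirichlet kernel. The function [f] of the completeness argument is merely square
    integrable and is never transformed: it is paired with kernels of quadratic decay and tested on
    intervals.

    The translation by [1/2] supplies a sign. It makes the products between adjacent scales odd
    under a reflection, and it gives the terms of [K_1 - K_0] shifted by an odd integer the sign
    that they need. *)

Lemma is_derive_continuous f (df : R -> R) :
  (forall x, is_derive x 1 f (df x)) -> continuous f.
Proof.
by move=> fdf x; apply/differentiable_continuous/derivable1_diffP; case: (fdf x).
Qed.

Lemma continuous_funD f g : continuous f -> continuous g -> continuous (fun x => f x + g x).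
Proof. by move=> cf cg x; apply: cvgD; [exact: cf|exact: cg]. Qed.

Lemma continuous_funB f g : continuous f -> continuous g -> continuous (fun x => f x - g x).
Proof. by move=> cf cg x; apply: cvgB; [exact: cf|exact: cg]. Qed.

Lemma continuous_funM f g : continuous f -> continuous g -> continuous (fun x => f x * g x).
Proof. by move=> cf cg x; apply: cvgM; [exact: cf|exact: cg]. Qed.

Lemma continuous_funZ r f : continuous f -> continuous (fun x => r * f x).
Proof. by move=> cf x; apply: cvgMr; exact: cf. Qed.

Lemma continuous_fun_comp f g : continuous f -> continuous g -> continuous (fun x => f (g x)).
Proof. by move=> cf cg x; apply: continuous_comp; [exact: cg|exact: cf]. Qed.

Lemma continuous_addr c : continuous (fun x : R => x + c).
Proof. by move=> x; apply: cvgD; [exact: cvg_id|exact: cvg_cst]. Qed.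

Lemma continuous_addl c : continuous (fun x : R => c + x).
Proof. by move=> x; apply: cvgD; [exact: cvg_cst|exact: cvg_id]. Qed.

Lemma continuous_integrable a b f : continuous f ->
  mu.-integrable `[a, b] (EFin \o f).
Proof.
move=> cf; apply: continuous_compact_integrable; first exact: segment_compact.
exact: continuous_subspaceT.
Qed.

Lemma continuous_RintegralS f a b c : a <= b -> b <= c -> continuous f ->
  \int[mu]_(x in `[a, c]) f x - \int[mu]_(x in `[a, b]) f x =
  \int[mu]_(x in `[b, c]) f x.
Proof.
move=> ab bc cf.
rewrite Rintegral_itvB; [|exact: continuous_integrable|by rewrite bnd_simp|by rewrite bnd_simp].
rewrite Rintegral_itv_obnd_cbnd//; apply: integrableS (continuous_integrable b c cf) => //;
    exact: subset_itv_oc_cc.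
Qed.

(** Calculus on intervals is reduced below to endpoint values of an antiderivative on the whole
    line. The signed integral from [0] is a difference of two set integrals, one of which runs over
    an empty or degenerate interval. *)
Lemma continuous_antiderivative f : continuous f ->
  exists F, forall x, is_derive x 1 F (f x).
Proof.
move=> cf.
pose F x := \int[mu]_(t in `[0, x]) f t - \int[mu]_(t in `[x, 0]) f t.
exists F => x.
have [M [xM Mx M0]] : exists M, [/\ - M < x, x < M & 0 < M].
  exists (`|x| + 1); have := ler_norm x; have := ler_norm (- x); rewrite normrN => h1 h2.
  by split; have := normr_ge0 x; lra.
have key y : - M < y -> \int[mu]_(t in `[(- M)%R, y]) f t - \int[mu]_(t in `[(-M)%R, 0%R]) f t = F y.
  move=> My; rewrite /F; have [y0|y0] := leP 0 y.
  - rewrite continuous_RintegralS//; last by lra.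
    have -> : \int[mu]_(t in `[y, 0]) f t = 0.
      move: y0; rewrite le_eqVlt => /orP[/eqP <-|y0]; first by rewrite set_itv1 Rintegral_set1.
      by rewrite set_itv_ge ?Rintegral_set0// bnd_simp -ltNge.
    by rewrite subr0.
  - rewrite [X in _ = X - _](_ : _ = 0) ?sub0r; last first.
      by rewrite set_itv_ge ?Rintegral_set0// bnd_simp -ltNge.
    rewrite -opprB; congr (- _).
    by rewrite continuous_RintegralS//; exact: ltW.
have [dF F'] := continuous_FTC1_closed Mx (continuous_integrable (- M) M cf) xM (cf x).
pose G y := \int[mu]_(t in `[(- M)%R, y]) f t - \int[mu]_(t in `[(-M)%R, 0%R]) f t.
have dI : is_derive x 1 (fun y => \int[mu]_(t in `[(- M)%R, y]) f t) (f x).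
  by apply: DeriveDef dF _; rewrite -F' derive1E.
have dG : is_derive x 1 G (f x).
  rewrite -[f x]subr0; exact: (is_deriveB dI (is_derive_cst _ _ _)).
apply: near_eq_is_derive dG.
near=> y; apply: key; near: y.
exact: lt_nbhsr.
Unshelve. all: by end_near. Qed.

Lemma integral_antiderivative F f a b : a <= b -> continuous f ->
  (forall x, is_derive x 1 F (f x)) -> \int[mu]_(x in `[a, b]) f x = F b - F a.
Proof.
move=> ab cf dF; have cF := is_derive_continuous dF.
move: ab; rewrite le_eqVlt => /orP[/eqP <-|ab].
  by rewrite set_itv1 Rintegral_set1 subrr.
rewrite /Rintegral (@continuous_FTC2 _ f F)//.
- exact: continuous_subspaceT.
- split.
  + by move=> y _; case: (dF y).
  + by apply: cvg_at_right_filter; exact: cF.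
  + by apply: cvg_at_left_filter; exact: cF.
- by move=> y _; rewrite derive1E; case: (dF y).
Qed.

Lemma is_derive_affine c d x : is_derive x 1 (fun x => c * x + d) c.
Proof. by apply: is_derive_eq; rewrite addr0 /GRing.scale/= mulr1. Qed.

Lemma is_derive_reflect d x : is_derive x 1 (fun x => d - x) (-1).
Proof. by apply: is_derive_eq; rewrite add0r mul1r. Qed.

Lemma continuous_affine c d : continuous (fun x => c * x + d).
Proof. exact: is_derive_continuous (is_derive_affine c d). Qed.

Lemma continuous_reflect d : continuous (fun x => d - x).
Proof. exact: is_derive_continuous (is_derive_reflect d). Qed.

Lemma integral_affine f a b c d : a <= b -> 0 < c -> continuous f ->
  \int[mu]_(x in `[a, b]) f (c * x + d) =
  c^-1 * \int[mu]_(x in `[(c * a + d)%R, (c * b + d)%R]) f x.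
Proof.
move=> ab c0 cf; have [F dF] := continuous_antiderivative cf.
have ab' : c * a + d <= c * b + d by rewrite lerD2r ler_pM2l.
have cfl : continuous (fun x => f (c * x + d)).
  by move=> x; apply: continuous_comp; [exact: continuous_affine|exact: cf].
have dFl x : is_derive x 1 (fun x => c^-1 * F (c * x + d)) (f (c * x + d)).
  have := @is_derive1_comp _ F _ x _ _ (dF (c * x + d)) (is_derive_affine c d x).
  move=> /(@is_deriveZ _ _ _ _ c^-1) h.
  by apply: is_derive_eq; rewrite /GRing.scale/= mulrCA mulVf ?mulr1// gt_eqF.
by rewrite (integral_antiderivative ab' cf dF) (integral_antiderivative ab cfl dFl) mulrBr.
Qed.

Lemma integral_shift f a b d : a <= b -> continuous f ->
  \int[mu]_(x in `[a, b]) f (x + d) = \int[mu]_(x in `[(a + d)%R, (b + d)%R]) f x.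
Proof.
move=> ab cf; have := integral_affine d ab ltr01 cf; rewrite invr1 !mul1r => <-.
by apply: eq_Rintegral => x _; rewrite mul1r.
Qed.

Lemma integral_reflect f a b d : a <= b -> continuous f ->
  \int[mu]_(x in `[a, b]) f (d - x) =
  \int[mu]_(x in `[(d - b)%R, (d - a)%R]) f x.
Proof.
move=> ab cf; have [F dF] := continuous_antiderivative cf.
have ab' : d - b <= d - a by rewrite lerD2l lerN2.
have cfl : continuous (fun x => f (d - x)).
  by move=> x; apply: continuous_comp; [exact: continuous_reflect|exact: cf].
have dFl x : is_derive x 1 (fun x => - F (d - x)) (f (d - x)).
  have := @is_derive1_comp _ F _ x _ _ (dF (d - x)) (is_derive_reflect d x).
  move=> /is_deriveN h.
  by apply: is_derive_eq; rewrite mulrN1 opprK.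
by rewrite (integral_antiderivative ab' cf dF) (integral_antiderivative ab cfl dFl) opprK addrC.
Qed.

Lemma integral_split f a b c : a <= b -> b <= c -> continuous f ->
  \int[mu]_(x in `[a, c]) f x =
  \int[mu]_(x in `[a, b]) f x + \int[mu]_(x in `[b, c]) f x.
Proof.
move=> ab bc cf; have [F dF] := continuous_antiderivative cf.
rewrite (integral_antiderivative (le_trans ab bc) cf dF).
by rewrite (integral_antiderivative ab cf dF) (integral_antiderivative bc cf dF) (addrC (_ - _)) addrA subrK.
Qed.

Lemma continuous_RintegralD a b f g : continuous f -> continuous g ->
  \int[mu]_(x in `[a, b]) (f x + g x) =
  \int[mu]_(x in `[a, b]) f x + \int[mu]_(x in `[a, b]) g x.
Proof. by move=> cf cg; apply: RintegralD => //; exact: continuous_integrable. Qed.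

Lemma continuous_RintegralB a b f g : continuous f -> continuous g ->
  \int[mu]_(x in `[a, b]) (f x - g x) =
  \int[mu]_(x in `[a, b]) f x - \int[mu]_(x in `[a, b]) g x.
Proof. by move=> cf cg; apply: RintegralB => //; exact: continuous_integrable. Qed.

Lemma continuous_RintegralZ a b f r : continuous f ->
  \int[mu]_(x in `[a, b]) (r * f x) = r * \int[mu]_(x in `[a, b]) f x.
Proof. by move=> cf; apply: RintegralZl => //; exact: continuous_integrable. Qed.

Lemma itv_Rintegral_cst a b r : a <= b -> \int[mu]_(x in `[a, b]) r = r * (b - a).
Proof.
move=> ab; rewrite (integral_antiderivative ab (@cst_continuous _ _ r) (is_derive_affine r 0)).
by rewrite !addr0 mulrBr.
Qed.

Lemma integral_bound a b f M : a <= b -> continuous f ->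
  (forall x, a <= x <= b -> `|f x| <= M) ->
  `|\int[mu]_(x in `[a, b]) f x| <= M * (b - a).
Proof.
move=> ab cf fM; rewrite -itv_Rintegral_cst//.
apply: le_trans (le_normr_Rintegral _ (continuous_integrable a b cf)) _ => //.
apply: le_Rintegral => //.
- by apply/integrable_norm/continuous_integrable.
- by apply: continuous_integrable; exact: cst_continuous.
Qed.

Lemma eq_itv_Rintegral a b f g : (forall x, a <= x <= b -> f x = g x) ->
  \int[mu]_(x in `[a, b]) f x = \int[mu]_(x in `[a, b]) g x.
Proof. by move=> fg; apply: eq_Rintegral => x; rewrite inE/= in_itv/=; exact: fg. Qed.

Lemma Rintegral_eq0 a b f : (forall x, a <= x <= b -> f x = 0) ->
  \int[mu]_(x in `[a, b]) f x = 0.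
Proof.
move=> f0; rewrite (@eq_itv_Rintegral _ _ _ (fun=> 0))//.
by rewrite Rintegral_cst// mul0r.
Qed.

Lemma integral_widen f a b c d : a <= b -> b <= c -> c <= d -> continuous f ->
  (forall x, a <= x <= d -> (x <= b) || (c <= x) -> f x = 0) ->
  \int[mu]_(x in `[a, d]) f x = \int[mu]_(x in `[b, c]) f x.
Proof.
move=> ab bc cd cf f0.
rewrite (@integral_split _ a b)//; last exact: le_trans cd.
rewrite (@integral_split _ b c)// Rintegral_eq0 ?add0r; last first.
  by move=> x /andP[ax xb]; apply: f0; rewrite ?xb// ax (le_trans xb)// (le_trans bc).
rewrite [X in _ + X]Rintegral_eq0 ?addr0// => x /andP[cx xd].
by apply: f0; rewrite ?cx ?orbT// xd (le_trans ab)// (le_trans bc).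
Qed.

Lemma integration_by_parts_vanishing f g df dg a b : a <= b ->
  (forall x, is_derive x 1 f (df x)) -> (forall x, is_derive x 1 g (dg x)) ->
  continuous df -> continuous dg -> f a = 0 -> f b = 0 ->
  \int[mu]_(x in `[a, b]) (f x * dg x) = - \int[mu]_(x in `[a, b]) (df x * g x).
Proof.
move=> ab hf hg cdf cdg fa fb.
have cf := is_derive_continuous hf; have cg := is_derive_continuous hg.
have c1 : continuous (fun x => f x * dg x) by move=> x; apply: continuousM; [exact: cf|exact: cdg].
have c2 : continuous (fun x => df x * g x) by move=> x; apply: continuousM; [exact: cdf|exact: cg].
have cD : continuous (fun x => f x * dg x + df x * g x).
  by move=> x; apply: cvgD; [exact: c1|exact: c2].
have dD x : is_derive x 1 (fun x => f x * g x) (f x * dg x + df x * g x).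
  have h1 := hf x; have h2 := hg x.
  by apply: is_derive_eq; rewrite /GRing.scale/= (mulrC (g x)).
apply/eqP; rewrite -subr_eq0 opprK -continuous_RintegralD//; apply/eqP.
by rewrite (integral_antiderivative ab cD dD) fa fb !mul0r subrr.
Qed.

End Integration.

(** * Dominated convergence and integrability for real-valued integrals *)

Section AbstractIntegration.
Variables (R : realType) (d : measure_display) (T : measurableType d).
Variable mu : {measure set T -> \bar R}.
Implicit Types (f g : T -> R) (D : set T).

Lemma Rintegral_dominated_cvg_ae D (fn : nat -> T -> R) f g : measurable D ->
  (forall n, measurable_fun D (fn n)) -> measurable_fun D f ->
  {ae mu, forall x, D x -> fn n x @[n --> \oo] --> f x} ->
  mu.-integrable D (EFin \o g) ->
  (forall n x, D x -> `|fn n x| <= g x) ->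
  mu.-integrable D (EFin \o f) /\
  \int[mu]_(x in D) fn n x @[n --> \oo] --> \int[mu]_(x in D) f x.
Proof.
move=> mD mfn mf fnf ig fng.
have m1 n : measurable_fun D (EFin \o fn n) by exact/measurable_EFinP.
have m2 : measurable_fun D (EFin \o f) by exact/measurable_EFinP.
have m3 : {ae mu, forall x, D x -> (EFin \o fn n) x @[n --> \oo] --> (EFin \o f) x}.
  apply: filterS fnf => x fx Dx; apply: cvg_EFin; [exact: nearW|exact: fx].
have m4 : {ae mu, forall x, forall n, D x -> (`|(EFin \o fn n) x| <= (EFin \o g) x)%E}.
  by apply: aeW => x n Dx; rewrite /= lee_fin; exact: fng.
have [fi _ cv] := dominated_convergence mD m1 m2 m3 ig m4.
split => //; apply: fine_cvg; rewrite fineK//.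
exact: integrable_fin_num.
Qed.

Lemma Rintegral_dominated_cvg D (fn : nat -> T -> R) f g : measurable D ->
  (forall n, measurable_fun D (fn n)) ->
  (forall x, D x -> fn n x @[n --> \oo] --> f x) ->
  mu.-integrable D (EFin \o g) ->
  (forall n x, D x -> `|fn n x| <= g x) ->
  mu.-integrable D (EFin \o f) /\
  \int[mu]_(x in D) fn n x @[n --> \oo] --> \int[mu]_(x in D) f x.
Proof.
move=> mD mfn fnf; apply: Rintegral_dominated_cvg_ae => //; last exact: aeW.
exact: (measurable_fun_cvg mfn fnf).
Qed.

Lemma Rintegrable_le D f g : measurable D -> measurable_fun D f ->
  mu.-integrable D (EFin \o g) -> (forall x, D x -> `|f x| <= g x) ->
  mu.-integrable D (EFin \o f).
Proof.
move=> mD mf ig fg; apply: le_integrable ig => //; first exact/measurable_EFinP.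
by move=> x Dx /=; rewrite lee_fin (le_trans (fg x Dx)) ?ler_norm.
Qed.

Lemma RintegrableD D f g : measurable D -> mu.-integrable D (EFin \o f) ->
  mu.-integrable D (EFin \o g) -> mu.-integrable D (EFin \o (fun x => f x + g x)).
Proof. by move=> mD fi gi; exact: (@integrableD _ _ _ mu D mD (EFin \o f) (EFin \o g)). Qed.

Lemma RintegrableZ D k f : measurable D -> mu.-integrable D (EFin \o f) ->
  mu.-integrable D (EFin \o (fun x => k * f x)).
Proof. by move=> mD fi; exact: (@integrableZl _ _ _ mu D mD k (EFin \o f)). Qed.

Lemma integrable_mul_sqr D f g : measurable D -> measurable_fun D f -> measurable_fun D g ->
  mu.-integrable D (EFin \o (fun x => f x ^+ 2)) ->
  mu.-integrable D (EFin \o (fun x => g x ^+ 2)) ->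
  mu.-integrable D (EFin \o (fun x => f x * g x)).
Proof.
move=> mD mf mg if2 ig2.
have iD : mu.-integrable D (EFin \o (fun x => f x ^+ 2 + g x ^+ 2)) by exact: RintegrableD.
apply: Rintegrable_le iD _ => //; first exact: measurable_funM.
move=> x _; have := sqr_ge0 (f x - g x); have := sqr_ge0 (f x + g x).
have := sqr_ge0 (f x); have := sqr_ge0 (g x).
by case: (lerP 0 (f x * g x)) => [/ger0_norm|/ltr0_norm] ->; nra.
Qed.

End AbstractIntegration.

(** * Exchange of integrals *)

Section Swap.
Variables (R : realType) (d1 d2 : measure_display) (T1 : measurableType d1) (T2 : measurableType d2).
Variables (m1 : {sigma_finite_measure set T1 -> \bar R}) (m2 : {sigma_finite_measure set T2 -> \bar R}).

(** A majorant that splits as a product makes Tonelli's condition immediate; Fubini is then applied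
    to [F] times the indicators of [D1] and [D2]. *)
Lemma Rintegral_swap (D1 : set T1) (D2 : set T2) (F : T1 -> T2 -> R) (g : T1 -> R) (h : T2 ->
    R) : measurable D1 -> measurable D2 ->
  measurable_fun setT (fun z : T1 * T2 => F z.1 z.2) ->
  m1.-integrable D1 (EFin \o g) -> m2.-integrable D2 (EFin \o h) ->
  (forall x y, D1 x -> D2 y -> `|F x y| <= g x * h y) ->
  \int[m1]_(x in D1) \int[m2]_(y in D2) F x y =
  \int[m2]_(y in D2) \int[m1]_(x in D1) F x y.
Proof.
move=> mD1 mD2 mF ig ih Fgh.
pose G (z : T1 * T2) := \1_D1 z.1 * \1_D2 z.2 * F z.1 z.2 : R.
have mG : measurable_fun setT G.
  apply: measurable_funM; [apply: measurable_funM|exact: mF].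
  - by apply: measurableT_comp; [exact: measurable_indic|exact: measurable_fst].
  - by apply: measurableT_comp; [exact: measurable_indic|exact: measurable_snd].
(* Absolute values, because only the product [g x * h y] is known to be nonnegative. *)
pose g' x := \1_D1 x * `|g x|; pose h' y := \1_D2 y * `|h y|.
have ig' : m1.-integrable setT (EFin \o g').
  have [/(_ (integrable_norm ig)) + _] := @integrable_mkcond _ _ _ m1 D1 (EFin \o (Num.norm \o g)) mD1.
  apply: eq_integrable => // x _.
  by rewrite /= /g' patchE indicE; case: ifPn => _; rewrite ?mul1r ?mul0r.
have ih' : m2.-integrable setT (EFin \o h').
  have [/(_ (integrable_norm ih)) + _] := @integrable_mkcond _ _ _ m2 D2 (EFin \o (Num.norm \o h)) mD2.
  apply: eq_integrable => // x _.
  by rewrite /= /h' patchE indicE; case: ifPn => _; rewrite ?mul1r ?mul0r.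
have Gle x y : `|G (x, y)| <= g' x * h' y.
  rewrite /G /g' /h' /= !indicE.
  have [D1x|_] := boolP (x \in D1); last by rewrite !mul0r normr0.
  have [D2y|_] := boolP (y \in D2); last by rewrite !(mul0r, mulr0) normr0.
  rewrite !mul1r (le_trans (Fgh _ _ _ _)) ?inE//; first exact: set_mem.
  - exact: set_mem.
  - by rewrite -normrM ler_norm.
have iG : (m1 \x m2)%E.-integrable setT (EFin \o G).
  apply/integrable12ltyP; first exact/measurable_EFinP.
  pose H := (\int[m2]_y h' y).
  have iH : (\int[m2]_y (h' y)%:E = H%:E)%E.
    by rewrite /H /Rintegral fineK//; exact: integrable_fin_num.
  apply: (@le_lt_trans _ _ (\int[m1]_x (H%:E * (g' x)%:E))%E); last first.
    rewrite integralZl// -(fineK (integrable_fin_num _ ig'))//.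
    by rewrite -EFinM ltry.
  apply: ge0_le_integral => //.
  - by move=> x _; exact: integral_ge0.
  - have := @measurable_fun_fubini_tonelli_F _ _ _ _ R m2 (fun z => `|(EFin \o G) z|%E).
    apply => //; apply/measurableT_comp => //; exact/measurable_EFinP.
  - apply: emeasurable_funM => //; apply/measurable_EFinP.
    by have /measurable_int/measurable_EFinP := ig'.
  move=> x _; rewrite -iH muleC -integralZl//.
  apply: ge0_le_integral => //.
  - apply/measurableT_comp => //; apply/measurable_EFinP.
    exact: (measurableT_comp mG (measurable_pair1 x)).
  - apply: emeasurable_funM => //; apply/measurable_EFinP.
    by have /measurable_int/measurable_EFinP := ih'.
  - by move=> y _; rewrite /= -EFinM lee_fin; exact: Gle.
have FE := Fubini iG.
have R1 x : (\int[m2]_y (G (x, y))%:E = ((\1_D1 x) * \int[m2]_(y in D2) F x y)%:E)%E.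
  have [D1x|nD1x] := boolP (x \in D1); last first.
    rewrite indicE (negbTE nD1x) mul0r integral0_eq// => y _.
    by rewrite /G /= indicE (negbTE nD1x) !mul0r.
  rewrite indicE D1x mul1r /Rintegral fineK; last first.
    apply: integrable_fin_num => //.
    apply: (@Rintegrable_le _ _ _ _ _ _ (fun y => g x * h y)) => //.
    - by apply: measurable_funTS; exact: (measurableT_comp mF (measurable_pair1 x)).
    - by apply: RintegrableZ.
    - by move=> y; apply: Fgh; exact: set_mem.
  rewrite [RHS]integral_mkcond; apply: eq_integral => y _.
  rewrite patchE /G /= !indicE D1x mul1r.
  by case: ifPn => _; rewrite ?mul1r ?mul0r.
have R2 y : (\int[m1]_x (G (x, y))%:E = ((\1_D2 y) * \int[m1]_(x in D1) F x y)%:E)%E.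
  have [D2y|nD2y] := boolP (y \in D2); last first.
    rewrite indicE (negbTE nD2y) mul0r integral0_eq// => x _.
    by rewrite /G /= [\1_D2 _]indicE (negbTE nD2y) !(mul0r, mulr0).
  rewrite indicE D2y mul1r /Rintegral fineK; last first.
    apply: integrable_fin_num => //.
    apply: (@Rintegrable_le _ _ _ _ _ _ (fun x => h y * g x)) => //.
    - by apply: measurable_funTS; exact: (measurableT_comp mF (measurable_pair2 y)).
    - by apply: RintegrableZ.
    - by move=> x D1x; rewrite mulrC; apply: Fgh => //; exact: set_mem.
  rewrite [RHS]integral_mkcond; apply: eq_integral => x _.
  rewrite patchE /G /= !indicE D2y mulr1.
  by case: ifPn => _; rewrite ?mul1r ?mul0r.
move: FE; under eq_integral do rewrite R1.
under [X in _ = X -> _]eq_integral do rewrite R2.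
move=> FE; rewrite Rintegral_mkcond [RHS]Rintegral_mkcond /Rintegral.
congr fine; move: FE; congr (_ = _); apply: eq_integral => x _;
  by rewrite patchE indicE; case: ifPn => _; rewrite ?mul1r ?mul0r.
Qed.

End Swap.

(** * The Cauchy density, and functions with vanishing interval integrals *)

Section LebesgueTools.
Variable R : realType.
Local Notation mu := (@lebesgue_measure R).
Implicit Types (f g F G : R -> R) (D : set R) (a b c d x y : R).

(** This is the common majorant of all transforms and kernels below. The case [c = 0] comes from the
    arctangent integral and symmetry; other centres follow from
    [1 + x^2 <= (2 + 2 c^2) (1 + (x - c)^2)]. *)
Lemma integrable_inv_oneDsqr c : mu.-integrable setT (EFin \o (fun x => (1 + (x - c) ^+ 2)^-1)).
Proof.
have cV (d : R) : continuous (fun x : R => (1 + (x - d) ^+ 2)^-1).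
  move=> x; apply: (@continuousV _ _ (fun x : R => 1 + (x - d) ^+ 2)).
    by rewrite gt_eqF// ltr_pwDl// sqr_ge0.
  have cB : {for x, continuous (fun x : R => x - d)} by apply: cvgB; [exact: cvg_id|exact: cvg_cst].
  by apply: cvgD; [exact: cvg_cst|rewrite expr2; apply: cvgM].
pose h (x : R) := (1 + (x - 0) ^+ 2)^-1.
have mh : measurable_fun setT h by apply: continuous_measurable_fun; exact: cV.
have h0 x : 0 <= h x by rewrite invr_ge0 addr_ge0// sqr_ge0.
have lth : (\int[mu]_x (h x)%:E < +oo)%E.
  rewrite ge0_symfun_integralT//; [|exact: cV|by move=> x /=; rewrite /h !subr0 sqrrN].
  rewrite -set_itvcy.
  have -> : (\int[mu]_(x in `[0%R, +oo[) (h x)%:E = (pi / 2)%:E)%E.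
    rewrite -(integral0y_oneDsqr R); apply: eq_integral => x _.
    by rewrite /h subr0 /oneDsqr.
  by rewrite -EFinM ltry.
have ih : mu.-integrable setT (EFin \o h).
  apply/integrableP; split; first exact/measurable_EFinP.
  apply: le_lt_trans lth; rewrite le_eqVlt; apply/orP; left; apply/eqP.
  by apply: eq_integral => x _; rewrite /= ger0_norm.
have i0 : mu.-integrable setT (EFin \o (fun x => (2 + 2 * c ^+ 2) * h x)) by exact: RintegrableZ.
apply: Rintegrable_le i0 _ => //.
  by apply: (@continuous_measurable_fun R (fun x : R => (1 + (x - c) ^+ 2)^-1)); exact: cV.
move=> x _; rewrite /h subr0 ger0_norm ?invr_ge0 ?addr_ge0 ?sqr_ge0//.
rewrite ler_pdivlMr ?ltr_pwDl ?sqr_ge0// mulrC ler_pdivrMr ?ltr_pwDl ?sqr_ge0//.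
have := sqr_ge0 (x - 2 * c); have := sqr_ge0 (c * (x - c)); nra.
Qed.

(** Lebesgue differentiation: for each [n] the integral of [f] from [-n] has derivative [f x] at
    almost every [x > -n], and it is constantly [0]. The countably many exceptional sets are
    discarded together. *)
Lemma ae_eq0_of_itv_integral f : measurable_fun setT f ->
  (forall a b, mu.-integrable `[a, b] (EFin \o f)) ->
  (forall a b, a < b -> \int[mu]_(x in `[a, b]) f x = 0) ->
  {ae mu, forall x, f x = 0}.
Proof.
move=> mf intf f0.
have lf : locally_integrable setT f.
  split=> // [|K _ cK]; first exact: openT.
  have /compact_bounded[M [_ /(_ (M + 1))]] := cK.
  rewrite ltrDl => /(_ ltr01) KM.
  have KS : K `<=` `[- (M + 1), M + 1].
    by move=> x Kx; rewrite /= in_itv/= -ler_norml; exact: KM.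
  have iK : mu.-integrable K (EFin \o f).
    apply: (@integrableS _ _ _ mu _ K) KS (intf _ _) => //; exact: compact_measurable.
  by have /integrableP[_] := iK.
have : {ae mu, forall x, forall n : nat, - n%:R < x -> f x = 0}.
  apply: ae_foralln => n.
  have := @FTC1 R f (BLeft (- n%:R)) (fun y => intf _ y) lf.
  apply: filterS; first exact: (ae_filter_ringOfSetsType mu).
  move=> x /= fx nx.
  have [|_ <-] := fx; first by rewrite lte_fin.
  have d0 : is_derive x 1 (fun y => \int[mu]_(t in `[(- n%:R)%R, y]) f t) 0.
    apply: near_eq_is_derive (is_derive_cst (0 : R) x 1).
    by near=> y; rewrite f0//; near: y; exact: lt_nbhsr.
  by rewrite derive1E; exact: (@derive_val _ _ _ _ _ _ _ d0).
apply: filterS; first exact: (ae_filter_ringOfSetsType mu).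
move=> x /(_ (Num.trunc `|x|).+1); apply.
by rewrite ltrNl (le_lt_trans (ler_norm _))// normrN truncnS_gt.
Unshelve. all: by end_near. Qed.

End LebesgueTools.

(** * Symmetric sums over the integers *)

Section BilateralSums.
Variable R : realType.
Local Notation mu := (@lebesgue_measure R).
Implicit Types (F G : int -> R) (a b c x y : R) (N : nat).

(** Symmetric partial sum over [-N, ..., N]; the symmetry is what makes sine terms cancel and the
    Dirichlet kernel appear. *)
Fixpoint zsum N F : R :=
  if N is M.+1 then zsum M F + (F M.+1%:Z + F (- M.+1%:Z)) else F 0.

Lemma eq_zsum N F G : (forall k, F k = G k) -> zsum N F = zsum N G.
Proof. by move=> FG; elim: N => [|N /= ->]; rewrite /= !FG. Qed.

Lemma zsumD N F G : zsum N (fun k => F k + G k) = zsum N F + zsum N G.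
Proof. by elim: N => [//|N /= ->]; ring. Qed.

Lemma zsumB N F G : zsum N (fun k => F k - G k) = zsum N F - zsum N G.
Proof. by elim: N => [//|N /= ->]; ring. Qed.

Lemma zsumZ N r F : zsum N (fun k => r * F k) = r * zsum N F.
Proof. by elim: N => [//|N /= ->]; ring. Qed.

Lemma ler_zsum N F G : (forall k, F k <= G k) -> zsum N F <= zsum N G.
Proof. by move=> FG; elim: N => [|N /= IH]; rewrite /= ?lerD. Qed.

Lemma ler_norm_zsum N F : `|zsum N F| <= zsum N (fun k => `|F k|).
Proof.
elim: N => [//|N /= IH]; apply: le_trans (ler_normD _ _) _.
by rewrite lerD// ler_normD.
Qed.

Lemma zsum_telescope N G : zsum N (fun k => G (k + 1) - G k) = G N.+1%:Z - G (- N%:Z).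
Proof.
elim: N => [|N /= ->]; first by rewrite /= add0r oppr0.
have -> : - N.+1%:Z + 1 = - N%:Z by rewrite -addn1 PoszD; ring.
have -> : N.+1%:Z + 1 = N.+2%:Z by rewrite -[in RHS]addn1 PoszD.
ring.
Qed.

Lemma zsum_continuous N (f : int -> R -> R) :
  (forall k, continuous (f k)) -> continuous (fun x => zsum N (f ^~ x)).
Proof.
move=> cf; elim: N => [|N IH] /= x; first exact: cf.
by apply: cvgD; [exact: IH|apply: cvgD; exact: cf].
Qed.

Lemma zsum_measurable d (T : measurableType d) N (f : int -> T -> R) (D : set T) :
  (forall k, measurable_fun D (f k)) -> measurable_fun D (fun z => zsum N (f ^~ z)).
Proof.
move=> mf; elim: N => [|N IH] /=; first exact: mf.
by apply: measurable_funD => //; exact: measurable_funD.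
Qed.

Lemma Rintegral_zsum a b N (f : int -> R -> R) : (forall k, continuous (f k)) ->
  \int[mu]_(x in `[a, b]) zsum N (f ^~ x) = zsum N (fun k => \int[mu]_(x in `[a, b]) f k x).
Proof.
move=> cf; elim: N => [//|N IH] /=.
rewrite continuous_RintegralD; [|exact: zsum_continuous|by move=> x; apply: cvgD; exact: cf].
by rewrite continuous_RintegralD// IH.
Qed.

Lemma zsum_integral_translates a N (f : R -> R) : continuous f ->
  zsum N (fun k => \int[mu]_(x in `[a, (a + 1)%R]) f (x + k%:~R)) =
  \int[mu]_(x in `[(a - N%:R)%R, (a + 1 + N%:R)%R]) f x.
Proof.
move=> cf.
have sh (k : R) : \int[mu]_(x in `[a, (a + 1)%R]) f (x + k) =
    \int[mu]_(x in `[(a + k)%R, (a + 1 + k)%R]) f x.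
  by rewrite integral_shift// lerDl.
elim: N => [|N IH] /=; first by rewrite sh subr0 !addr0.
rewrite IH !sh mulrNz -pmulrn -natr1.
move: N%:R (ler0n R N) => n n0.
rewrite [in RHS](@integral_split _ f _ (a - n) (a + 1 + (n + 1))); [|lra|lra|exact: cf].
rewrite [in RHS](@integral_split _ f (a - n) (a + 1 + n) (a + 1 + (n + 1))); [|lra|lra|exact: cf].
have -> : a + 1 + n = a + (n + 1) by ring.
have -> : a + 1 - (n + 1) = a - n by ring.
ring.
Qed.

(** Each term is at most twice the increment of [atan] over the unit interval centred at [k - x]:
    the mean value point is within [1/2] of the centre. The increments telescope to less than [pi],
    and [2 pi < 8]. *)
Lemma zsum_inv_oneDsqr N x : zsum N (fun k => (1 + (x - k%:~R) ^+ 2)^-1) <= 8.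
Proof.
pose G (k : int) : R := 2 * atan (k%:~R - 1 / 2 - x).
apply: le_trans (_ : zsum N (fun k => G (k + 1) - G k) <= _); last first.
  rewrite zsum_telescope /G; have := atan_ltpi2 (N.+1%:Z%:~R - 1 / 2 - x).
  have := atan_gtNpi2 ((- N%:Z)%:~R - 1 / 2 - x); have := @pihalf_lt2 R; lra.
apply: ler_zsum => k; rewrite /G intrD.
set u : R := k%:~R - 1 / 2 - x.
have -> : k%:~R + 1%:~R - 1 / 2 - x = u + 1 by rewrite /u; ring.
have u1 : u < u + 1 by rewrite ltrDl.
have catan : {within `[u, u + 1], continuous (@atan R)}.
  by apply: continuous_subspaceT => y; exact: continuous_atan.
have [c cu] := @MVT R atan (fun y => (1 + y ^+ 2)^-1) u (u + 1) u1 (fun y _ => is_derive1_atan y) catan.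
rewrite -mulrBr => ->.
have -> : u + 1 - u = 1 by ring.
rewrite mulr1 mulrC.
rewrite ler_pdivlMl ?ltr_pwDl ?sqr_ge0// ler_pdivrMr ?ltr_pwDl ?sqr_ge0//.
have -> : x - k%:~R = - (u + 1 / 2) by rewrite /u; ring.
move: cu; rewrite in_itv/= => /andP[uc cu].
pose d := c - (u + 1 / 2); have -> : c = u + 1 / 2 + d by rewrite /d; ring.
have : d ^+ 2 <= 1 / 4 by rewrite /d; nra.
by have := sqr_ge0 (u + 1 / 2 - d); nra.
Qed.

(** With [P], [Q], [T] the three denominators, [T <= 2 (P + Q)] gives
    [1 / (P Q) <= 2 / T (1 / P + 1 / Q)]; each of the two remaining sums is at most [8]. *)
Lemma zsum_inv_oneDsqrM N x y :
  zsum N (fun k => (1 + (x - k%:~R) ^+ 2)^-1 * (1 + (y - k%:~R) ^+ 2)^-1) <=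
  32 * (1 + (x - y) ^+ 2)^-1.
Proof.
apply: le_trans (_ : zsum N (fun k => 2 * (1 + (x - y) ^+ 2)^-1 *
   ((1 + (x - k%:~R) ^+ 2)^-1 + (1 + (y - k%:~R) ^+ 2)^-1)) <= _); last first.
  rewrite zsumZ zsumD; have := zsum_inv_oneDsqr N x; have := zsum_inv_oneDsqr N y.
  have : 0 <= (1 + (x - y) ^+ 2)^-1 by rewrite invr_ge0 addr_ge0 ?sqr_ge0.
  by move: (_^-1) (zsum _ _) (zsum _ _) => p u v; nra.
apply: ler_zsum => k.
have P0 : 0 < 1 + (x - k%:~R) ^+ 2 by rewrite ltr_pwDl ?sqr_ge0.
have Q0 : 0 < 1 + (y - k%:~R) ^+ 2 by rewrite ltr_pwDl ?sqr_ge0.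
have T0 : 0 < 1 + (x - y) ^+ 2 by rewrite ltr_pwDl ?sqr_ge0.
have PQ : 1 + (x - y) ^+ 2 <= 2 * (1 + (x - k%:~R) ^+ 2 + (1 + (y - k%:~R) ^+ 2)).
  have -> : x - y = (x - k%:~R) - (y - k%:~R) by ring.
  move: (x - k%:~R) (y - k%:~R) => p q; have := sqr_ge0 (p + q); nra.
move: (1 + (x - k%:~R) ^+ 2) (1 + (y - k%:~R) ^+ 2) (1 + (x - y) ^+ 2) P0 Q0 T0 PQ => P Q T P0 Q0 T0 PQ.
have -> : 2 * T^-1 * (P^-1 + Q^-1) = 2 * (P + Q) / (T * (P * Q)) by field; rewrite !gt_eqF.
rewrite -invfM ler_pdivlMr ?mulr_gt0// mulrC -mulrA divff ?mulr1// gt_eqF ?mulr_gt0//.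
Qed.

End BilateralSums.

(** * Trigonometric kernels and Riemann-Lebesgue *)

Section CosineKernels.
Variable R : realType.
Local Notation mu := (@lebesgue_measure R).
Implicit Types (f w q : R -> R) (a b c s t x y xi : R) (N m n : nat).

Definition cosp x : R := cos (2 * pi * x).

Lemma periodic_int f x (k : int) : periodic f (pi *+ 2) ->
  f (2 * pi * (x + k%:~R)) = f (2 * pi * x).
Proof.
move=> pf.
have P y n : f (2 * pi * (y + n%:R)) = f (2 * pi * y).
  rewrite -[RHS](periodicn pf n); congr f.
  by rewrite -[_ *+ n]mulr_natr -[_ *+ 2]mulr_natr; ring.
case: k => n; first exact: P.
by rewrite NegzE mulrNz -[in LHS](P _ n.+1) -pmulrn subrK.
Qed.

Lemma sin_period x (k : int) : sin (2 * pi * (x + k%:~R)) = sin (2 * pi * x).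
Proof. exact/periodic_int/sinD2pi. Qed.

Lemma cosp_period x (k : int) : cosp (x + k%:~R) = cosp x.
Proof. exact/periodic_int/cosD2pi. Qed.

Lemma cosp_opp x : cosp (- x) = cosp x.
Proof. by rewrite /cosp mulrN cosN. Qed.

Lemma cosp0 : cosp 0 = 1.
Proof. by rewrite /cosp mulr0 cos0. Qed.

Lemma cosp_max x : `|cosp x| <= 1.
Proof. exact: cos_max. Qed.

Lemma is_derive_cosp a b t :
  is_derive t 1 (fun t => cosp (a * t + b)) (- (2 * pi * a) * sin (2 * pi * (a * t + b))).
Proof.
have h : is_derive t 1 (fun t => 2 * pi * (a * t + b)) (2 * pi * a).
  by have h := is_derive_affine a b t; apply: is_derive_eq.
have := @is_derive1_comp _ cos _ t _ _ (is_derive_cos _) h.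
by move=> k; apply: is_derive_eq; rewrite mulNr mulrC mulNr.
Qed.

Lemma is_derive_sinp a b t :
  is_derive t 1 (fun t => sin (2 * pi * (a * t + b))) ((2 * pi * a) * cosp (a * t + b)).
Proof.
have h : is_derive t 1 (fun t => 2 * pi * (a * t + b)) (2 * pi * a).
  by have h := is_derive_affine a b t; apply: is_derive_eq.
have := @is_derive1_comp _ sin _ t _ _ (is_derive_sin _) h.
by move=> k; apply: is_derive_eq; rewrite mulrC.
Qed.

Lemma cosp_continuous a b : continuous (fun t => cosp (a * t + b)).
Proof. exact: is_derive_continuous (is_derive_cosp a b). Qed.

Lemma cosp_continuousM a : continuous (fun t => cosp (a * t)).
Proof.
rewrite (_ : (fun t => _) = (fun t => cosp (a * t + 0))); first exact: cosp_continuous.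
by apply/funext => t; rewrite addr0.
Qed.

Lemma integral_cosp (k : int) : \int[mu]_(s in `[- (1 / 2), (1 / 2)%R]) cosp (k%:~R * s) = (k == 0)%:R.
Proof.
have h2 : - (1 / 2) <= 1 / 2 :> R by lra.
have [->|k0] := eqVneq k 0.
  rewrite (@eq_itv_Rintegral _ _ _ _ (fun=> 1)); last by move=> x _; rewrite mul0r cosp0.
  by rewrite itv_Rintegral_cst//=; field.
have pi0 := @pi_gt0 R.
have kR : (2 * pi * k%:~R : R) != 0 by rewrite mulf_neq0 ?intr_eq0// gt_eqF// mulr_gt0.
have dF s : is_derive s 1 (fun s => (2 * pi * k%:~R)^-1 * sin (2 * pi * (k%:~R * s + 0))) (cosp (k%:~R * s)).
  have h := is_derive_sinp k%:~R 0 s.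
  by apply: is_derive_eq; rewrite /GRing.scale/= mulrA mulVf// mul1r addr0.
rewrite (integral_antiderivative h2 (@cosp_continuousM _) dF) !addr0.
rewrite -mulrBr -(@sin_period (k%:~R * (- (1/2))) k).
have -> : k%:~R * - (1 / 2) + k%:~R = k%:~R * (1 / 2) :> R by field.
by rewrite subrr mulr0.
Qed.

Definition dirichlet N s : R := zsum N (fun k => cosp (k%:~R * s)).

Lemma dirichlet_continuous N : continuous (dirichlet N).
Proof.
by apply: zsum_continuous => k; exact: cosp_continuousM.
Qed.

Lemma dirichlet_period N s (k : int) : dirichlet N (s + k%:~R) = dirichlet N s.
Proof. by apply: eq_zsum => j; rewrite mulrDr -intrM cosp_period. Qed.

Lemma zsum_cosp N a b : zsum N (fun k => cosp (a - k%:~R * b)) = cosp a * dirichlet N b.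
Proof.
rewrite /dirichlet; elim: N => [|N IH] /=; first by rewrite mul0r subr0 cosp0 mulr1.
rewrite IH mulrDr; congr (_ + _).
rewrite mulrNz !mulNr opprK cosp_opp /cosp !mulrBr !mulrDr cosB cosD; ring.
Qed.

Lemma dirichlet_sin N s : dirichlet N s * sin (pi * s) = sin ((N.*2.+1)%:R * pi * s).
Proof.
rewrite /dirichlet; elim: N => [|N IH] /=; first by rewrite mul0r cosp0 !mul1r.
rewrite mulrDl IH mulrNz mulNr cosp_opp -pmulrn /cosp.
have -> : (N.+1).*2.+1%:R * pi * s = 2 * pi * (N.+1%:R * s) + pi * s :> R.
  by rewrite doubleS -[in RHS]natr1 -addn3 natrD -muln2 natrM; ring.
have -> : N.*2.+1%:R * pi * s = 2 * pi * (N.+1%:R * s) - pi * s :> R.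
  by rewrite -[in RHS]natr1 -addn1 natrD -muln2 natrM; ring.
by rewrite addrC [in RHS]sinD [in X in _ + X = _]sinB; ring.
Qed.

Lemma integral_dirichlet N : \int[mu]_(s in `[- (1 / 2), (1 / 2)%R]) dirichlet N s = 1.
Proof.
rewrite Rintegral_zsum => [|k]; last exact: cosp_continuousM.
rewrite (@eq_zsum _ _ _ (fun k => (k == 0)%:R)) => [|k]; last exact: integral_cosp.
by elim: N => [|N /= ->]; rewrite //= !addr0.
Qed.

(** A crude Jordan inequality: [sin u = 2 cos (u/2) sin (u/2)] and [sin (u/2) = (u/2) cos v] with
    [v] below [u/2]. Both cosines are at least [cos (pi/4)], whose square is [1/2]. *)
Lemma sin_ge_half (u : R) : 0 <= u <= pi / 2 -> u / 2 <= sin u.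
Proof.
move=> /andP[u0 up].
have pi0 := @pi_gt0 R.
have cc v : 0 <= v <= u / 2 -> cos (pi / 4) <= cos v.
  move=> /andP[v0 vu]; rewrite leNgt ltr_cos ?in_itv/= -?leNgt; [lra|apply/andP; split;
      lra|apply/andP; split; lra].
have c4 : 0 <= cos (pi / 4 : R) by apply: cos_ge0_pihalf; apply/andP; split; lra.
have c42 : cos (pi / 4) ^+ 2 = 1 / 2 :> R.
  have := @cos_mulr2n R (pi / 4); have -> : pi / 4 *+ 2 = pi / 2 :> R by rewrite -mulr_natr; field.
  by rewrite cos_pihalf -mulr_natr; lra.
have u2 : 0 <= u / 2 by lra.
have [v vu] := @MVT_segment R sin cos 0 (u / 2) u2 (fun y _ => is_derive_sin y)
  (continuous_subspaceT (@continuous_sin R)).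
rewrite sin0 !subr0 => sE.
have -> : sin u = cos (u / 2) * sin (u / 2) *+ 2.
  by rewrite -sin_mulr2n; congr sin; rewrite -mulr_natr; field.
have -> : cos (u / 2) * sin (u / 2) *+ 2 = cos (u / 2) * cos v * u.
  by rewrite sE -mulr_natr; field.
have := cc v; rewrite in_itv/= in vu => /(_ vu) h1.
have := cc (u / 2); rewrite u2 lexx => /(_ isT) h2.
have h3 : cos (pi / 4) ^+ 2 <= cos (u / 2) * cos v by rewrite expr2; apply: ler_pM.
by move: h3; rewrite c42 => h3; nra.
Qed.

Lemma sin_pi_ge s : `|s| <= 1 / 2 -> `|s| <= `|sin (pi * s)|.
Proof.
move=> s2.
have -> : `|sin (pi * s)| = `|sin (pi * `|s|)|.
  by case: (lerP 0 s) => [/ger0_norm ->//|/ltr0_norm ->]; rewrite mulrN sinN normrN.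
apply: le_trans (ler_norm (sin _)).
have p2 := @pi_ge2 R; have s0 := normr_ge0 s.
apply: le_trans (sin_ge_half _); first by nra.
by apply/andP; split; nra.
Qed.

End CosineKernels.

(** * Riemann-Lebesgue lemma and sampling by Dirichlet kernels *)

Section RiemannLebesgue.
Variable R : realType.
Local Notation mu := (@lebesgue_measure R).
Local Notation I := (`[(- (1 / 2))%R, (1 / 2)%R]%classic : set R).
Implicit Types (f g w q : R -> R) (a b c s t x y xi : R) (N m n : nat).

(** Continuity would be too much: the class has to contain the quotients [(W s - W 0) / sin (pi s)],
    which may jump at [0] and are controlled only on one period. *)
Definition bounded_measurable f :=
  measurable_fun setT f /\ exists M, forall x, - (1 / 2) <= x <= 1 / 2 -> `|f x| <= M.

Lemma bounded_measurableM f g : bounded_measurable f -> bounded_measurable g ->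
  bounded_measurable (fun x => f x * g x).
Proof.
move=> [mf [M fM]] [mg [K gK]]; split; first exact: measurable_funM.
by exists (M * K) => x xI; rewrite normrM; apply: ler_pM => //; [exact: fM|exact: gK].
Qed.

Lemma bounded_measurableB f g : bounded_measurable f -> bounded_measurable g ->
  bounded_measurable (fun x => f x - g x).
Proof.
move=> [mf [M fM]] [mg [K gK]]; split; first exact: measurable_funB.
by exists (M + K) => x xI; apply: le_trans (ler_normB _ _) _; apply: lerD; [exact: fM|exact: gK].
Qed.

Lemma bounded_measurableZ r f : bounded_measurable f -> bounded_measurable (fun x => r * f x).
Proof.
move=> [mf [M fM]]; split; first exact: measurable_funM.
by exists (`|r| * M) => x xI; rewrite normrM; apply: ler_wpM2l => //; exact: fM.
Qed.

Lemma bounded_measurable_integrable f : bounded_measurable f -> mu.-integrable I (EFin \o f).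
Proof.
move=> [mf [M fM]].
have iM : mu.-integrable I (EFin \o (fun _ : R => M)) by apply: continuous_integrable; exact: cst_continuous.
have mI : measurable_fun I f by exact: measurable_funTS.
have bI x : I x -> `|f x| <= M by rewrite /= in_itv/=; exact: fM.
exact: (@Rintegrable_le _ _ _ mu I f (fun=> M)).
Qed.

(** The numerator of the Dirichlet kernel. These modes are orthogonal on [I], with square norm
    [1/2]. *)
Let e n s : R := sin (n.*2.+1%:R * pi * s).

Lemma bounded_measurable_sin n : bounded_measurable (e n).
Proof.
split; last by exists 1 => x _; exact: sin_max.
apply: continuous_measurable_fun.
rewrite (_ : e n = fun s => sin (2 * pi * (n.*2.+1%:R / 2 * s + 0))).
  exact: is_derive_continuous (is_derive_sinp _ _).
by apply/funext => s; rewrite /e; congr (sin _); field.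
Qed.

Lemma integral_sin_orthogonal m n :
  \int[mu]_(s in I) (e m s * e n s) = (1 / 2) * (m == n)%:R.
Proof.
have E s : e m s * e n s =
    1 / 2 * (cosp ((m%:Z - n%:Z)%:~R * s) - cosp ((m%:Z + n%:Z + 1)%:~R * s)).
  rewrite /e /cosp !intrD mulrNz -!pmulrn.
  have -> : 2 * pi * ((m%:R - n%:R) * s) = m.*2.+1%:R * pi * s - n.*2.+1%:R * pi * s :> R.
    by rewrite -!natr1 -!muln2 !natrM; ring.
  have -> : 2 * pi * ((m%:R + n%:R + 1) * s) = m.*2.+1%:R * pi * s + n.*2.+1%:R * pi * s :> R.
    by rewrite -!natr1 -!muln2 !natrM; ring.
  by rewrite cosB cosD; field.
under eq_Rintegral do rewrite E.
rewrite continuous_RintegralZ; last first.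
  by apply: continuous_funB; exact: cosp_continuousM.
rewrite continuous_RintegralB; try exact: cosp_continuousM.
rewrite !integral_cosp; have -> : (m%:Z + n%:Z + 1 == 0) = false by lia.
by rewrite subr0 subr_eq0 eqz_nat.
Qed.

(* Bessel's inequality in its deflation form: [r] is [q] minus its projection on the first [n] modes. *)
Lemma bessel q n : bounded_measurable q ->
  exists r, [/\ bounded_measurable r,
    forall m, (n <= m)%N -> \int[mu]_(s in I) (r s * e m s) = \int[mu]_(s in I) (q s * e m s) &
    \int[mu]_(s in I) (r s ^+ 2) = \int[mu]_(s in I) (q s ^+ 2) -
      2 * \sum_(0 <= k < n) (\int[mu]_(s in I) (q s * e k s)) ^+ 2].
Proof.
move=> bq; elim: n => [|n [r [br rm r2]]].
  by exists q; split => //; rewrite big_geq// mulr0 subr0.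
have be := bounded_measurable_sin.
pose c := \int[mu]_(s in I) (q s * e n s).
have bc := bounded_measurableZ (2 * c) (be n).
(* The coefficient is [2 * c] because [e n] has square norm [1/2]. *)
exists (fun s => r s - 2 * c * e n s); split; first exact: bounded_measurableB.
- move=> m nm.
  have E s : (r s - 2 * c * e n s) * e m s = r s * e m s - 2 * c * (e n s * e m s) by ring.
  under eq_Rintegral do rewrite E.
  have b2 : bounded_measurable (fun s => r s * e m s) by exact: bounded_measurableM.
  have b3 : bounded_measurable (fun s => e n s * e m s) by exact: bounded_measurableM.
  rewrite RintegralB//; [|exact: bounded_measurable_integrable|
    exact/bounded_measurable_integrable/(bounded_measurableZ _ b3)].
  rewrite RintegralZl//; last exact: bounded_measurable_integrable.
  by rewrite integral_sin_orthogonal ltn_eqF// !mulr0 subr0 rm// ltnW.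
- have E s : (r s - 2 * c * e n s) ^+ 2 =
      r s ^+ 2 - (4 * c * (r s * e n s) - 4 * c ^+ 2 * (e n s * e n s)) by ring.
  under eq_Rintegral do rewrite E.
  have b1 : bounded_measurable (fun s => r s ^+ 2) by exact: bounded_measurableM.
  have b2 : bounded_measurable (fun s => r s * e n s) by exact: bounded_measurableM.
  have b3 : bounded_measurable (fun s => e n s * e n s) by exact: bounded_measurableM.
  have b4 := bounded_measurableZ (4 * c) b2.
  have b5 := bounded_measurableZ (4 * c ^+ 2) b3.
  rewrite RintegralB//; [|exact: bounded_measurable_integrable|
    exact/bounded_measurable_integrable/(bounded_measurableB b4 b5)].
  rewrite RintegralB//; try exact: bounded_measurable_integrable.
  rewrite !RintegralZl//; try exact: bounded_measurable_integrable.
  rewrite integral_sin_orthogonal eqxx r2 rm// big_nat_recr//= -/c.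
  by field.
Qed.

(** Bessel's inequality bounds the partial sums of the squared coefficients, so the coefficients
    tend to [0]. *)
Lemma riemann_lebesgue q : bounded_measurable q ->
  \int[mu]_(s in I) (q s * e n s) @[n --> \oo] --> (0 : R).
Proof.
move=> bq; pose u n := (\int[mu]_(s in I) (q s * e n s)) ^+ 2.
have cu : cvgn (series u).
  apply: (@nondecreasing_is_cvgn R).
    by apply/nondecreasing_seqP => n; rewrite /series/= big_nat_recr//= lerDl sqr_ge0.
  exists (\int[mu]_(s in I) (q s ^+ 2)) => _ [n _ <-].
  have [r [_ _ r2]] := bessel n bq.
  have {r2} : \int[mu]_(s in I) (r s ^+ 2) = \int[mu]_(s in I) (q s ^+ 2) - 2 * series u n by [].
  have : 0 <= \int[mu]_(s in I) (r s ^+ 2) by apply: Rintegral_ge0 => x _; exact: sqr_ge0.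
  have : 0 <= series u n by apply: sumr_ge0 => k _; exact: sqr_ge0.
  by move: (Rintegral _ _ _) (Rintegral _ _ _) (series u n) => p q' S; lra.
have /cvgrPdist_lt u0 := cvg_series_cvg_0 cu.
apply/cvgrPdist_lt => eps eps0.
have := u0 (eps ^+ 2); rewrite exprn_gt0// => /(_ isT).
apply: filterS => n; rewrite !sub0r !normrN /u normrX.
by rewrite ltr_pXn2r// ?nnegrE// ltW.
Qed.

(* [x^-1] is [0] at [0], which is why the pointwise limit below converges everywhere. *)
Lemma measurable_inv : measurable_fun setT (fun x : R => x^-1).
Proof.
apply: (@measurable_fun_cvg _ _ R setT (fun n x => x / (x ^+ 2 + n.+1%:R^-1))).
- move=> n; apply: continuous_measurable_fun => x.
  have p : x ^+ 2 + n.+1%:R^-1 != 0 by rewrite gt_eqF// ltr_wpDl ?sqr_ge0 ?invr_gt0.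
  apply: (@continuousM _ _ (fun x : R => x)); first exact: cvg_id.
  apply: (@continuousV _ _ (fun x : R => x ^+ 2 + n.+1%:R^-1)) => //.
  by apply: cvgD; [exact: exprn_continuous|exact: cvg_cst].
- move=> x _; have [->|x0] := eqVneq x 0.
    by rewrite invr0; under eq_fun do rewrite mul0r; exact: cvg_cst.
  have -> : x^-1 = x / (x ^+ 2 + 0) by rewrite addr0; field.
  apply: cvgMr; apply: cvgV; first by rewrite addr0 expf_neq0.
  apply: cvgD; first exact: cvg_cst.
  exact: cvg_harmonic.
Qed.

(** The periodisation [W] of [w] around [xi] carries the integral to one period. As the Dirichlet
    kernel has mass [1], the error is the integral of [(W s - W 0) / sin (pi s)] against [e N]; the
    Lipschitz bound keeps this quotient bounded, and Riemann-Lebesgue applies. *)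
Lemma dirichlet_sampling w A L xi m : 0 <= A -> continuous w ->
  (forall x, A <= `|x| -> w x = 0) -> (forall x y, `|w x - w y| <= L * `|x - y|) ->
  A + `|xi| <= m%:R + 1 / 2 ->
  \int[mu]_(t in `[(- A)%R, A]) (w t * dirichlet N (t - xi)) @[N --> \oo] -->
  zsum m (fun k => w (xi + k%:~R)).
Proof.
move=> A0 cw w0 wL Am.
pose W s := zsum m (fun k => w (xi + s + k%:~R)).
have cW : continuous W.
  apply: zsum_continuous => k; apply: (continuous_fun_comp cw).
  by apply: continuous_funD; [exact: continuous_addl|exact: cst_continuous].
have WL s : `|W s - W 0| <= zsum m (fun=> L) * `|s|.
  rewrite /W -zsumB mulrC -zsumZ; apply: le_trans (ler_norm_zsum _ _) _.
  apply: ler_zsum => k; rewrite mulrC (le_trans (wL _ _))//.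
  by rewrite (_ : _ - _ = s) //; ring.
have h1 : - (1 / 2) <= 1 / 2 :> R by lra.
have IE N : \int[mu]_(t in `[(- A)%R, A]) (w t * dirichlet N (t - xi)) =
    \int[mu]_(s in I) (W s * dirichlet N s).
  have cDx : continuous (fun t => dirichlet N (t - xi)).
    exact: continuous_fun_comp (@dirichlet_continuous R N) (@continuous_addr R _).
  have cD : continuous (fun t => w t * dirichlet N (t - xi)) by exact: continuous_funM.
  (* By the assumption on [m], this window of [2m + 1] unit intervals around [xi] contains the
     support of [w]. *)
  rewrite -(@integral_widen _ _ (xi - 1 / 2 - m%:R) _ _ (xi - 1 / 2 + 1 + m%:R))//; last first.
  - by move=> x _ /orP[x1|x1]; rewrite w0 ?mul0r// ler_normr ?x1// lerNr x1 orbT.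
  - by have := ler_norm (- xi); rewrite normrN; lra.
  - by lra.
  - by have := ler_norm xi; lra.
  rewrite -zsum_integral_translates// -Rintegral_zsum; last first.
    by move=> k; exact: continuous_fun_comp cD (@continuous_addr R _).
  have cWD : continuous (fun t => W (t - xi) * dirichlet N (t - xi)).
    by apply: continuous_funM => //; exact: continuous_fun_comp cW (@continuous_addr R _).
  transitivity (\int[mu]_(t in `[(xi - 1 / 2)%R, (xi - 1 / 2 + 1)%R]) (W (t - xi) * dirichlet N (t - xi))).
    apply: eq_Rintegral => t _; rewrite /W mulrC -zsumZ; apply: eq_zsum => k.
    by rewrite [xi + _]addrC subrK (addrAC t) dirichlet_period mulrC.
  have -> : xi - 1 / 2 + 1 = 1 / 2 + xi by field.
  rewrite (addrC xi) -(integral_shift xi h1 cWD).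
  by apply: eq_Rintegral => t _; rewrite addrK.
have W0E : zsum m (fun k => w (xi + k%:~R)) = W 0 by apply: eq_zsum => k; rewrite addr0.
rewrite W0E.
pose q s := (W s - W 0) * (sin (pi * s))^-1.
have bq : bounded_measurable q.
  split.
    apply: measurable_funM.
      apply: continuous_measurable_fun; apply: continuous_funB => //; exact: cst_continuous.
    apply: (measurableT_comp measurable_inv); apply: continuous_measurable_fun.
    apply: continuous_fun_comp; first exact: continuous_sin.
    by apply: continuous_funZ => x; exact: cvg_id.
  have L0 : 0 <= zsum m (fun=> L).
    by have := WL 1; rewrite normr1 mulr1; exact: le_trans.
  exists (zsum m (fun=> L)) => s sI.
  have s1 : `|s| <= 1 / 2 by rewrite ler_norml.
  have [->|s0] := eqVneq s 0; first by rewrite /q subrr mul0r normr0.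
  rewrite /q normrM normfV ler_pdivrMr; last first.
    by apply: lt_le_trans (sin_pi_ge s1); rewrite normr_gt0.
  by apply: le_trans (WL s) _; rewrite ler_wpM2l// sin_pi_ge.
have := riemann_lebesgue bq => h.
have -> : (fun N => \int[mu]_(t in `[(- A)%R, A]) (w t * dirichlet N (t - xi))) =
  (fun N => W 0 + \int[mu]_(s in I) (q s * e N s)).
  apply/funext => N; rewrite IE.
  have -> : W 0 = \int[mu]_(s in I) (W 0 * dirichlet N s).
    rewrite continuous_RintegralZ; last exact: dirichlet_continuous.
    by rewrite integral_dirichlet mulr1.
  have c1 : continuous (fun s => W 0 * dirichlet N s).
    by apply: continuous_funZ; exact: dirichlet_continuous.
  rewrite addrC; apply/eqP; rewrite -subr_eq; apply/eqP.
  rewrite -continuous_RintegralB//; last first.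
    by apply: continuous_funM => //; exact: dirichlet_continuous.
  apply: eq_itv_Rintegral => s sI; rewrite -mulrBl /q /e -dirichlet_sin.
  (* At [0] the quotient takes the value [0], and both sides vanish. *)
  have [->|s0] := eqVneq s 0; first by rewrite subrr !mul0r.
  have : sin (pi * s) != 0.
    rewrite -normr_gt0; apply: lt_le_trans (sin_pi_ge _); rewrite ?normr_gt0//.
    by rewrite ler_norml.
  by move=> sn0; field.
rewrite -[X in _ --> X]addr0; apply: cvgD => //; exact: cvg_cst.
Qed.

End RiemannLebesgue.

(** * Cosine transforms *)

Section FourierTransform.
Variable R : realType.
Local Notation mu := (@lebesgue_measure R).
Implicit Types (f w q a b : R -> R) (A c s t x y xi : R) (N m : nat).

Lemma derivative_lipschitz f (df : R -> R) L : (forall x, is_derive x 1 f (df x)) ->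
  (forall x, `|df x| <= L) -> forall x y, `|f x - f y| <= L * `|x - y|.
Proof.
move=> dF dL.
have H x y : y <= x -> `|f x - f y| <= L * `|x - y|.
  move=> yx; have [c _ ->] := @MVT_segment R f df y x yx (fun z _ => dF z)
    (continuous_subspaceT (is_derive_continuous dF)).
  by rewrite normrM ler_wpM2r.
move=> x y; have [yx|/ltW xy] := leP y x; first exact: H.
by rewrite distrC (distrC x); exact: H.
Qed.

Lemma lipschitz_continuous f L : (forall x y, `|f x - f y| <= L * `|x - y|) -> continuous f.
Proof.
move=> fL x; apply/cvgrPdist_lt => e e0.
have L0 : 0 < `|L| + 1 by rewrite ltr_wpDl.
near=> y; apply: le_lt_trans (fL x y) _.
apply: (@le_lt_trans _ _ ((`|L| + 1) * `|x - y|)).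
  by rewrite ler_wpM2r// (le_trans (ler_norm L))// lerDl.
rewrite mulrC -ltr_pdivlMr//; near: y.
by have /cvgrPdist_lt := @cvg_id _ (nbhs x); apply; rewrite divr_gt0.
Unshelve. all: by end_near. Qed.

(** The strict inequality describes an open set, so [f] vanishes in a neighbourhood of each of its
    points. *)
Lemma derivative_support f (df : R -> R) A : (forall x, is_derive x 1 f (df x)) ->
  (forall t, A < `|t| -> f t = 0) -> forall t, A < `|t| -> df t = 0.
Proof.
move=> dF f0 t At.
have At' : \forall y \near t, A < `|y|.
  move: At; rewrite ltr_normr => /orP[At|At].
    by apply: filterS (lt_nbhsr At) => y yA; exact: lt_le_trans (ler_norm y).
  rewrite ltrNr in At; apply: filterS (lt_nbhsl At) => y yA.
  by rewrite ltr_normr ltrNr yA orbT.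
have d0 : is_derive t 1 f 0.
  by apply: near_eq_is_derive (is_derive_cst (0 : R) t 1); apply: filterS At' => y /f0 ->.
by rewrite -(@derive_val _ _ _ _ _ _ _ (dF t)) (@derive_val _ _ _ _ _ _ _ d0).
Qed.

(** The support lies in a strictly smaller interval, so that [a] and its derivative vanish at [A]
    and [-A] and integration by parts leaves no boundary term. Two derivatives are the price of
    quadratic decay of the transform. *)
Record nice A a : Prop := Nice {
  nice_even : forall t, a (- t) = a t;
  nice_support : exists2 A0, 0 < A0 < A & forall t, A0 <= `|t| -> a t = 0;
  nice_smooth : exists (a1 a2 : R -> R) C, [/\ forall t, is_derive t 1 a (a1 t),
    forall t, is_derive t 1 a1 (a2 t), continuous a2 &
    forall t, [/\ `|a t| <= C, `|a1 t| <= C & `|a2 t| <= C]] }.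

Lemma nice_continuous A a : nice A a -> continuous a.
Proof. by case=> _ _ [a1 [a2 [C [d1 _ _ _]]]]; exact: is_derive_continuous d1. Qed.

Lemma nice_gt0 A a : nice A a -> 0 < A.
Proof. by case=> _ [A0 /andP[A00 A0A] _] _; exact: lt_trans A0A. Qed.

Lemma nice_eq0 A a t : nice A a -> A <= `|t| -> a t = 0.
Proof. by case=> _ [A0 /andP[_ A0A] a0] _ At; apply/a0/le_trans/At/ltW. Qed.

Lemma nice_bounded A a : nice A a -> exists2 C, 0 <= C & forall t, `|a t| <= C.
Proof.
case=> _ _ [a1 [a2 [C [_ _ _ aC]]]]; exists C => [|t]; last by case: (aC t).
by case: (aC 0) => + _ _; exact: le_trans.
Qed.

(** The sine produced by the integration is written as a cosine with phase shifted by a quarter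
    period; the integral keeps its shape and the step can be iterated. *)
Lemma by_parts_cosp f (df : R -> R) A c phi : 0 <= A -> c != 0 ->
  (forall t, is_derive t 1 f (df t)) -> continuous df -> f (- A) = 0 -> f A = 0 ->
  \int[mu]_(t in `[(- A)%R, A]) (f t * cosp (c * t + phi)) =
  - (2 * pi * c)^-1 * \int[mu]_(t in `[(- A)%R, A]) (df t * cosp (c * t + (phi - 1 / 4))).
Proof.
move=> A0 c0 dF cdf fA1 fA2.
have k0 : 2 * pi * c != 0 by rewrite mulf_neq0// gt_eqF// mulr_gt0// pi_gt0.
have dg t : is_derive t 1 (fun t => (2 * pi * c)^-1 * sin (2 * pi * (c * t + phi))) (cosp (c * t + phi)).
  have h := is_derive_sinp c phi t.
  by apply: is_derive_eq; rewrite /GRing.scale/= mulrA mulVf// mul1r.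
have AA : - A <= A by lra.
rewrite (integration_by_parts_vanishing AA dF dg cdf (@cosp_continuous R _ _) fA1 fA2).
rewrite mulNr; congr (- _); rewrite -continuous_RintegralZ; last first.
  by apply: continuous_funM => //; exact: cosp_continuous.
apply: eq_Rintegral => t _; rewrite mulrCA; congr (_ * (_ * _)).
by rewrite /cosp -cosBpihalf; congr (cos _); field.
Qed.

Definition ft A a x : R := \int[mu]_(t in `[(- A)%R, A]) (a t * cosp (x * t)).

(** The sum of the trivial bound for [ft A a x] and the bound for [x^2 ft A a x] given by two
    integrations by parts, where the factor [(2 pi)^-2 <= 1] is dropped. *)
Lemma ft_decay A a : nice A a -> exists2 C, 0 <= C & forall x, `|ft A a x| <= C * (1 + x ^+ 2)^-1.
Proof.
move=> na; have A0 := nice_gt0 na; have ca := nice_continuous na.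
case: (na) => _ [A' /andP[_ A'A] as0] [a1 [a2 [C [d1 d2 c2 aC]]]].
have C0 : 0 <= C by case: (aC 0) => + _ _; exact: le_trans.
have c1 := is_derive_continuous d2.
have s0 t : A' < `|t| -> a t = 0 by move=> /ltW/as0.
have s1 := derivative_support d1 s0.
have AN : A' < `|A| by rewrite gtr0_norm.
have AN' : A' < `|- A| by rewrite normrN gtr0_norm.
have AA : - A <= A by lra.
have cc phi x : continuous (fun t => cosp (x * t + phi)) by exact: cosp_continuous.
have B0 x : `|ft A a x| <= C * (A - - A).
  apply: integral_bound => //; first by apply: continuous_funM => //; exact: cosp_continuousM.
  move=> t _; rewrite normrM -[leRHS]mulr1; apply: ler_pM => //; last exact: cosp_max.
  by case: (aC t).
exists (2 * (C * (A - - A))) => [|x]; first by rewrite !mulr_ge0//; lra.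
have p1 : 0 < 1 + x ^+ 2 by rewrite ltr_pwDl ?sqr_ge0.
rewrite ler_pdivlMr// mulrDr mulr1 mulr2n mulrDl !mul1r; apply: lerD; first exact: B0.
have [->|x0] := eqVneq x 0; first by rewrite expr0n/= mulr0 mulr_ge0//; lra.
have -> : ft A a x = ((2 * pi * x) ^+ 2)^-1 *
    \int[mu]_(t in `[(- A)%R, A]) (a2 t * cosp (x * t + (0 - 1 / 4 - 1 / 4))) * (1).
  rewrite mulr1 /ft; under eq_Rintegral do rewrite -[x * _]addr0.
  rewrite (by_parts_cosp _ (ltW A0) x0 d1 c1 (s0 _ AN') (s0 _ AN)).
  rewrite (by_parts_cosp _ (ltW A0) x0 d2 c2 (s1 _ AN') (s1 _ AN)).
  by rewrite mulrA mulrNN -invfM -expr2.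
have B2 : `|\int[mu]_(t in `[(- A)%R, A]) (a2 t * cosp (x * t + (0 - 1 / 4 - 1 / 4)))| <= C * (A - - A).
  apply: integral_bound => //; first exact: continuous_funM.
  move=> t _; rewrite normrM -[leRHS]mulr1; apply: ler_pM => //; last exact: cosp_max.
  by case: (aC t).
move: B2; set J := Rintegral _ _ _ => B2.
rewrite mulr1 normrM mulrAC -[leRHS]mul1r; apply: ler_pM => //; first by rewrite mulr_ge0// sqr_ge0.
have x2 : 0 < x ^+ 2 by rewrite exprn_even_gt0.
rewrite ger0_norm ?invr_ge0 ?sqr_ge0// exprMn invfM -mulrA mulVf ?gt_eqF// mulr1.
have p2 : 1 <= 2 * pi :> R by have := @pi_ge2 R; lra.
by rewrite invf_le1 ?exprn_ege1// exprn_gt0// (lt_le_trans _ p2).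
Qed.

Lemma ft_continuous A a : nice A a -> continuous (ft A a).
Proof.
move=> na; have A0 := nice_gt0 na; have ca := nice_continuous na.
have [C C0 aC] := nice_bounded na.
apply: (@lipschitz_continuous _ (C * (2 * pi * A) * (A - - A))) => x y.
rewrite /ft -continuous_RintegralB; try by apply: continuous_funM => //; exact: cosp_continuousM.
rewrite mulrAC; apply: integral_bound; first by lra.
  by apply: continuous_funB; apply: continuous_funM => //; exact: cosp_continuousM.
move=> t /andP[t1 t2]; rewrite -mulrBr normrM -(mulrA C); apply: ler_pM => //.
have pi0 := @pi_gt0 R.
have tA : `|t| <= A by rewrite ler_norml t1.
rewrite mulrC (mulrC y); apply: le_trans (_ : (2 * pi * `|t|) * `|x - y| <= _); last first.
  by rewrite ler_wpM2r// ler_wpM2l// mulr_ge0// ltW.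
have dc (z : R) : is_derive z 1 (fun z : R => cosp (t * z)) (- (2 * pi * t) * sin (2 * pi * (t * z))).
  have := is_derive_cosp t 0 z; rewrite addr0.
  by rewrite (_ : (fun z : R => cosp (t * z + 0)) = (fun z : R => cosp (t * z)))//;
      apply/funext => ?; rewrite addr0.
apply: (derivative_lipschitz dc) => z.
rewrite normrM normrN -[leRHS]mulr1; apply: ler_pM => //; last exact: sin_max.
by rewrite !normrM (ger0_norm (ltW pi0)) ger0_norm.
Qed.

Lemma integral_odd f A : 0 <= A -> continuous f -> (forall t, f (- t) = - f t) ->
  \int[mu]_(t in `[(- A)%R, A]) f t = 0.
Proof.
move=> A0 cf fo.
have AA : - A <= A by lra.
have := integral_reflect 0 AA cf; rewrite !sub0r opprK => E.
have : \int[mu]_(t in `[(- A)%R, A]) f t = \int[mu]_(t in `[(- A)%R, A]) (-1 * f t).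
  by rewrite -[LHS]E; apply: eq_Rintegral => t _; rewrite sub0r fo mulN1r.
by rewrite continuous_RintegralZ//; move: (Rintegral _ _ _) => J; lra.
Qed.

(** Evenness of [a] removes the sine part of the expanded cosine. *)
Lemma ft_cosp A a u v : nice A a ->
  ft A a u * cosp v = \int[mu]_(t in `[(- A)%R, A]) (a t * cosp (u * t - v)).
Proof.
move=> na; have A0 := nice_gt0 na; have ca := nice_continuous na.
have cs : continuous (fun t => sin (2 * pi * (u * t))).
  rewrite (_ : (fun t => _) = (fun t => sin (2 * pi * (u * t + 0)))).
    exact: is_derive_continuous (is_derive_sinp u 0).
  by apply/funext => t; rewrite addr0.
have c1 : continuous (fun t => a t * cosp (u * t)).
  by apply: continuous_funM => //; exact: cosp_continuousM.
have c2 : continuous (fun t => a t * sin (2 * pi * (u * t))) by exact: continuous_funM.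
have E t : a t * cosp (u * t - v) =
  cosp v * (a t * cosp (u * t)) + sin (2 * pi * v) * (a t * sin (2 * pi * (u * t))).
  by rewrite /cosp mulrBr cosB; ring.
under [RHS]eq_Rintegral do rewrite E.
rewrite continuous_RintegralD; [|exact: continuous_funZ|exact: continuous_funZ].
have odd0 : \int[mu]_(t in `[(- A)%R, A]) (a t * sin (2 * pi * (u * t))) = 0.
  apply: integral_odd => //; first exact: ltW.
  by move=> t; rewrite (nice_even na) !mulrN sinN mulrN.
by rewrite !continuous_RintegralZ// odd0 mulr0 addr0 mulrC.
Qed.

(** Poisson summation with independent positions [x] and [y]. Putting both cosines under the
    integral leaves the phase [x t - y xi - k (t - xi)], so the partial sum is the integral of
    [a t * cosp (x * t - y * xi)] against the Dirichlet kernel at [t - xi], and sampling gives the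
    limit. *)
Lemma poisson A a x y xi m : nice A a -> A + `|xi| <= m%:R + 1 / 2 ->
  zsum N (fun k => ft A a (x - k%:~R) * cosp ((y - k%:~R) * xi)) @[N --> \oo] -->
  zsum m (fun k => a (xi + k%:~R) * cosp (x * (xi + k%:~R) - y * xi)).
Proof.
move=> na Am; have A0 := nice_gt0 na; have ca := nice_continuous na.
pose w t := a t * cosp (x * t - y * xi).
have cw : continuous w by apply: continuous_funM => //; exact: cosp_continuous.
have w0 t : A <= `|t| -> w t = 0 by move=> At; rewrite /w (nice_eq0 na At) mul0r.
have [L wL] : exists L, forall s t, `|w s - w t| <= L * `|s - t|.
  case: (na) => _ _ [a1 [a2 [C [d1 _ _ aC]]]].
  have dw t : is_derive t 1 w (a1 t * cosp (x * t - y * xi) +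
      a t * (- (2 * pi * x) * sin (2 * pi * (x * t - y * xi)))).
    have h1 := d1 t; have h2 := is_derive_cosp x (- (y * xi)) t.
    by apply: is_derive_eq; rewrite /GRing.scale/= addrC; congr (_ + _); rewrite mulrC.
  exists (C * 1 + C * `|2 * pi * x|); apply: (derivative_lipschitz dw) => t.
  apply: le_trans (ler_normD _ _) _; apply: lerD.
    by rewrite normrM; apply: ler_pM => //; [case: (aC t)|exact: cosp_max].
  rewrite normrM; apply: ler_pM => //; first by case: (aC t).
  by rewrite normrM normrN -[leRHS]mulr1; apply: ler_pM => //; exact: sin_max.
have h := dirichlet_sampling (ltW A0) cw w0 wL Am.
rewrite (_ : (fun N => zsum N _) =
  (fun N => \int[mu]_(t in `[(- A)%R, A]) (w t * dirichlet N (t - xi)))); first exact: h.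
apply/funext => N; symmetry.
have cws k : continuous (fun t => a t * cosp ((x - k%:~R) * t - (y - k%:~R) * xi)).
  by apply: continuous_funM => //; exact: cosp_continuous.
under [RHS]eq_zsum do rewrite ft_cosp//.
rewrite -Rintegral_zsum//; apply: eq_Rintegral => t _.
rewrite /w -mulrA -zsum_cosp -zsumZ; apply: eq_zsum => k.
by congr (_ * cosp _); ring.
Qed.

End FourierTransform.

(** * Limits of kernels, Fourier inversion and Plancherel *)

Section Plancherel.
Variable R : realType.
Local Notation mu := (@lebesgue_measure R).
Implicit Types (f w q a b : R -> R) (A c s t x y xi : R) (N m : nat).

Lemma zsum_opp N (F : int -> R) : zsum N (fun k => F (- k)) = zsum N F.
Proof. by elim: N => [|N /= ->]; rewrite /= ?oppr0 ?opprK// [F (- _) + _]addrC. Qed.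

Lemma zsum_ft_bound A a : nice A a ->
  exists2 C, 0 <= C & forall N x, zsum N (fun k => `|ft A a (x - k%:~R)|) <= C.
Proof.
move=> na; have [C C0 aC] := ft_decay na; exists (C * 8) => [|N x]; first by rewrite mulr_ge0.
apply: le_trans (_ : C * zsum N (fun k => (1 + (x - k%:~R) ^+ 2)^-1) <= _).
  by rewrite -zsumZ; apply: ler_zsum => k; exact: aC.
by rewrite ler_wpM2l// zsum_inv_oneDsqr.
Qed.

(** One of the two transforms is expanded into its integral over [t], and Poisson summation is
    applied for each [t]. As [|t| <= A], the bound on [2 * A] lets one [m] serve all frequencies. *)
Lemma kernel_limit A a x y m : nice A a -> 2 * A <= m%:R + 1 / 2 ->
  zsum N (fun k => ft A a (x - k%:~R) * ft A a (y - k%:~R)) @[N --> \oo] -->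
  \int[mu]_(t in `[(- A)%R, A])
    (a t * zsum m (fun k => a (t + k%:~R) * cosp (x * (t + k%:~R) - y * t))).
Proof.
move=> na Am; have A0 := nice_gt0 na; have ca := nice_continuous na.
have [C C0 aC] := nice_bounded na; have [K K0 aK] := zsum_ft_bound na.
pose f N t := a t * zsum N (fun k => ft A a (x - k%:~R) * cosp ((y - k%:~R) * t)).
have cf N : continuous (f N).
  apply: continuous_funM => //; apply: zsum_continuous => k.
  by apply: continuous_funZ; exact: cosp_continuousM.
have [|||||_ h] := @Rintegral_dominated_cvg _ _ _ mu `[(- A)%R, A]%classic f
  (fun t => a t * zsum m (fun k => a (t + k%:~R) * cosp (x * (t + k%:~R) - y * t))) (fun=> C * K).
- exact: measurable_itv.
- by move=> N; apply: measurable_funTS; apply: continuous_measurable_fun.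
- move=> t /=; rewrite in_itv/= => tA; apply: cvgMr; apply: poisson => //.
  by apply: le_trans Am; rewrite mulr2n mulrDl mul1r lerD2l ler_norml.
- by apply: continuous_integrable; exact: cst_continuous.
- move=> N t _; rewrite normrM; apply: ler_pM => //.
  apply: le_trans (ler_norm_zsum _ _) _; apply: le_trans (aK N x); apply: ler_zsum => k.
  by rewrite normrM -[leRHS]mulr1; apply: ler_pM => //; exact: cosp_max.
rewrite (_ : (fun N => zsum N _) = (fun N => \int[mu]_(t in `[(- A)%R, A]) f N t))//.
apply/funext => N; rewrite /f; symmetry.
under eq_Rintegral do rewrite -zsumZ.
rewrite Rintegral_zsum; last first.
  by move=> k; apply: continuous_funM => //; apply: continuous_funZ; exact: cosp_continuousM.
apply: eq_zsum => k; rewrite [ft A a (y - _)]/ft -continuous_RintegralZ.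
  by apply: eq_Rintegral => t _; rewrite mulrCA.
by apply: continuous_funM => //; exact: cosp_continuousM.
Qed.

Lemma integral_cosp_period (k : int) c :
  \int[mu]_(x in `[0%R, 1%R]) cosp (k%:~R * x + c) = (k == 0)%:R * cosp c.
Proof.
have h2 : 0 <= 1 :> R by [].
have [->|k0] := eqVneq k 0.
  rewrite (@eq_itv_Rintegral _ _ _ _ (fun=> cosp c)); last by move=> x _; rewrite mul0r add0r.
  by rewrite itv_Rintegral_cst//= subr0 mulrC.
have pi0 := @pi_gt0 R.
have kR : (2 * pi * k%:~R : R) != 0 by rewrite mulf_neq0 ?intr_eq0// gt_eqF// mulr_gt0.
have dF s : is_derive s 1 (fun s =>
    (2 * pi * k%:~R)^-1 * sin (2 * pi * (k%:~R * s + c))) (cosp (k%:~R * s + c)).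
  have h := is_derive_sinp k%:~R c s.
  by apply: is_derive_eq; rewrite /GRing.scale/= mulrA mulVf// mul1r.
rewrite (integral_antiderivative h2 (@cosp_continuous _ _ _) dF).
by rewrite mulr1 mulr0 add0r (addrC _ c) sin_period subrr mul0r.
Qed.

Lemma integral_line_zsum f g : continuous f -> mu.-integrable setT (EFin \o g) ->
  (forall x, `|f x| <= g x) ->
  zsum N (fun k => \int[mu]_(x in `[0%R, 1%R]) f (x + k%:~R)) @[N --> \oo] --> \int[mu]_x f x.
Proof.
move=> cf ig fg.
pose I N := `[(0 - N%:R)%R, (0 + 1 + N%:R)%R]%classic : set R.
pose h N x := f x * \1_(I N) x.
have [|||||_ hl] := @Rintegral_dominated_cvg _ _ _ mu setT h f g.
- exact: measurableT.
- move=> N; apply: measurable_funM; first exact: continuous_measurable_fun.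
  by apply: measurable_indic; exact: measurable_itv.
- move=> x _; rewrite -[X in _ --> X]mulr1; apply: cvgMr.
  apply: cvg_near_cst; near=> N.
  rewrite indicE mem_set// /I /= in_itv/= !add0r.
  have : `|x| < N%:R by near: N; exact: nbhs_infty_gtr.
  by rewrite ltr_norml => /andP[]; lra.
- exact: ig.
- move=> N x _; rewrite /h normrM indicE.
  by case: (_ \in _); rewrite ?normr1 ?normr0 ?mulr1 ?mulr0//; apply: le_trans (fg x).
rewrite (_ : (fun N => zsum N _) = (fun N => \int[mu]_x h N x))//.
apply/funext => N.
have := zsum_integral_translates 0 N cf; rewrite !add0r => ->.
rewrite Rintegral_mkcond; apply: eq_Rintegral => x _.
rewrite patchE /h indicE /I !add0r.
by case: ifPn => _; rewrite ?mulr1 ?mulr0.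
Unshelve. all: by end_near. Qed.

Lemma integrable_decay C c : mu.-integrable setT (EFin \o (fun x => C * (1 + (x - c) ^+ 2)^-1)).
Proof. by apply: RintegrableZ => //; exact: integrable_inv_oneDsqr. Qed.

(** The line is cut into unit periods and Poisson summation evaluates the periodised integrand. What
    is left is a trigonometric polynomial in [x] with frequencies [k], and integration over a period
    retains only [k = 0]. *)
Lemma fourier_inversion A a x1 x2 xi : nice A a ->
  \int[mu]_x (ft A a (x - x1) * cosp ((x - x2) * xi)) = a xi * cosp ((x1 - x2) * xi).
Proof.
move=> na; have A0 := nice_gt0 na; have ca := nice_continuous na.
have [C C0 aC] := ft_decay na; have [K K0 aK] := zsum_ft_bound na.
have cft := ft_continuous na.
pose f x := ft A a (x - x1) * cosp ((x - x2) * xi).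
have cf : continuous f.
  apply: continuous_funM; first exact: continuous_fun_comp cft (@continuous_addr R _).
  rewrite (_ : (fun x => _) = (fun x => cosp (xi * x + - (xi * x2)))); first exact: cosp_continuous.
  by apply/funext => x; congr cosp; ring.
have fC x : `|f x| <= C * (1 + (x - x1) ^+ 2)^-1.
  rewrite normrM -[leRHS]mulr1; apply: ler_pM; [by []|by []|exact: aC|exact: cosp_max].
have l1 := integral_line_zsum cf (integrable_decay C x1) fC.
(* Large enough for Poisson summation at the frequency [xi]; the value of the integral does not
   involve [m]. *)
pose m := (Num.trunc (A + `|xi|)).+1.
have Am : A + `|xi| <= m%:R + 1 / 2.
  by have := truncnS_gt (A + `|xi|); rewrite -/m; lra.
pose F N x := zsum N (fun k => f (x + k%:~R)).
have cF N : continuous (F N).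
  by apply: zsum_continuous => k; exact: continuous_fun_comp cf (@continuous_addr R _).
have [|||||_ l2] := @Rintegral_dominated_cvg _ _ _ mu `[0%R, 1%R]%classic F
   (fun x => zsum m (fun k => a (xi + k%:~R) * cosp ((x - x1) * (xi + k%:~R) - (x - x2) * xi))) (fun=> K).
- exact: measurable_itv.
- by move=> N; apply: measurable_funTS; apply: continuous_measurable_fun.
- move=> x _; have := @poisson _ A a (x - x1) (x - x2) xi m na Am.
  rewrite (_ : (fun N => zsum N _) = F ^~ x)//.
  apply/funext => N; rewrite /F -zsum_opp; apply: eq_zsum => k.
  by rewrite /f mulrNz opprK; congr (ft _ _ _ * cosp (_ * _)); ring.
- by apply: continuous_integrable; exact: cst_continuous.
- move=> N x _; apply: le_trans (ler_norm_zsum _ _) _; apply: le_trans (aK N (x - x1)).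
  rewrite -zsum_opp; apply: ler_zsum => k.
  rewrite normrM -[leRHS]mulr1; apply: ler_pM => //; last exact: cosp_max.
  by rewrite mulrNz -addrA (addrC (- _)) addrA.
have E : (fun N => zsum N (fun k => \int[mu]_(x in `[0%R, 1%R]) f (x + k%:~R))) =
   (fun N => \int[mu]_(x in `[0%R, 1%R]) F N x).
  apply/funext => N; rewrite Rintegral_zsum// => k.
  exact: continuous_fun_comp cf (@continuous_addr R _).
move: l1; rewrite E => l1.
have := cvg_unique (@Rhausdorff R) l1 l2; rewrite /f => ->.
have cE k x : a (xi + k%:~R) * cosp ((x - x1) * (xi + k%:~R) - (x - x2) * xi) =
    a (xi + k%:~R) * cosp (k%:~R * x + ((x2 - x1) * xi - k%:~R * x1)).
  by congr (_ * cosp _); ring.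
under eq_Rintegral do (under eq_zsum do rewrite cE).
rewrite Rintegral_zsum; last by move=> k; apply: continuous_funZ; exact: cosp_continuous.
have -> : zsum m (fun k => \int[mu]_(x in `[0%R, 1%R]) (a (xi + k%:~R) * cosp (k%:~R * x +
    ((x2 - x1) * xi - k%:~R * x1)))) =
   zsum m (fun k => (k == 0)%:R * (a (xi + k%:~R) * cosp ((x2 - x1) * xi - k%:~R * x1))).
  apply: eq_zsum => k; rewrite continuous_RintegralZ; last exact: cosp_continuous.
  by rewrite integral_cosp_period mulrCA.
have z0 (G : int -> R) N : zsum N (fun k => (k == 0)%:R * G k) = G 0.
  by elim: N => [|N /= ->]; rewrite /= ?eqxx ?mul1r// !mul0r !addr0.
rewrite z0 addr0 mul0r subr0 -(cosp_opp ((x1 - x2) * xi)).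
by congr (_ * cosp _); ring.
Qed.

(** The second transform is expanded, the integrals are exchanged under a majorant of quadratic
    decay in [x], and inversion recovers [a1] at each frequency. *)
Lemma plancherel A1 A2 a1 a2 x1 x2 : nice A1 a1 -> nice A2 a2 ->
  \int[mu]_x (ft A1 a1 (x - x1) * ft A2 a2 (x - x2)) =
  \int[mu]_(t in `[(- A2)%R, A2]) (a1 t * a2 t * cosp ((x1 - x2) * t)).
Proof.
move=> n1 n2; have ca2 := nice_continuous n2.
have [C C0 aC] := ft_decay n1; have [K K0 aK] := nice_bounded n2.
have cft := ft_continuous n1.
transitivity (\int[mu]_x \int[mu]_(t in `[(- A2)%R, A2]) (ft A1 a1 (x - x1) * (a2 t * cosp ((x - x2) * t)))).
  apply: eq_Rintegral => x _; rewrite continuous_RintegralZ//.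
  by apply: continuous_funM => //; exact: cosp_continuousM.
rewrite (@Rintegral_swap _ _ _ _ _ mu mu setT `[(- A2)%R, A2]%classic _
  (fun x => C * (1 + (x - x1) ^+ 2)^-1) (fun=> K))//.
- apply: eq_Rintegral => t _.
  rewrite -mulrA [RHS]mulrCA -(fourier_inversion x1 x2 t n1) -RintegralZl//; last first.
    apply: (@Rintegrable_le _ _ _ mu setT _ (fun x => C * (1 + (x - x1) ^+ 2)^-1)) => //.
    + apply: measurable_funM.
        by apply: continuous_measurable_fun; exact: continuous_fun_comp cft (@continuous_addr R _).
      apply: continuous_measurable_fun.
      rewrite (_ : (fun x => _) = (fun x => cosp (t * x + - (t * x2)))); first exact: cosp_continuous.
      by apply/funext => x; congr cosp; ring.
    + exact: integrable_decay.
    + by move=> x _; rewrite normrM -[leRHS]mulr1; apply: ler_pM => //; exact: cosp_max.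
  by apply: eq_Rintegral => x _; rewrite mulrCA.
- have m1 : measurable_fun setT (fun x => ft A1 a1 (x - x1)).
    by apply: continuous_measurable_fun; exact: continuous_fun_comp cft (@continuous_addr R _).
  have m2 : measurable_fun setT a2 by exact: continuous_measurable_fun.
  have m3 : measurable_fun setT (@cosp R).
    apply: continuous_measurable_fun; rewrite (_ : @cosp R = (fun x => cosp (1 * x))).
      exact: cosp_continuousM.
    by apply/funext => x; rewrite mul1r.
  have m4 : measurable_fun setT (fun x : R => x - x2).
    by apply: continuous_measurable_fun; exact: continuous_addr.
  apply: measurable_funM; first exact: (measurableT_comp m1 measurable_fst).
  apply: measurable_funM; first exact: (measurableT_comp m2 measurable_snd).
  apply: (measurableT_comp m3); apply: measurable_funM; last exact: measurable_snd.
  exact: (measurableT_comp m4 measurable_fst).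
- exact: integrable_decay.
- by apply: continuous_integrable; exact: cst_continuous.
- move=> x t _ _; rewrite normrM; apply: ler_pM => //.
  by rewrite normrM -[leRHS]mulr1; apply: ler_pM => //; exact: cosp_max.
Qed.

End Plancherel.

(** * Reproducing kernels and dilations *)

Section ReproducingKernel.
Variable R : realType.
Local Notation mu := (@lebesgue_measure R).
Implicit Types (f w q a b : R -> R) (A c l r s t u v x y xi : R) (N m n : nat).

Lemma cvg_norm_le (z : nat -> R) l r : z n @[n --> \oo] --> l ->
  (forall n, `|z n| <= r) -> `|l| <= r.
Proof.
move=> zl zr; apply/ler_addgt0Pr => e e0.
have /cvgrPdist_lt /(_ e e0) [n _ /(_ n (leqnn n)) /= h] := zl.
have -> : l = z n + (l - z n) by ring.
by apply: le_trans (ler_normD _ _) _; apply: lerD => //; exact: ltW.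
Qed.

(* By Poisson summation this is the limit of [zsum N (fun k => ft A a (x - k) * ft A a (y - k))];
   the inner sum is finite because [a] has compact support. *)
Definition rkernel A a m x y : R := \int[mu]_(t in `[(- A)%R, A])
  (a t * zsum m (fun k => a (t + k%:~R) * cosp (x * (t + k%:~R) - y * t))).

Lemma zsum_ft2_bound A a : nice A a -> exists2 C, 0 <= C & forall N x y,
  `|zsum N (fun k => ft A a (x - k%:~R) * ft A a (y - k%:~R))| <= C * (1 + (x - y) ^+ 2)^-1.
Proof.
move=> na; have [C C0 aC] := ft_decay na; exists (C ^+ 2 * 32) => [|N x y].
  by rewrite mulr_ge0// sqr_ge0.
apply: le_trans (ler_norm_zsum _ _) _.
apply: le_trans (_ : C ^+ 2 * zsum N (fun k => (1 + (x - k%:~R) ^+ 2)^-1 * (1 + (y - k%:~R) ^+ 2)^-1) <= _).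
  rewrite -zsumZ; apply: ler_zsum => k; rewrite normrM expr2 mulrACA.
  by apply: ler_pM => //; exact: aC.
by rewrite -mulrA ler_wpM2l ?sqr_ge0// zsum_inv_oneDsqrM.
Qed.

Lemma kernel_bound A a m : nice A a -> 2 * A <= m%:R + 1 / 2 ->
  exists2 C, 0 <= C & forall x y, `|rkernel A a m x y| <= C * (1 + (x - y) ^+ 2)^-1.
Proof.
move=> na Am; have [C C0 aC] := zsum_ft2_bound na; exists C => // x y.
by have h := @kernel_limit _ A a x y m na Am; apply: (cvg_norm_le h) => N; exact: aC.
Qed.

Lemma kernel_measurable A a m : nice A a -> 2 * A <= m%:R + 1 / 2 ->
  measurable_fun setT (fun z : R * R => rkernel A a m z.1 z.2).
Proof.
move=> na Am.
apply: (@measurable_fun_cvg _ _ R setT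
  (fun N (z : R * R) => zsum N (fun k => ft A a (z.1 - k%:~R) * ft A a (z.2 - k%:~R)))); last first.
  by move=> z _; exact: kernel_limit.
move=> n; apply: (@zsum_measurable _ _ _ _
  (fun k (z : R * R) => ft A a (z.1 - k%:~R) * ft A a (z.2 - k%:~R))) => k.
have m1 : measurable_fun setT (fun x => ft A a (x - k%:~R)).
  apply: continuous_measurable_fun.
  exact: continuous_fun_comp (ft_continuous na) (@continuous_addr R _).
by apply: measurable_funM; [exact: (measurableT_comp m1 measurable_fst)|
  exact: (measurableT_comp m1 measurable_snd)].
Qed.

Lemma inv_oneDsqr_shift c u v : (1 + (u - v) ^+ 2)^-1 <= (2 + 2 * (c - u) ^+ 2) * (1 + (c - v) ^+ 2)^-1.
Proof.
have p1 : 0 < 1 + (u - v) ^+ 2 by rewrite ltr_pwDl ?sqr_ge0.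
have p2 : 0 < 1 + (c - v) ^+ 2 by rewrite ltr_pwDl ?sqr_ge0.
rewrite ler_pdivlMr// mulrC ler_pdivrMr//.
have -> : c - v = (c - u) + (u - v) by ring.
move: (c - u) (u - v) => p r.
have := sqr_ge0 (p - r); have := sqr_ge0 (p * r); nra.
Qed.

Lemma inv_oneDsqr_scale l u : 0 < l -> (1 + (l * u) ^+ 2)^-1 <= (1 + l ^- 2) * (1 + u ^+ 2)^-1.
Proof.
move=> l0.
have p1 : 0 < 1 + (l * u) ^+ 2 by rewrite ltr_pwDl ?sqr_ge0.
have p2 : 0 < 1 + u ^+ 2 by rewrite ltr_pwDl ?sqr_ge0.
have p3 : 0 < l ^- 2 by rewrite invr_gt0 exprn_gt0.
rewrite ler_pdivlMr// mulrC ler_pdivrMr//.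
have -> : (1 + l ^- 2) * (1 + (l * u) ^+ 2) = 1 + l ^- 2 + (l * u) ^+ 2 + u ^+ 2.
  by field; rewrite gt_eqF.
by have := sqr_ge0 (l * u); lra.
Qed.

(** Dilated functions are transforms of dilated multipliers; [plancherel], which allows two
    different multipliers, thus covers inner products across scales. *)
Lemma nice_dilate A a l r : 0 < l -> nice A a -> nice (l * A) (fun s => r * a (l^-1 * s)).
Proof.
move=> l0 [ae [A0 /andP[A00 A0A] as0] [a1 [a2 [C [d1 d2 c2 aC]]]]].
have dl (g dg : R -> R) (c : R) : (forall t, is_derive t 1 g (dg t)) ->
    forall t, is_derive t 1 (fun s => c * g (l^-1 * s)) (c * l^-1 * dg (l^-1 * t)).
  move=> dg0 t.
  have h := is_derive_affine l^-1 0 t.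
  have e : (fun s => c * g (l^-1 * s)) = (fun s => c * g (l^-1 * s + 0)).
    by apply/funext => s; rewrite addr0.
  rewrite e -[l^-1 * t]addr0.
  have k := @is_derive1_comp _ g _ t _ _ (dg0 (l^-1 * t + 0)) h.
  move: k => /(@is_deriveZ _ _ _ _ c) k.
  by apply: is_derive_eq; rewrite /GRing.scale/= mulrAC mulrA.
split.
- by move=> t; rewrite mulrN ae.
- exists (l * A0); first by rewrite mulr_gt0//= ltr_pM2l.
  move=> t lt; rewrite as0 ?mulr0// normrM gtr0_norm ?invr_gt0//.
  by rewrite mulrC ler_pdivlMr// mulrC.
- pose c0 := 1 + `|r| + `|r * l^-1| + `|r * l^-1 * l^-1|.
  have C0 : 0 <= C by case: (aC 0) => + _ _; exact: le_trans.
  exists (fun t => r * l^-1 * a1 (l^-1 * t)), (fun t => r * l^-1 * l^-1 * a2 (l^-1 * t)), (c0 * C).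
  split; [exact: dl|exact: dl| |].
    apply: continuous_funZ; apply: (continuous_fun_comp c2).
    by apply: continuous_funZ => x; exact: cvg_id.
  move=> t; have [h1 h2 h3] := aC (l^-1 * t).
  have [r0 r1 r2] : [/\ 0 <= `|r|, 0 <= `|r * l^-1| & 0 <= `|r * l^-1 * l^-1|] by [].
  by split; rewrite normrM; apply: ler_pM => //; rewrite /c0; lra.
Qed.

Lemma ft_dilate A a l r x : 0 < l -> nice A a ->
  ft (l * A) (fun s => r * a (l^-1 * s)) x = r * l * ft A a (l * x).
Proof.
move=> l0 na; have A0 := nice_gt0 na; have ca := nice_continuous na.
pose g s := r * a (l^-1 * s) * cosp (x * s).
have cg : continuous g.
  apply: continuous_funM; last exact: cosp_continuousM.
  by apply: continuous_funZ; apply: (continuous_fun_comp ca); apply: continuous_funZ => ?; exact: cvg_id.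
have AA : - A <= A by lra.
have := integral_affine 0 AA l0 cg; rewrite !addr0 mulrN => E.
rewrite /ft -/(g _) -[LHS]/(\int[mu]_(s in `[(- (l * A))%R, (l * A)%R]) g s).
rewrite -[LHS](mulKf (_ : l^-1 != 0)) ?invr_eq0 ?gt_eqF// -E invrK mulrC (mulrC r) -mulrA.
rewrite mulrC; congr (_ * _).
rewrite -continuous_RintegralZ; last first.
  by apply: continuous_funM => //; exact: cosp_continuousM.
apply: eq_Rintegral => t _; rewrite /g addr0 mulKf ?gt_eqF// -mulrA; congr (_ * (_ * cosp _)).
ring.
Qed.

End ReproducingKernel.

(** * Completeness of Meyer wavelets *)

Section MeyerMultipliers.
Variable R : realType.
Local Notation mu := (@lebesgue_measure R).
Implicit Types (f w q a b h : R -> R) (A c l r s t u v x y xi : R) (N m n : nat).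

(* [e0]-[e2] are the coefficients, in the shift by an integer, of the identity [K_1 - K_0 = sum_k psi psi];
   [sym1]-[sym3] are the folding relations behind orthonormality. *)
Record meyer a b : Prop := Meyer {
  meyer_scaling : nice 1 a;
  meyer_wavelet : nice (3 / 2) b;
  meyer_a0 : a 0 = 1;
  meyer_e0 : forall t, a (t / 2) ^+ 2 - a t ^+ 2 = b t ^+ 2;
  meyer_e1 : forall t, a t * a (t + 1) = b t * b (t + 1);
  meyer_e2 : forall t, a (t / 2) * a (t / 2 + 1) = b t * b (t + 2);
  meyer_low : forall t, `|t| <= 1 / 3 -> b t = 0;
  meyer_high : forall t, 4 / 3 <= `|t| -> b t = 0;
  meyer_sym1 : forall t, 1 / 3 <= t <= 2 / 3 -> b t ^+ 2 + b (1 - t) ^+ 2 = 1;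
  meyer_sym2 : forall t, 2 / 3 <= t <= 4 / 3 -> b t ^+ 2 + b (2 - t) ^+ 2 = 1;
  meyer_sym3 : forall t, 2 / 3 <= t <= 4 / 3 -> b t * b (t / 2) = b (2 - t) * b ((2 - t) / 2) }.

Lemma nice_mul_translate0 A a t r : nice A a -> 2 * A <= `|r| -> a t * a (t + r) = 0.
Proof.
move=> na Ar; have [tA|tA] := leP A `|t|; first by rewrite (nice_eq0 na tA) mul0r.
rewrite (nice_eq0 (t := t + r) na) ?mulr0//.
have := ler_normB (t + r) t; have -> : t + r - t = r by ring.
lra.
Qed.

Lemma cosp_half u : cosp (u + 1 / 2) = - cosp u.
Proof.
rewrite /cosp (_ : 2 * pi * (u + 1 / 2) = 2 * pi * u + pi); first by rewrite cosDpi.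
by field.
Qed.

(** Both sides are combinations of the cosines [T k]. The first product involves only even shifts;
    comparing coefficients at [T 0], [T 1], [T (- 1)], [T 2] and [T (- 2)] gives the three relations
    of the record and their mirror images. On the right the half translation changes the sign at odd
    shifts, so that [b t * b (t + 1)] matches the subtracted [a t * a (t + 1)]. *)
Lemma meyer_pointwise a b x y s : meyer a b ->
  a (s / 2) * zsum 2 (fun k => a (s / 2 + k%:~R) * cosp (2 * x * (s / 2 + k%:~R) - 2 * y * (s / 2))) -
  a s * zsum 2 (fun k => a (s + k%:~R) * cosp (x * (s + k%:~R) - y * s)) =
  b s * zsum 3 (fun k => b (s + k%:~R) * cosp ((x + 1 / 2) * (s + k%:~R) - (y + 1 / 2) * s)).
Proof.
move=> [na nb _ e0 e1 e2 _ _ _ _ _].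
pose T r := cosp ((x - y) * s + r * x).
have ET1 k : cosp (2 * x * (s / 2 + k%:~R) - 2 * y * (s / 2)) = T (2 * k%:~R).
  by congr cosp; field.
have ET2 k : cosp (x * (s + k%:~R) - y * s) = T k%:~R.
  by congr cosp; field.
have ET3 k : cosp ((x + 1 / 2) * (s + k%:~R) - (y + 1 / 2) * s) = cosp ((x - y) * s + k%:~R * x + k%:~R / 2).
  by congr cosp; field.
under eq_zsum do rewrite ET1.
under [X in _ - _ * X = _]eq_zsum do rewrite ET2.
under [X in _ = _ * X]eq_zsum do rewrite ET3.
have aN t r : a (t - r) = a (- t + r) by rewrite -(nice_even na) opprB addrC.
have bN t r : b (t - r) = b (- t + r) by rewrite -(nice_even nb) opprB addrC.
have e1' : a s * a (s - 1) = b s * b (s - 1).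
  by rewrite aN bN -(nice_even na s) -(nice_even nb s) e1.
have e2' : a (s / 2) * a (s / 2 - 1) = b s * b (s - 2).
  by rewrite aN bN -(nice_even na (s / 2)) -(nice_even nb s) -mulNr e2.
have h2 : 2 * 1 <= `|2 : R| by rewrite mulr1 ger0_norm.
have h2' : 2 * 1 <= `|- 2 : R| by rewrite normrN.
have h6 : 2 * (3 / 2) <= `|3 : R| by rewrite ger0_norm//; lra.
have h6' : 2 * (3 / 2) <= `|- 3 : R| by rewrite normrN.
have z1 := nice_mul_translate0 (s / 2) na h2; have z1' := nice_mul_translate0 (s / 2) na h2'.
have z2 := nice_mul_translate0 s na h2; have z2' := nice_mul_translate0 s na h2'.
have z3 := nice_mul_translate0 s nb h6; have z3' := nice_mul_translate0 s nb h6'.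
have C1 : cosp ((x - y) * s + 1 * x + 1 / 2) = - T 1 by rewrite cosp_half.
have C1' : cosp ((x - y) * s + (- 1) * x + (- 1) / 2) = - T (- 1).
  by rewrite -cosp_half -(cosp_period _ 1) /T; congr cosp; field.
have C2 : cosp ((x - y) * s + 2 * x + 2 / 2) = T 2.
  by rewrite divff// (cosp_period _ 1).
have C2' : cosp ((x - y) * s + (- 2) * x + (- 2) / 2) = T (- 2).
  by rewrite -(cosp_period _ 1) /T; congr cosp; field.
have C0 : cosp ((x - y) * s + 0 * x + 0 / 2) = T 0 by rewrite /T !mul0r addr0.
rewrite /= !mulrNz -!pmulrn mulr0n !addr0 !mulr0 C0 C1 C1' C2 C2' mulr1.
(* The two remaining cosines belong to the shifts [3] and [-3], whose coefficients vanish. *)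
move: (cosp _) (cosp _) => u1 u2.
have -> : 2 * - 1 = - 2 :> R by ring.
have := e2 s; have := e1 s; have := e0 s; move: z1 z1' z2 z2' z3 z3' e1' e2'.
move: (a (s / 2)) (a (s / 2 + 1)) (a (s / 2 - 1)) (a (s / 2 + 2)) (a (s / 2 - 2)).
move: (a s) (a (s + 1)) (a (s - 1)) (a (s + 2)) (a (s - 2)).
move: (b s) (b (s + 1)) (b (s - 1)) (b (s + 2)) (b (s - 2)) (b (s + 3)) (b (s - 3)).
move: (T 0) (T 1) (T (- 1)) (T 2) (T (- 2)) (T (2 * 2)) (T (2 * - 2)).
move=> T0 T1 T1' T2 T2' T4 T4' b0 b1 b1' b2 b2' b3 b3' a0 a1 a1' a2 a2' h0 h1 h1' h3 h3'.
move=> y1 y1' y2 y2' y3 y3' f1' f2' f0 f1 f2.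
apply/eqP; rewrite -subr_eq0; apply/eqP.
transitivity ((h0 ^+ 2 - a0 ^+ 2 - b0 ^+ 2) * T0 + (h0 * h1 - b0 * b2) * T2 +
  (h0 * h1' - b0 * b2') * T2' + h0 * h3 * T4 + h0 * h3' * T4' - (a0 * a1 - b0 * b1) * T1 -
  (a0 * a1' - b0 * b1') * T1' - a0 * a2 * T2 - a0 * a2' * T2' - b0 * b3 * u2 - b0 * b3' * u1).
  by ring.
by rewrite f0 f1 f2 f1' f2' y1 y1' y2 y2' y3 y3'; ring.
Qed.

(** The three integrals are brought to the common interval [[-2, 2]]: the first by [t = s / 2],
    which absorbs the factor [2], the others because the multipliers vanish on the excess. The
    integrands are then compared pointwise. *)
Lemma kernel_identity a b x y : meyer a b ->
  2 * rkernel 1 a 2 (2 * x) (2 * y) - rkernel 1 a 2 x y =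
  rkernel (3 / 2) b 3 (x + 1 / 2) (y + 1 / 2).
Proof.
move=> ab; have [na nb _ _ _ _ _ _ _ _ _] := ab.
have ca := nice_continuous na; have cb := nice_continuous nb.
have cK (g : R -> R) A m u v : continuous g ->
    continuous (fun t => g t * zsum m (fun k => g (t + k%:~R) * cosp (u * (t + k%:~R) - v * t))).
  move=> cg; apply: continuous_funM => //; apply: zsum_continuous => k.
  apply: continuous_funM; first exact: continuous_fun_comp cg (@continuous_addr R _).
  rewrite (_ : (fun t => _) = (fun t => cosp ((u - v) * t + u * k%:~R))); first exact: cosp_continuous.
  by apply/funext => t; congr cosp; ring.
have i12 : - (1 : R) <= 1 by lra.
have -> : 2 * rkernel 1 a 2 (2 * x) (2 * y) = \int[mu]_(s in `[(- 2)%R, 2%R])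
    (a (s / 2) * zsum 2 (fun k => a (s / 2 + k%:~R) * cosp (2 * x * (s / 2 + k%:~R) - 2 * y * (s / 2)))).
  have h0 : 0 < (1 / 2 : R) by lra.
  have h1 : - (2 : R) <= 2 by lra.
  have := integral_affine 0 h1 h0 (cK a 1 2 (2 * x) (2 * y) ca).
  have -> : (1 / 2)^-1 = 2 :> R by field.
  have -> : 1 / 2 * - 2 + 0 = - 1 :> R by field.
  have -> : 1 / 2 * 2 + 0 = 1 :> R by field.
  rewrite -/(rkernel _ _ _ _ _) => <-; apply: eq_Rintegral => s _.
  by have -> : 1 / 2 * s + 0 = s / 2 by field.
have -> : rkernel 1 a 2 x y = \int[mu]_(s in `[(- 2)%R, 2%R])
    (a s * zsum 2 (fun k => a (s + k%:~R) * cosp (x * (s + k%:~R) - y * s))).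
  rewrite /rkernel; symmetry; apply: integral_widen; [lra|lra|lra|exact: cK|].
  by move=> s _ /orP[s1|s1]; rewrite (nice_eq0 na) ?mul0r// ler_normr ?s1// lerNr s1 orbT.
have -> : rkernel (3 / 2) b 3 (x + 1 / 2) (y + 1 / 2) = \int[mu]_(s in `[(- 2)%R, 2%R])
    (b s * zsum 3 (fun k => b (s + k%:~R) * cosp ((x + 1 / 2) * (s + k%:~R) - (y + 1 / 2) * s))).
  rewrite /rkernel; symmetry; apply: integral_widen; [lra|lra|lra|exact: cK|].
  by move=> s _ /orP[s1|s1]; rewrite (nice_eq0 nb) ?mul0r// ler_normr ?s1// lerNr s1 orbT.
rewrite -continuous_RintegralB; last 2 first.
- have c2 : continuous (fun s : R => s / 2) by move=> s; apply: cvgMl; exact: cvg_id.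
  exact: continuous_fun_comp (cK a 1 2 (2 * x) (2 * y) ca) c2.
- exact: cK.
by apply: eq_Rintegral => s _; exact: meyer_pointwise.
Qed.

Lemma sqint_decay_integrable f c : sqint setT f ->
  mu.-integrable setT (EFin \o (fun y => `|f y| * (1 + (y - c) ^+ 2)^-1)).
Proof.
move=> [mf if2].
have mg : measurable_fun setT (fun y => (1 + (y - c) ^+ 2)^-1).
  by have /measurable_int/measurable_EFinP := integrable_inv_oneDsqr c.
apply: integrable_mul_sqr => //; first exact: measurableT_comp.
- apply: (@Rintegrable_le _ _ _ mu setT _ (fun y => f y ^+ 2)) => //.
    by apply: measurable_funX; exact: measurableT_comp.
  by move=> y _; rewrite real_normK ?num_real// ger0_norm ?sqr_ge0.
- apply: (@Rintegrable_le _ _ _ mu setT _ (fun y => (1 + (y - c) ^+ 2)^-1)) => //.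
    exact: measurable_funX.
    exact: integrable_inv_oneDsqr.
  move=> y _.
  have p : 0 < (1 + (y - c) ^+ 2)^-1 by rewrite invr_gt0 ltr_pwDl ?sqr_ge0.
  rewrite ger0_norm ?sqr_ge0// expr2 -[leRHS]mulr1; apply: ler_wpM2l; first exact: ltW.
  by rewrite invf_le1 ?ltr_pwDl ?sqr_ge0// lerDl sqr_ge0.
Qed.

End MeyerMultipliers.

(** * Functions orthogonal to the wavelets *)

Section OrthogonalComplement.
Variable R : realType.
Local Notation mu := (@lebesgue_measure R).
Implicit Types (f w q a b h : R -> R) (A c l r s t u v x y xi : R) (N m n : nat).

Lemma integrable_zsum (g : int -> R -> R) N : (forall k, mu.-integrable setT (EFin \o g k)) ->
  mu.-integrable setT (EFin \o (fun y => zsum N (g ^~ y))) /\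
  \int[mu]_y zsum N (g ^~ y) = zsum N (fun k => \int[mu]_y g k y).
Proof.
move=> ig; elim: N => [|N [IH1 IH2]] /=; first by split => //; exact: ig.
have i2 : mu.-integrable setT (EFin \o (fun y => g N.+1%:Z y + g (- N.+1%:Z) y)) by exact: RintegrableD.
split; first exact: RintegrableD.
by rewrite RintegralD// IH2 RintegralD.
Qed.

Lemma dilated_decay_integrable f l c C (g : R -> R) : sqint setT f -> 0 < l -> 0 <= C ->
  measurable_fun setT g -> (forall y, `|g y| <= C * (1 + (l * (y - c)) ^+ 2)^-1) ->
  mu.-integrable setT (EFin \o (fun y => f y * g y)).
Proof.
move=> sf l0 C0 mg gC; have [mf _] := sf.
have i1 : mu.-integrable setT (EFin \o (fun y => C * (1 + l ^- 2) * (`|f y| * (1 + (y - c) ^+ 2)^-1))).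
  by apply: RintegrableZ => //; exact: sqint_decay_integrable.
apply: Rintegrable_le i1 _ => //; first exact: measurable_funM.
move=> y _; rewrite normrM mulrCA ler_wpM2l// -mulrA (le_trans (gC y))// ler_wpM2l//.
exact: inv_oneDsqr_scale.
Qed.

Lemma rkernel_measurable2 A a m l x c : nice A a -> 2 * A <= m%:R + 1 / 2 ->
  measurable_fun setT (fun y => rkernel A a m (l * x + c) (l * y + c)).
Proof.
move=> na Am; have := kernel_measurable na Am => mK.
have m1 : measurable_fun setT (fun y => l * y + c).
  by apply: continuous_measurable_fun; exact: continuous_affine.
exact: (measurableT_comp (measurableT_comp mK (measurable_pair1 (l * x + c))) m1).
Qed.

Lemma rkernel_dilated_bound A a m c : nice A a -> 2 * A <= m%:R + 1 / 2 ->
  exists2 C, 0 <= C & forall l x y,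
  `|rkernel A a m (l * x + c) (l * y + c)| <= C * (1 + (l * (y - x)) ^+ 2)^-1.
Proof.
move=> na Am; have [C C0 aC] := kernel_bound na Am; exists C => // l x y.
apply: le_trans (aC _ _) _; rewrite le_eqVlt; apply/orP; left; apply/eqP.
by congr (_ * (1 + _)^-1); ring.
Qed.

(** The partial sums of the kernel are finite combinations of functions to which [f] is orthogonal;
    their bound, uniform in [N], allows the passage to the limit. *)
Lemma orthogonal_kernel A b m f l x : nice A b -> 2 * A <= m%:R + 1 / 2 -> sqint setT f -> 0 < l ->
  (forall k : int, \int[mu]_y (f y * ft A b (l * y - k%:~R + 1 / 2)) = 0) ->
  \int[mu]_y (f y * rkernel A b m (l * x + 1 / 2) (l * y + 1 / 2)) = 0.
Proof.
move=> nb Am sf l0 f0; have [mf if2] := sf.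
have [C C0 bC] := zsum_ft2_bound nb; have [D D0 bD] := ft_decay nb.
pose X := l * x + 1 / 2.
pose g k y := ft A b (X - k%:~R) * (f y * ft A b (l * y - k%:~R + 1 / 2)).
have mft (k : int) : measurable_fun setT (fun y => ft A b (l * y - k%:~R + 1 / 2)).
  apply: continuous_measurable_fun; apply: (continuous_fun_comp (ft_continuous nb)).
  rewrite (_ : (fun y => _) = (fun y => l * y + (- k%:~R + 1 / 2))); first exact: continuous_affine.
  by apply/funext => y; rewrite addrA.
have ig0 (k : int) : mu.-integrable setT (EFin \o (fun y => f y * ft A b (l * y - k%:~R + 1 / 2))).
  apply: (@dilated_decay_integrable f l ((k%:~R - 1 / 2) / l) D) => // y.
  apply: le_trans (bD _) _; rewrite le_eqVlt; apply/orP; left; apply/eqP.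
  by congr (_ * (1 + _ ^+ 2)^-1); field; rewrite gt_eqF.
have ig k : mu.-integrable setT (EFin \o g k) by apply: RintegrableZ.
have gE N y : zsum N (g ^~ y) = f y * zsum N (fun k => ft A b (X - k%:~R) * ft A b (l * y + 1 / 2 - k%:~R)).
  by rewrite -zsumZ; apply: eq_zsum => k; rewrite /g mulrCA (addrAC (l * y)).
have [|||||_ lim] := @Rintegral_dominated_cvg _ _ _ mu setT (fun N y => zsum N (g ^~ y))
  (fun y => f y * rkernel A b m X (l * y + 1 / 2))
  (fun y => C * (1 + l ^- 2) * (`|f y| * (1 + (y - x) ^+ 2)^-1)).
- exact: measurableT.
- by move=> N; have [/measurable_int/measurable_EFinP] := integrable_zsum N ig.
- move=> y _; under eq_fun do rewrite gE; apply: cvgMr; exact: kernel_limit.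
- by apply: RintegrableZ => //; exact: sqint_decay_integrable.
- move=> N y _; rewrite gE normrM mulrCA ler_wpM2l//.
  apply: le_trans (bC _ _ _) _; rewrite -mulrA ler_wpM2l//.
  apply: le_trans (inv_oneDsqr_scale (y - x) l0); rewrite le_eqVlt; apply/orP; left; apply/eqP.
  by congr ((1 + _)^-1); rewrite /X; ring.
have e0 : (fun N => \int[mu]_y zsum N (g ^~ y)) = fun=> 0.
  apply/funext => N; have [_ ->] := integrable_zsum N ig.
  rewrite (@eq_zsum _ _ _ (fun=> 0)) => [|k]; last by rewrite /g RintegralZl// f0 mulr0.
  by elim: N => [//|N /= ->]; rewrite !addr0.
rewrite e0 in lim; apply: (cvg_unique (@Rhausdorff R) lim); exact: cvg_cst.
Qed.

Lemma mulr_le_sqrD u v : `|u * v| <= u ^+ 2 + v ^+ 2.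
Proof.
by rewrite ler_norml; have := sqr_ge0 (u + v); have := sqr_ge0 (u - v);
  have := sqr_ge0 u; have := sqr_ge0 v; move=> *; apply/andP; split; nra.
Qed.

Lemma orthogonal_scaling_kernel a b f n x : meyer a b -> sqint setT f ->
  (forall j k : int, \int[mu]_y (f y * ft (3 / 2) b ((2 : R) ^ j * y - k%:~R + 1 / 2)) = 0) ->
  \int[mu]_y (f y * ((2 : R) ^+ n * rkernel 1 a 2 ((2 : R) ^+ n * x) ((2 : R) ^+ n * y))) = 0.
Proof.
move=> ab sf f0; have [na nb _ _ _ _ _ _ _ _ _] := ab; have [mf if2] := sf.
have A1 : 2 * 1 <= 2%:R + 1 / 2 :> R by lra.
have A2 : 2 * (3 / 2) <= 3%:R + 1 / 2 :> R by lra.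
have [G GE] : exists G : R -> R, forall l, G l = \int[mu]_y (f y * (l * rkernel 1 a 2 (l * x) (l * y))).
  by exists (fun l => \int[mu]_y (f y * (l * rkernel 1 a 2 (l * x) (l * y)))).
have [C C0 bC] := rkernel_dilated_bound 0 na A1.
have bC' l y : `|rkernel 1 a 2 (l * x) (l * y)| <= C * (1 + (l * (y - x)) ^+ 2)^-1.
  by have := bC l x y; rewrite !addr0.
have mK l : measurable_fun setT (fun y => l * rkernel 1 a 2 (l * x) (l * y)).
  apply: measurable_funM => //.
  by have := @rkernel_measurable2 1 a 2 l x 0 na A1; under eq_fun do rewrite !addr0.
have iK l : 0 < l -> mu.-integrable setT (EFin \o (fun y => f y * (l * rkernel 1 a 2 (l * x) (l * y)))).
  move=> l0; apply: (@dilated_decay_integrable f l x (l * C)) => //; first by rewrite mulr_ge0// ltW.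
  by move=> y; rewrite normrM gtr0_norm// -mulrA ler_wpM2l// ltW.
have G2 l : 0 < l -> (forall k : int, \int[mu]_y (f y * ft (3 / 2) b (l * y - k%:~R + 1 / 2)) = 0) ->
    G (2 * l) = G l.
  move=> l0 fl; have l20 : 0 < 2 * l by rewrite mulr_gt0.
  apply/eqP; rewrite -subr_eq0 !GE -RintegralB//; [|exact: iK|exact: iK]; apply/eqP.
  have E y : f y * (2 * l * rkernel 1 a 2 (2 * l * x) (2 * l * y)) - f y * (l * rkernel 1 a 2 (l * x) (l * y)) =
      l * (f y * rkernel (3 / 2) b 3 (l * x + 1 / 2) (l * y + 1 / 2)).
    by rewrite -(kernel_identity _ _ ab) -!mulrA; ring.
  under eq_Rintegral do rewrite E.
  rewrite RintegralZl//.
    by rewrite (orthogonal_kernel x nb A2 sf l0 fl) mulr0.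
  have [D D0 bD] := rkernel_dilated_bound (1 / 2) nb A2.
  by apply: (@dilated_decay_integrable f l x D) => //; exact: rkernel_measurable2.
have two0 n' : 0 < (2 : R) ^+ n' by rewrite exprn_gt0.
have Gup n' : G (2 ^+ n') = G 1.
  elim: n' => [|n' IH]; first by rewrite expr0.
  by rewrite exprS G2 => [|//|k]; [exact: IH|exact: (f0 n'%:Z)].
have Gdown n' : G ((2 ^+ n')^-1) = G 1.
  elim: n' => [|n' IH]; first by rewrite expr0 invr1.
  have v0 : 0 < ((2 : R) ^+ n'.+1)^-1 by rewrite invr_gt0.
  rewrite -IH -(G2 _ v0) => [|k]; last by have := f0 (- n'.+1%:Z) k; rewrite -exprnN.
  by congr (G _); rewrite exprS; field; rewrite gt_eqF.
rewrite -GE Gup.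
(* For [l <= 1], [l^2 (1 + (y - x)^2) <= 1 + (l (y - x))^2]. Hence the square of the kernel at scale
   [l] is at most [C^2 / (1 + (y - x)^2)], and one majorant serves all coarse scales. Pointwise the
   kernel is at most [l C], which tends to [0]. *)
have [|||||_ lim] := @Rintegral_dominated_cvg _ _ _ mu setT
  (fun n' y => f y * ((2 ^+ n')^-1 * rkernel 1 a 2 ((2 ^+ n')^-1 * x) ((2 ^+ n')^-1 * y)))
  (fun=> 0) (fun y => f y ^+ 2 + C ^+ 2 * (1 + (y - x) ^+ 2)^-1).
- exact: measurableT.
- by move=> n'; apply: measurable_funM; [exact: mf|exact: mK].
- move=> y _; rewrite -[X in _ --> X](mulr0 (f y)); apply: cvgMr.
  apply/cvgrPdist_le => e e0; near=> n'.
  have v0 : 0 < ((2 : R) ^+ n')^-1 by rewrite invr_gt0.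
  rewrite sub0r normrN normrM gtr0_norm//.
  apply: (@le_trans _ _ ((2 ^+ n')^-1 * C)).
    apply: ler_wpM2l; first exact: ltW.
    apply: le_trans (bC' _ _) _; rewrite -[leRHS]mulr1 ler_wpM2l//.
    by rewrite invf_le1 ?ltr_pwDl ?sqr_ge0// lerDl sqr_ge0.
  rewrite mulrC ler_pdivrMr// -ler_pdivrMl//.
  apply: (@le_trans _ _ n'%:R); last by rewrite -natrX ler_nat ltnW// ltn_expl.
  by near: n'; exact: nbhs_infty_ger.
- by apply: RintegrableD => //; exact: integrable_decay.
- move=> n' y _; apply: le_trans (mulr_le_sqrD _ _) _; rewrite lerD2l.
  set l := (2 ^+ n')^-1.
  have l0 : 0 < l by rewrite /l invr_gt0.
  have l1 : l <= 1 by rewrite /l invf_le1// exprn_ege1// ler1n.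
  set r := rkernel _ _ _ _ _; have := bC' l y; rewrite -/r => rC.
  set p := 1 + (l * (y - x)) ^+ 2 in rC.
  have p0 : 0 < p by rewrite ltr_pwDl ?sqr_ge0.
  rewrite exprMn -(real_normK (num_real r)).
  apply: (@le_trans _ _ (l ^+ 2 * (C * p^-1) ^+ 2)).
    by rewrite ler_wpM2l ?sqr_ge0// ler_pXn2r// nnegrE// mulr_ge0// invr_ge0 ltW.
  rewrite exprMn mulrCA ler_wpM2l ?sqr_ge0//.
  have q0 : 0 < 1 + (y - x) ^+ 2 by rewrite ltr_pwDl ?sqr_ge0.
  rewrite [p^-1 ^+ 2]exprVn ler_pdivrMr ?exprn_gt0// [leRHS]mulrC ler_pdivlMr//.
  have h1 : l ^+ 2 * (1 + (y - x) ^+ 2) <= p.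
    by rewrite /p mulrDr mulr1 exprMn lerD2r -[leRHS](expr1n _ 2) ler_pXn2r ?nnegrE ?(ltW l0).
  apply: le_trans h1 _; rewrite expr2 -[leLHS]mulr1 ler_wpM2l ?(ltW p0)//.
  by rewrite /p lerDl sqr_ge0.
have e0 : (fun n' => G ((2 ^+ n')^-1)) = fun=> G 1 by apply/funext => n'; exact: Gdown.
have lim2 : G ((2 ^+ n')^-1) @[n' --> \oo] --> G 1 by rewrite e0; exact: cvg_cst.
have eG : (fun n' => G ((2 ^+ n')^-1)) = (fun n' =>
    \int[mu]_y (f y * ((2 ^+ n')^-1 * rkernel 1 a 2 ((2 ^+ n')^-1 * x) ((2 ^+ n')^-1 * y)))).
  by apply/funext => n'; exact: GE.
rewrite eG in lim2; rewrite -(cvg_unique (@Rhausdorff R) lim lim2).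
by rewrite Rintegral_cst// mul0r.
Unshelve. all: by end_near. Qed.

End OrthogonalComplement.

(** * The scaling kernels as an approximate identity *)

Section ApproximateIdentity.
Variable R : realType.
Local Notation mu := (@lebesgue_measure R).
Implicit Types (f w a b h : R -> R) (A c l p q r s t u v x y xi : R) (N m n : nat).

(** Inversion at frequency [0] gives every rescaled translate of the scaling function the integral
    [a 0 = 1]. The mass of the kernel is therefore the sum of the translates at [l y], and Poisson
    summation at frequency [0] evaluates it to [a 0], since [a] vanishes at [1] and [-1]. *)
Lemma kernel_mass a b l y : meyer a b -> 0 < l ->
  mu.-integrable setT (EFin \o (fun x => l * rkernel 1 a 2 (l * x) (l * y))) /\
  \int[mu]_x (l * rkernel 1 a 2 (l * x) (l * y)) = 1.
Proof.
move=> ab l0; have [na _ a0 _ _ _ _ _ _ _ _] := ab.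
have A1 : 2 * 1 <= 2%:R + 1 / 2 :> R by lra.
have [C C0 aC] := zsum_ft2_bound na; have [D D0 aD] := ft_decay na.
have na' := nice_dilate 1 l0 na.
have ln0 : l != 0 by rewrite gt_eqF.
(* The last factor equals [1]; it gives the expression the form of [fourier_inversion] at frequency
   [0]. *)
have ftE (k : int) x : l * ft 1 a (l * x - k%:~R) =
    ft (l * 1) (fun s => 1 * a (l^-1 * s)) (x - k%:~R / l) * cosp ((x - 0) * 0).
  rewrite mulr0 cosp0 mulr1 ft_dilate// mul1r; congr (_ * ft _ _ _).
  by field.
have ft1 (k : int) : \int[mu]_x (l * ft 1 a (l * x - k%:~R)) = 1.
  under eq_Rintegral do rewrite ftE.
  by rewrite fourier_inversion// !mulr0 cosp0 a0 !mul1r.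
have ift (k : int) : mu.-integrable setT (EFin \o (fun x => l * ft 1 a (l * x - k%:~R))).
  have [E E0 aE] := ft_decay na'.
  apply: (@Rintegrable_le _ _ _ mu setT _ (fun x => E * (1 + (x - k%:~R / l) ^+ 2)^-1)) => //.
  - apply: measurable_funM => //; apply: continuous_measurable_fun.
    apply: (continuous_fun_comp (ft_continuous na)); exact: continuous_affine.
  - exact: integrable_decay.
  - by move=> x _; rewrite ftE mulr0 cosp0 mulr1; exact: aE.
pose g (k : int) x := ft 1 a (l * y - k%:~R) * (l * ft 1 a (l * x - k%:~R)).
have ig k : mu.-integrable setT (EFin \o g k) by apply: RintegrableZ.
have gE N x : zsum N (g ^~ x) = l * zsum N (fun k => ft 1 a (l * x - k%:~R) * ft 1 a (l * y - k%:~R)).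
  by rewrite -zsumZ; apply: eq_zsum => k; rewrite /g; ring.
have [|||||iK lim] := @Rintegral_dominated_cvg _ _ _ mu setT (fun N x => zsum N (g ^~ x))
  (fun x => l * rkernel 1 a 2 (l * x) (l * y)) (fun x => l * C * (1 + l ^- 2) * (1 + (x - y) ^+ 2)^-1).
- exact: measurableT.
- by move=> N; have [/measurable_int/measurable_EFinP] := integrable_zsum N ig.
- by move=> x _; under eq_fun do rewrite gE; apply: cvgMr; exact: kernel_limit.
- exact: integrable_decay.
- move=> N x _; rewrite gE normrM gtr0_norm// -!mulrA; apply: ler_wpM2l; first exact: ltW.
  apply: le_trans (aC _ _ _) _; apply: ler_wpM2l => //.
  apply: le_trans (inv_oneDsqr_scale (x - y) l0); rewrite le_eqVlt; apply/orP; left; apply/eqP.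
  by congr ((1 + _)^-1); ring.
split => //.
have e0 : (fun N => \int[mu]_x zsum N (g ^~ x)) =
    (fun N => zsum N (fun k => ft 1 a (l * y - k%:~R) * cosp ((0 - k%:~R) * 0))).
  apply/funext => N; have [_ ->] := integrable_zsum N ig; apply: eq_zsum => k.
  by rewrite /g RintegralZl// ft1 mulr0 cosp0.
rewrite e0 in lim.
have Am : 1 + `|0 : R| <= 1%:R + 1 / 2 by rewrite normr0; lra.
have := @poisson _ 1 a (l * y) 0 0 1 na Am => lim2.
rewrite (cvg_unique (@Rhausdorff R) lim lim2) /= !add0r.
rewrite (nice_eq0 na (t := 1%:~R)) ?normr1// (nice_eq0 na (t := (- 1)%:~R)) ?mulrNz ?normrN ?normr1//.
by rewrite !mul0r !addr0 mulr0z mulr0 subr0 cosp0 a0 mulr1.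
Qed.

Lemma ae_neq (p : R) : {ae mu, forall y, y != p}.
Proof.
exists [set p]; split.
- exact: measurable_set1.
- exact: lebesgue_measure_set1.
- by move=> y /= /negP; rewrite negbK => /eqP.
Qed.

Lemma dilated_cauchy_continuous l y : continuous (fun x => l * (1 + (l * (y - x)) ^+ 2)^-1).
Proof.
have c1 : continuous (fun x => l * (y - x)) by apply: continuous_funZ; exact: continuous_reflect.
have c2 : continuous (fun x => 1 + l * (y - x) * (l * (y - x))).
  by apply: continuous_funD; [exact: cst_continuous|exact: continuous_funM].
apply: continuous_funZ => x; apply: cvgV; last exact: c2.
by rewrite gt_eqF// ltr_pwDl ?sqr_ge0.
Qed.

Lemma integral_dilated_cauchy_le l y p q : 0 < l -> p <= q ->
  \int[mu]_(x in `[p, q]) (l * (1 + (l * (y - x)) ^+ 2)^-1) <= 4.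
Proof.
move=> l0 pq.
have dF x : is_derive x 1 (fun x => atan (l * x + - (l * y))) (l * (1 + (l * (y - x)) ^+ 2)^-1).
  have h := @is_derive1_comp _ (@atan R) _ x _ _ (is_derive1_atan (l * x +
      - (l * y))) (is_derive_affine l (- (l * y)) x).
  apply: is_derive_eq; rewrite mulrC; congr (_ * (1 + _)^-1); ring.
rewrite (integral_antiderivative pq (@dilated_cauchy_continuous l y) dF).
have := atan_ltpi2 (l * q + - (l * y)); have := atan_gtNpi2 (l * p + - (l * y)); have := @pihalf_lt2 R.
lra.
Qed.

(** A majorant uniform in [l >= 1] that is integrable against any square-integrable function. Near
    the interval the mass of the Cauchy density suffices; far from it the density itself is small at
    every [x] of the interval. *)
Lemma kernel_smoothing_bound a b p q : meyer a b -> p < q ->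
  exists2 M, 0 <= M & forall l y, 1 <= l ->
    `|\int[mu]_(x in `[p, q]) (l * rkernel 1 a 2 (l * x) (l * y))| <= M * (1 + (y - p) ^+ 2)^-1.
Proof.
move=> ab pq; have [na _ _ _ _ _ _ _ _ _ _] := ab.
have A1 : 2 * 1 <= 2%:R + 1 / 2 :> R by lra.
have [C C0 bC] := rkernel_dilated_bound 0 na A1.
(* If [|y - p| > r], then [|x - p| <= |y - p| / 2] for every [x] in [[p, q]], hence
   [|y - p| <= 2 |y - x|]; moreover [|y - p| > 1]. *)
pose r := 2 * (q - p) + 1.
have r1 : 1 <= r by rewrite /r; lra.
exists (4 * C * (1 + r ^+ 2) + 8 * C * (q - p)) => [|l y l1].
  have : 0 <= 4 * C * (1 + r ^+ 2) by rewrite !mulr_ge0// addr_ge0// sqr_ge0.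
  have : 0 <= 8 * C * (q - p) by rewrite !mulr_ge0//; lra.
  lra.
have l0 : 0 < l by lra.
have T0 : 0 < 1 + (y - p) ^+ 2 by rewrite ltr_pwDl ?sqr_ge0.
have [iK _] := kernel_mass y ab l0.
have iKpq : mu.-integrable `[p, q] (EFin \o (fun x => l * rkernel 1 a 2 (l * x) (l * y))).
  by apply: integrableS iK.
pose g x := l * (1 + (l * (y - x)) ^+ 2)^-1.
have cg : continuous g by exact: dilated_cauchy_continuous.
have Kg x : `|l * rkernel 1 a 2 (l * x) (l * y)| <= C * g x.
  by rewrite normrM gtr0_norm// mulrCA ler_wpM2l ?(ltW l0)//; have := bC l x y; rewrite !addr0.
have B1 : `|\int[mu]_(x in `[p, q]) (l * rkernel 1 a 2 (l * x) (l * y))| <=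
    C * \int[mu]_(x in `[p, q]) g x.
  apply: le_trans (le_normr_Rintegral _ iKpq) _ => //.
  rewrite -continuous_RintegralZ//; apply: le_Rintegral => //.
  - exact: integrable_norm.
  - by apply: continuous_integrable; exact: continuous_funZ.
apply: le_trans B1 _; rewrite mulrDl.
have P1 : 0 <= 8 * C * (q - p) * (1 + (y - p) ^+ 2)^-1.
  by rewrite !mulr_ge0 ?invr_ge0//; [lra|exact: ltW].
have P2 : 0 <= 4 * C * (1 + r ^+ 2) * (1 + (y - p) ^+ 2)^-1.
  by rewrite !mulr_ge0 ?invr_ge0//; [rewrite addr_ge0// sqr_ge0|exact: ltW].
have [yr|yr] := leP `|y - p| r.
  apply: (@le_trans _ _ (4 * C * (1 + r ^+ 2) * (1 + (y - p) ^+ 2)^-1)); last by lra.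
  apply: (@le_trans _ _ (C * 4)); first by rewrite ler_wpM2l//; exact: integral_dilated_cauchy_le (ltW pq).
  rewrite ler_pdivlMr// (mulrC C) ler_wpM2l ?mulr_ge0// lerD2l.
  by rewrite -(real_normK (num_real (y - p))) ler_pXn2r// nnegrE; lra.
apply: (@le_trans _ _ (8 * C * (q - p) * (1 + (y - p) ^+ 2)^-1)); last by lra.
have gb x : p <= x <= q -> `|g x| <= 8 * (1 + (y - p) ^+ 2)^-1.
  move=> /andP[px xq].
  have v1 : `|y - p| <= 2 * `|y - x|.
    have -> : y - p = (y - x) + (x - p) by ring.
    have : `|(y - x) + (x - p)| <= `|y - x| + `|x - p| by exact: ler_normD.
    rewrite (ger0_norm (_ : 0 <= x - p)); last by lra.
    move: yr; have -> : y - p = (y - x) + (x - p) by ring.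
    rewrite /r; lra.
  have v2 : 1 < `|y - p| by apply: le_lt_trans yr.
  have e1 : (y - p) ^+ 2 <= 4 * (y - x) ^+ 2.
    rewrite -(real_normK (num_real (y - p))) -(real_normK (num_real (y - x))).
    by have := normr_ge0 (y - p); nra.
  have e2 : 1 <= (y - p) ^+ 2.
    by rewrite -(real_normK (num_real (y - p))) exprn_ege1// ltW.
  have p0 : 0 < 1 + (l * (y - x)) ^+ 2 by rewrite ltr_pwDl ?sqr_ge0.
  rewrite ger0_norm; last by rewrite /g mulr_ge0 ?invr_ge0// ltW.
  rewrite /g ler_pdivrMr// mulrAC ler_pdivlMr// exprMn.
  have : l * (y - x) ^+ 2 <= l ^+ 2 * (y - x) ^+ 2 by rewrite ler_wpM2r ?sqr_ge0// expr2 ler_peMl// ltW.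
  have : l <= l * (y - p) ^+ 2 by rewrite ler_peMr// ltW.
  have : l * (y - p) ^+ 2 <= l * (4 * (y - x) ^+ 2) by rewrite ler_wpM2l// ltW.
  lra.
have := integral_bound (ltW pq) cg gb; move: (Rintegral _ _ _) => J hJ.
have JJ : J <= 8 * (1 + (y - p) ^+ 2)^-1 * (q - p) by apply: le_trans (ler_norm J) hJ.
have := ler_wpM2l C0 JJ; move: (_^-1) => z; lra.
Qed.

(** By unit mass the error is the integral of the kernel against a difference of two values of the
    indicator. That difference vanishes for [x] close to [y], and away from [y] the kernel is of
    order [1 / (l (x - y)^2)]; the error is [O(1 / l)]. *)
Lemma kernel_smoothing_cvg a b p q y : meyer a b -> y != p -> y != q ->
  \int[mu]_(x in `[p, q]) ((2 : R) ^+ n * rkernel 1 a 2 ((2 : R) ^+ n * x) ((2 : R) ^+ n * y)) @[n --> \oo] -->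
  (\1_(`[p, q]%classic) y : R).
Proof.
move=> ab yp yq; have [na _ _ _ _ _ _ _ _ _ _] := ab.
have A1 : 2 * 1 <= 2%:R + 1 / 2 :> R by lra.
have [C C0 bC] := rkernel_dilated_bound 0 na A1.
have [d d0 dI] : exists2 d : R, 0 < d & forall x, \1_(`[p, q]%classic) x != \1_(`[p, q]%classic) y :>
    R -> d <= `|x - y|.
  (* Where the indicator differs at [x] and [y], one of the end points separates them. *)
  exists (Num.min `|y - p| `|y - q|); first by rewrite lt_min !normr_gt0 !subr_eq0 yp.
  move=> x; rewrite !indicE !mem_setE => xy.
  have [h|h] : (p - x) * (p - y) <= 0 \/ (q - x) * (q - y) <= 0.
    move: xy; rewrite !in_itv/=.
    have [px|px] := leP p x; have [py|py] := leP p y; have [xq|xq] := leP x q; have [yq'|yq'] := leP y q;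
      rewrite ?eqxx//= => _; try (by left; nra); try (by right; nra).
  - rewrite ge_min; apply/orP; left.
    by rewrite -ler_sqr ?nnegrE// !real_normK ?num_real//; have := sqr_ge0 (x - p); nra.
  - rewrite ge_min; apply/orP; right.
    by rewrite -ler_sqr ?nnegrE// !real_normK ?num_real//; have := sqr_ge0 (x - q); nra.
pose Z := \int[mu]_x (C * (1 + d ^- 2) * (1 + (x - y) ^+ 2)^-1).
have key l : 0 < l -> `|\1_(`[p, q]%classic) y - \int[mu]_(x in `[p, q]) (l * rkernel 1 a 2 (l * x)
    (l * y))| <= l^-1 * Z.
  move=> l0; have [iK mK] := kernel_mass y ab l0.
  pose I : set R := `[p, q]%classic.
  have mI : measurable_fun setT (\1_I : R -> R) by apply: measurable_indic; exact: measurable_itv.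
  have mKl : measurable_fun setT (fun x => l * rkernel 1 a 2 (l * x) (l * y)).
    by have /measurable_int/measurable_EFinP := iK.
  have -> : \int[mu]_(x in `[p, q]) (l * rkernel 1 a 2 (l * x) (l * y)) =
      \int[mu]_x (l * rkernel 1 a 2 (l * x) (l * y) * \1_I x).
    rewrite Rintegral_mkcond; apply: eq_Rintegral => x _; rewrite patchE indicE.
    by case: ifPn => _; rewrite ?mulr1 ?mulr0.
  have -> : \1_I y = \int[mu]_x (\1_I y * (l * rkernel 1 a 2 (l * x) (l * y))).
    by rewrite RintegralZl// mK mulr1.
  rewrite -RintegralB//; last 2 first.
  - exact: RintegrableZ.
  - apply: Rintegrable_le (integrable_norm iK) _ => //; first exact: measurable_funM.
    move=> x _ /=; rewrite normrM -[leRHS]mulr1 ler_wpM2l// indicE.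
    by case: (_ \in _); rewrite ?normr1 ?normr0.
  have iZ := integrable_decay (C * (1 + d ^- 2)) y.
  rewrite /Z -RintegralZl//.
  have B x : `|\1_I y * (l * rkernel 1 a 2 (l * x) (l * y)) - l * rkernel 1 a 2 (l * x) (l * y) * \1_I x| <=
      l^-1 * (C * (1 + d ^- 2) * (1 + (x - y) ^+ 2)^-1).
    have rhs0 : 0 <= l^-1 * (C * (1 + d ^- 2) * (1 + (x - y) ^+ 2)^-1).
      rewrite !mulr_ge0 ?invr_ge0 ?addr_ge0 ?sqr_ge0 ?invr_ge0 ?exprn_ge0//; exact: ltW.
    rewrite (mulrC _ (\1_I x)) -mulrBl normrM.
    have [->|xy] := eqVneq (\1_I x : R) (\1_I y); first by rewrite subrr normr0 mul0r.
    have dx := dI x xy.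
    apply: (@le_trans _ _ (1 * (l * (C * (1 + (l * (y - x)) ^+ 2)^-1)))).
      apply: ler_pM => //.
        by rewrite !indicE; case: (_ \in _); case: (_ \in _);
            rewrite ?subrr ?subr0 ?sub0r ?normrN ?normr0 ?normr1.
      by rewrite normrM gtr0_norm// ler_wpM2l ?(ltW l0)//; have := bC l x y; rewrite !addr0.
    rewrite mul1r mulrCA [leRHS]mulrCA -(mulrA C); apply: ler_wpM2l => //.
    have v0 : 0 < (x - y) ^+ 2.
      by rewrite -(real_normK (num_real (x - y))) exprn_gt0// (lt_le_trans d0).
    have p0 : 0 < 1 + (l * (y - x)) ^+ 2 by rewrite ltr_pwDl ?sqr_ge0.
    have q0 : 0 < 1 + (x - y) ^+ 2 by rewrite ltr_pwDl ?sqr_ge0.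
    have dw : d ^+ 2 <= (x - y) ^+ 2.
      by rewrite -(real_normK (num_real (x - y))) ler_pXn2r// nnegrE ltW.
    (* With [u = x - y] this yields [l / (1 + (l u)^2) <= l^-1 u^-2]; and
       [u^-2 <= (1 + d^-2) / (1 + u^2)] because [|u| >= d]. *)
    have E : l = l^-1 * ((x - y) ^+ 2)^-1 * (l ^+ 2 * (x - y) ^+ 2).
      have xy0 : x - y != 0 by rewrite -sqrf_eq0 gt_eqF.
      by field; rewrite xy0 gt_eqF.
    apply: (@le_trans _ _ (l^-1 * ((x - y) ^+ 2)^-1)).
      rewrite ler_pdivrMr// [leLHS]E; apply: ler_wpM2l.
        by rewrite mulr_ge0// invr_ge0 ltW.
      by rewrite -(sqrrN (x - y)) opprB -exprMn lerDr.
    rewrite mulrCA; apply: ler_wpM2l; first by rewrite invr_ge0 ltW.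
    rewrite ler_pdivlMr// mulrDr mulr1 mulVf ?gt_eqF// addrC lerD2l.
    by rewrite lef_pV2// posrE exprn_gt0.
  apply: le_trans (le_normr_Rintegral _ _) _ => //.
    apply: Rintegrable_le (RintegrableZ l^-1 _ iZ) _ => //.
    by apply: measurable_funB; apply: measurable_funM.
  apply: le_Rintegral => //.
  - apply: Rintegrable_le (RintegrableZ l^-1 _ iZ) _ => //; last by move=> x _; rewrite normr_id; exact: B.
    by apply: measurableT_comp => //; apply: measurable_funB; apply: measurable_funM.
  - exact: RintegrableZ.
apply/cvgrPdist_le => e e0; near=> n.
have l0 : 0 < (2 : R) ^+ n by rewrite exprn_gt0.
apply: le_trans (key _ l0) _; rewrite ler_pdivrMl// -ler_pdivrMr//.
apply: (@le_trans _ _ n%:R); last by rewrite -natrX ler_nat ltnW// ltn_expl.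
by near: n; exact: nbhs_infty_ger.
Unshelve. all: by end_near. Qed.

End ApproximateIdentity.

(** * Measurability of integrals depending on a parameter *)

Section ParametricIntegral.
Variables (R : realType) (d1 d2 : measure_display) (T1 : measurableType d1) (T2 : measurableType d2).
Variables (m1 : {sigma_finite_measure set T1 -> \bar R}).

(** The integral is the finite part of a difference of integrals of the positive and negative parts,
    and Tonelli makes each of these measurable in the parameter. *)
Lemma measurable_Rintegral_param (D : set T1) (F : T1 -> T2 -> R) : measurable D ->
  measurable_fun setT (fun z : T1 * T2 => F z.1 z.2) ->
  measurable_fun setT (fun y => \int[m1]_(x in D) F x y).
Proof.
move=> mD mF.
pose G (z : T2 * T1) := \1_D z.2 * F z.2 z.1 : R.
have mG : measurable_fun setT G.
  apply: measurable_funM.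
    by apply: measurableT_comp; [exact: measurable_indic|exact: measurable_snd].
  have ms : measurable_fun setT (fun z : T2 * T1 => (z.2, z.1)).
    by apply/measurable_fun_pairP; split; [exact: measurable_snd|exact: measurable_fst].
  exact: (measurableT_comp mF ms).
have -> : (fun y => \int[m1]_(x in D) F x y) = (fun y =>
    fine (\int[m1]_x (maxe ((EFin \o G) (y, x)) 0) - \int[m1]_x (maxe (- ((EFin \o G) (y, x))) 0))%E).
  apply/funext => y; rewrite /Rintegral integral_mkcond integralE; congr (fine _).
  congr (_ - _)%E; apply: eq_integral => x _; rewrite ?funeposE ?funenegE patchE /G /= indicE;
  by case: ifPn => _; rewrite ?mul1r ?mul0r.
apply: (@measurableT_comp _ _ _ _ _ _ (@fine R)) => //.
apply: emeasurable_funB.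
- apply: (@measurable_fun_fubini_tonelli_F _ _ _ _ R m1 (fun z => maxe ((EFin \o G) z) 0)).
    by apply: measurable_maxe; [exact/measurable_EFinP|exact: measurable_cst].
  by move=> z; rewrite le_max lexx orbT.
- apply: (@measurable_fun_fubini_tonelli_F _ _ _ _ R m1 (fun z => maxe (- (EFin \o G) z) 0)%E).
    apply: measurable_maxe; last exact: measurable_cst.
    by apply: measurableT_comp => //; exact/measurable_EFinP.
  by move=> z; rewrite le_max lexx orbT.
Qed.

End ParametricIntegral.

(** * Completeness of the wavelet system *)

Section Completeness.
Variable R : realType.
Local Notation mu := (@lebesgue_measure R).
Implicit Types (f w a b h : R -> R) (A c l p q r s t u v x y xi : R) (N m n : nat).

(** The kernels are applied to the indicator of an interval instead of to [f]: the smoothed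
    indicators [L n] are orthogonal to [f] and converge to the indicator almost everywhere, so all
    interval integrals of [f] vanish. *)
Lemma wavelet_completeness a b f : meyer a b -> sqint setT f ->
  (forall j k : int, \int[mu]_y (f y * ft (3 / 2) b ((2 : R) ^ j * y - k%:~R + 1 / 2)) = 0) ->
  {ae mu, forall x, f x = 0}.
Proof.
move=> ab sf f0; have [na _ _ _ _ _ _ _ _ _ _] := ab; have [mf if2] := sf.
have A1 : 2 * 1 <= 2%:R + 1 / 2 :> R by lra.
have [C C0 bC] := rkernel_dilated_bound 0 na A1.
have fI p q : mu.-integrable `[p, q] (EFin \o f).
  apply: (@Rintegrable_le _ _ _ mu `[p, q] f (fun x => f x ^+ 2 + 1)) => //.
  - exact: measurable_funTS.
  - apply: RintegrableD => //; first by apply: integrableS if2.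
    by apply: continuous_integrable; exact: cst_continuous.
  - move=> x _; rewrite -(real_normK (num_real (f x))); have := sqr_ge0 (`|f x| - 1); nra.
apply: ae_eq0_of_itv_integral => // p q pq.
pose K n x y := (2 : R) ^+ n * rkernel 1 a 2 ((2 : R) ^+ n * x) ((2 : R) ^+ n * y).
have mK n : measurable_fun setT (fun z : R * R => K n z.1 z.2).
  apply: measurable_funM => //.
  have m1 : measurable_fun setT (fun z : R * R => ((2 : R) ^+ n * z.1, (2 : R) ^+ n * z.2)).
    by apply/measurable_fun_pairP; split; apply: measurable_funM.
  exact: (measurableT_comp (kernel_measurable na A1) m1).
have [M M0 LM] := kernel_smoothing_bound ab pq.
pose L n y := \int[mu]_(x in `[p, q]) K n x y.
have l1 n : 1 <= (2 : R) ^+ n by rewrite exprn_ege1// ler1n.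
have l0 n : 0 < (2 : R) ^+ n by rewrite exprn_gt0.
have idom := sqint_decay_integrable p sf.
have iF n x : \int[mu]_y (f y * K n x y) = 0 by exact: orthogonal_scaling_kernel ab sf f0.
have mL n : measurable_fun setT (L n) by apply: (@measurable_Rintegral_param _ _ _ _ _ mu `[p, q] (K
    n)); [exact: measurable_itv|exact: mK].
(* Fubini puts the integral over [[p, q]] outside, and the inner integral vanishes for every [x]. *)
have fL n : \int[mu]_y (f y * L n y) = 0.
  pose F x y := f y * K n x y.
  have mF : measurable_fun setT (fun z : R * R => F z.1 z.2).
    by apply: measurable_funM; [exact: (measurableT_comp mf measurable_snd)|exact: mK].
  have := @Rintegral_swap _ _ _ _ _ mu mu `[p, q] setT F (fun=> 1)
    (fun y => 2 ^+ n * C * (1 + (2 ^+ n) ^- 2) * (2 + 2 * (q - p) ^+ 2) * (`|f y| * (1 + (y - p) ^+ 2)^-1)).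
  have -> : \int[mu]_(x in `[p, q]) \int[mu]_y F x y = 0.
    by apply: Rintegral_eq0 => x _; exact: iF.
  have -> : \int[mu]_y (f y * L n y) = \int[mu]_y \int[mu]_(x in `[p, q]) F x y.
    apply: eq_Rintegral => y _; rewrite /F RintegralZl//.
    by have [iK _] := kernel_mass y ab (l0 n); apply: integrableS iK.
  move=> swap; apply/esym/swap => //.
  - by apply: continuous_integrable; exact: cst_continuous.
  - exact: RintegrableZ.
  - move=> x y; rewrite /= in_itv/= => /andP[px xq] _; rewrite mul1r /F /K normrM mulrCA ler_wpM2l//.
    rewrite normrM gtr0_norm// -!mulrA ler_wpM2l ?(ltW (l0 n))//.
    have := bC (2 ^+ n) x y; rewrite !addr0 => /le_trans; apply; rewrite ler_wpM2l//.
    apply: le_trans (inv_oneDsqr_scale (y - x) (l0 n)) _; rewrite ler_wpM2l//.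
    rewrite -sqrrN opprB (le_trans (inv_oneDsqr_shift p x y))// -(sqrrN (y - p)) opprB ler_wpM2r//.
      by rewrite invr_ge0 addr_ge0// sqr_ge0.
    by have := ltW pq; nra.
have [||||||_ lim] := @Rintegral_dominated_cvg_ae _ _ _ mu setT (fun n y => f y * L n y)
  (fun y => f y * \1_(`[p, q]%classic) y) (fun y => M * (`|f y| * (1 + (y - p) ^+ 2)^-1)).
- exact: measurableT.
- by move=> n; apply: measurable_funM; [exact: mf|exact: mL].
- by apply: measurable_funM; [exact: mf|apply: measurable_indic; exact: measurable_itv].
- have [np nq] := (ae_neq p, ae_neq q).
  apply: (filterS2 (F := almost_everywhere mu)) np nq => y yp yq _; apply: cvgMr;
      exact: (kernel_smoothing_cvg ab yp yq).
- exact: RintegrableZ.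
- by move=> n y _; rewrite normrM mulrCA ler_wpM2l//; exact: LM.
have e0 : (fun n => \int[mu]_y (f y * L n y)) = (fun=> 0) by apply/funext => n; exact: fL.
rewrite e0 in lim.
have := cvg_unique (@Rhausdorff R) lim (@cvg_cst _ (0 : R) _ _ _) => /= e1.
rewrite Rintegral_mkcond -[RHS]e1; apply: eq_Rintegral => x _; rewrite patchE indicE.
by case: ifPn => _; rewrite ?mulr1 ?mulr0.
Qed.

End Completeness.

(** * Orthonormality *)

Section Orthonormality.
Variable R : realType.
Local Notation mu := (@lebesgue_measure R).
Implicit Types (f w a b h : R -> R) (A c l p q r s t u v x y xi : R) (N m n : nat).

Lemma integral_even f A : 0 <= A -> continuous f -> (forall t, f (- t) = f t) ->
  \int[mu]_(t in `[(- A)%R, A]) f t = 2 * \int[mu]_(t in `[0, A]) f t.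
Proof.
move=> A0 cf fe; rewrite (integral_split (b := 0)) ?oppr_le0//.
have := integral_reflect 0 A0 cf; rewrite sub0r subr0 => <-.
rewrite (@eq_itv_Rintegral _ _ _ (fun x => f (0 - x)) f) => [|x _]; first by ring.
by rewrite sub0r.
Qed.

Lemma integral_fold f g p q d : p <= q -> continuous f -> continuous g -> d = p + q ->
  (forall t, p <= t <= q -> f t + f (d - t) = g t) ->
  2 * \int[mu]_(t in `[p, q]) f t = \int[mu]_(t in `[p, q]) g t.
Proof.
move=> pq cf cg -> fg.
have := integral_reflect (p + q) pq cf; rewrite addrK [p + q]addrC addrK => E.
rewrite -(eq_itv_Rintegral fg) (continuous_RintegralD _ _ cf (g := fun t => f (p + q - t))); last first.
  by apply: (continuous_fun_comp cf); exact: continuous_reflect.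
by rewrite (addrC p q) E; ring.
Qed.

Lemma integral_unit_cosp p (m : int) : \int[mu]_(t in `[p, (p + 1)%R]) cosp (m%:~R * t) = (m == 0)%:R :> R.
Proof.
have := @integral_shift _ (fun t => cosp (m%:~R * t)) 0 1 p ler01 (@cosp_continuousM R m%:~R).
rewrite add0r (addrC 1) => <-.
under eq_Rintegral do rewrite mulrDr.
rewrite integral_cosp_period; have [->|_] := eqVneq m 0; last by rewrite mul0r.
by rewrite mul0r cosp0 mulr1.
Qed.

Lemma meyer_continuous a b l c : meyer a b -> continuous (fun t => b (l * t) * b t * cosp (c * t)).
Proof.
move=> [_ nb _ _ _ _ _ _ _ _ _]; have cb := nice_continuous nb.
apply: continuous_funM; last exact: cosp_continuousM.
by apply: continuous_funM => //; apply: (continuous_fun_comp cb); apply: continuous_funZ => ?; exact: cvg_id.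
Qed.

(** The half [[1/3, 4/3]] of the support is folded about [1/2] on [[1/3, 2/3]] and about [1] on
    [[2/3, 4/3]]. The cosine is invariant under both reflections, so the squares of [b] add up to
    [1] and there remains the integral of the cosine over a full period. *)
Lemma meyer_same_scale a b (k : int) : meyer a b ->
  \int[mu]_(t in `[- (3 / 2), (3 / 2)%R]) (b (1 * t) * b t * cosp (k%:~R * t)) = (k == 0)%:R.
Proof.
move=> ab; have := ab => -[_ nb _ _ _ _ blow bhigh s1 s2 _].
have cF := @meyer_continuous a b 1 k%:~R ab.
have be := nice_even nb.
rewrite integral_even// => [|t]; last by rewrite !mulrN !be cosp_opp.
rewrite (@integral_widen _ _ 0 (1 / 3) (4 / 3) (3 / 2)) ?divr_ge0//; [|lra|lra|]; last first.
  move=> x /andP[x0 _] /orP[h|h].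
    by rewrite (blow x) ?mulr0 ?mul0r// ger0_norm.
  by rewrite (bhigh x) ?mulr0 ?mul0r// ger0_norm.
rewrite (@integral_split _ _ (1 / 3) (2 / 3)) //; [|lra|lra].
have cc := @cosp_continuousM R k%:~R.
rewrite mulrDr (@integral_fold _ (fun t => cosp (k%:~R * t)) _ _ 1) //; [|lra|lra|]; last first.
  move=> t th; rewrite !mul1r (_ : cosp (k%:~R * (1 - t)) = cosp (k%:~R * t)).
    by rewrite -!expr2 -mulrDl s1// mul1r.
  by rewrite mulrBr mulr1 addrC cosp_period cosp_opp.
rewrite (@integral_fold _ (fun t => cosp (k%:~R * t)) _ _ 2) //; [|lra|lra|]; last first.
  move=> t th; rewrite !mul1r (_ : cosp (k%:~R * (2 - t)) = cosp (k%:~R * t)).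
    by rewrite -!expr2 -mulrDl s2// mul1r.
  by rewrite mulrBr addrC -[2]/(2%:~R) -intrM cosp_period cosp_opp.
rewrite -(@integral_split _ _ (1 / 3) (2 / 3) (4 / 3) _ _ cc); [|lra|lra].
by rewrite -(integral_unit_cosp (1 / 3)) (_ : 1 / 3 + 1 = 4 / 3 :> R)//; field.
Qed.

(** On [[1/3, 2/3]] the product [b (2 * t) * b t] is invariant under [t -> 1 - t], while the
    half-integer frequency makes the cosine change sign. *)
Lemma meyer_adjacent_scale a b (k : int) : meyer a b ->
  \int[mu]_(t in `[- (3 / 2), (3 / 2)%R]) (b (2 * t) * b t * cosp ((k%:~R + 1 / 2) * t)) = 0.
Proof.
move=> ab; have := ab => -[_ nb _ _ _ _ blow bhigh _ _ s3].
have cF := @meyer_continuous a b 2 (k%:~R + 1 / 2) ab.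
have be := nice_even nb.
rewrite integral_even// => [|t]; last by rewrite !mulrN !be cosp_opp.
rewrite (@integral_widen _ _ 0 (1 / 3) (2 / 3) (3 / 2)) ?divr_ge0//; [|lra|lra|]; last first.
  move=> x /andP[x0 _] /orP[h|h].
    by rewrite (blow x) ?mulr0 ?mul0r// ger0_norm.
  by rewrite (bhigh (2 * x)) ?mul0r// ger0_norm; lra.
rewrite (@integral_fold _ (fun=> 0) _ _ 1) //; [|lra|exact: cst_continuous|lra|].
  by rewrite Rintegral_eq0.
move=> t th.
have E : b (2 * t) * b t = b (2 * (1 - t)) * b (1 - t).
  have := s3 (2 * t); rewrite (_ : 2 * t / 2 = t); last by field.
  rewrite (_ : 2 - 2 * t = 2 * (1 - t)); last by ring.
  rewrite (_ : 2 * (1 - t) / 2 = 1 - t); last by field.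
  by apply; lra.
rewrite E -mulrDr (_ : (k%:~R + 1 / 2) * (1 - t) = - ((k%:~R + 1 / 2) * t) + 1 / 2 + k%:~R); last by ring.
by rewrite cosp_period cosp_half cosp_opp subrr mulr0.
Qed.

Lemma meyer_distant_scale a b c n : meyer a b ->
  \int[mu]_(t in `[- (3 / 2), (3 / 2)%R]) (b ((2 : R) ^+ n.+2 * t) * b t * cosp (c * t)) = 0.
Proof.
move=> [_ nb _ _ _ _ blow bhigh _ _ _]; apply: Rintegral_eq0 => t _.
have [t3|t3] := leP `|t| (1 / 3); first by rewrite (blow t) ?mulr0 ?mul0r.
rewrite bhigh ?mul0r// normrM ger0_norm ?exprn_ge0// !exprS.
have : 1 <= (2 : R) ^+ n by rewrite exprn_ege1// ler1n.
by move: (_ ^+ n) => z z1; nra.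
Qed.

Definition wavelet_fun b (j k : int) x : R :=
  Num.sqrt 2 ^ j * ft (3 / 2) b ((2 : R) ^ j * x - k%:~R + 1 / 2).

(** Each wavelet is the transform of a dilated multiplier centred at [(k - 1/2) / 2^j]. After
    Plancherel, rescaling the frequency by [2^(j + n)] puts the finer multiplier back at unit scale,
    and only the scale difference [n] survives. *)
Lemma wavelet_inner_product a b (j k k' : int) n : meyer a b ->
  \int[mu]_x (wavelet_fun b j k x * wavelet_fun b (j + n%:Z) k' x) =
  Num.sqrt 2 ^+ n * \int[mu]_(t in `[- (3 / 2), (3 / 2)%R])
    (b ((2 : R) ^+ n * t) * b t * cosp (((k%:~R - 1 / 2) * (2 : R) ^+ n - (k'%:~R - 1 / 2)) * t)).
Proof.
move=> ab; have := ab => -[_ nb _ _ _ _ _ _ _ _ _].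
have l0 (i : int) : 0 < (2 : R) ^ i by rewrite exprz_gt0.
have ln0 (i : int) : (2 : R) ^ i != 0 by rewrite gt_eqF.
pose B (i : int) s := Num.sqrt 2 ^ i / 2 ^ i * b ((2 ^ i)^-1 * s).
have nB i : nice (2 ^ i * (3 / 2)) (B i) by exact: nice_dilate.
have WE (i m : int) x : wavelet_fun b i m x = ft (2 ^ i * (3 / 2)) (B i) (x - (m%:~R - 1 / 2) / 2 ^ i).
  rewrite ft_dilate// divfK// /wavelet_fun; congr (_ * ft _ _ _); field; exact: ln0.
under eq_Rintegral do rewrite !WE.
rewrite plancherel//.
pose l := (2 : R) ^ (j + n%:Z).
set c := _ - _.
pose F s := B j s * B (j + n%:Z) s * cosp (c * s).
have cF : continuous F.
  apply: continuous_funM; last exact: cosp_continuousM.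
  by apply: continuous_funM; apply: nice_continuous.
have H : - (3 / 2) <= 3 / 2 :> R by lra.
have := integral_affine 0 H (l0 (j + n%:Z)) cF.
rewrite !addr0 mulrN => E.
rewrite -[LHS](mulVKf (ln0 (j + n%:Z))) -E.
rewrite -continuous_RintegralZ; last first.
  by apply: (continuous_fun_comp cF); exact: continuous_affine.
rewrite -continuous_RintegralZ; last exact: meyer_continuous ab.
apply: eq_itv_Rintegral => t _; rewrite addr0 /F /B.
have e1 : (2 : R) ^ (j + n%:Z) = 2 ^ j * 2 ^+ n by rewrite expfzDr.
have e2 : Num.sqrt (2 : R) ^ (j + n%:Z) = Num.sqrt 2 ^ j * Num.sqrt 2 ^+ n.
  by rewrite expfzDr// gt_eqF// sqrtr_gt0.
have e3 : (2 : R) ^ j = Num.sqrt 2 ^ j * Num.sqrt 2 ^ j.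
  by rewrite -expfzMl -expr2 sqr_sqrtr.
have e4 : (2 : R) ^ j != 0 := ln0 j.
have e5 : (2 : R) ^+ n != 0 by rewrite gt_eqF// exprn_gt0.
have -> : c * (2 ^ (j + n%:Z) * t) = ((k%:~R - 1 / 2) * 2 ^+ n - (k'%:~R - 1 / 2)) * t.
  by rewrite /c e1; field; rewrite e4 e5.
have -> : (2 ^ j)^-1 * (2 ^ (j + n%:Z) * t) = 2 ^+ n * t :> R by rewrite e1; field.
have key : 2 ^ (j + n%:Z) * (Num.sqrt 2 ^ j / 2 ^ j) * (Num.sqrt 2 ^ (j + n%:Z) / 2 ^ (j + n%:Z)) =
    Num.sqrt 2 ^+ n :> R.
  rewrite e2; transitivity (Num.sqrt 2 ^ j * Num.sqrt 2 ^ j / 2 ^ j * Num.sqrt 2 ^+ n : R).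
    by field; rewrite e4 ln0.
  by rewrite -e3 divff// mul1r.
by rewrite mulKf// -key; ring.
Qed.

Lemma wavelet_orthonormal a b (j k j' k' : int) : meyer a b ->
  \int[mu]_x (wavelet_fun b j k x * wavelet_fun b j' k' x) = ((j == j') && (k == k'))%:R.
Proof.
move=> ab.
wlog jj : j k j' k' / j <= j'.
  move=> H; have [/H->//|/ltW/H E] := leP j j'.
  under eq_Rintegral do rewrite mulrC.
  by rewrite E eq_sym (eq_sym k).
have [n ->] : exists n : nat, j' = j + n%:Z by exists `|j' - j|%N; rewrite gez0_abs; lia.
rewrite (wavelet_inner_product _ _ _ _ ab).
case: n => [|[|n]].
- rewrite expr0 mul1r mulr1 addr0 eqxx /= -subr_eq0 -(meyer_same_scale _ ab) intrB.
  by apply: eq_itv_Rintegral => t _; congr (_ * cosp (_ * _)); ring.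
- rewrite (_ : (j == _) = false) /=; last by apply/eqP; lia.
  have -> : (k%:~R - 1 / 2) * (2 : R) ^+ 1 - (k'%:~R - 1 / 2) = (2 * k - k' - 1)%:~R + 1 / 2.
    by rewrite !intrD !intrM !mulrNz expr1; field.
  by rewrite expr1 (meyer_adjacent_scale _ ab) mulr0.
- rewrite (_ : (j == _) = false) /=; last by apply/eqP; lia.
  by rewrite (meyer_distant_scale _ _ ab) mulr0.
Qed.

End Orthonormality.

(** * The Meyer wavelet: orthonormal basis and band limit *)

Section MeyerWavelet.
Variable R : realType.
Local Notation mu := (@lebesgue_measure R).
Implicit Types (f g w a b h : R -> R) (A c l p q r s t u v x y xi : R) (N m n : nat).

Lemma sqint_continuous_itv f p q : continuous f -> sqint `[p, q] f.
Proof.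
move=> cf; split; first by apply: measurable_funTS; exact: continuous_measurable_fun.
by apply: continuous_integrable; exact: continuous_funM.
Qed.

Lemma ft_shift_sqint A b c : nice A b -> sqint setT (fun x => ft A b (x + c)).
Proof.
move=> nb; have [C C0 bC] := ft_decay nb.
have cf : continuous (fun x => ft A b (x + c)).
  by apply: (continuous_fun_comp (ft_continuous nb)); exact: continuous_addr.
split; first exact: continuous_measurable_fun.
apply: (@Rintegrable_le _ _ _ mu setT _ (fun x => C * C * (1 + (x - - c) ^+ 2)^-1)) => //.
- by apply: continuous_measurable_fun; exact: continuous_funM.
- exact: integrable_decay.
move=> x _; rewrite opprK normrX; have := bC (x + c); have := normr_ge0 (ft A b (x + c)).
have : (1 + (x + c) ^+ 2)^-1 <= 1 by rewrite invf_le1 ?ltr_pwDl ?sqr_ge0// lerDl sqr_ge0.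
have : 0 <= (1 + (x + c) ^+ 2)^-1 by rewrite invr_ge0 addr_ge0// sqr_ge0.
move: (_^-1) `|_| => z y z0 z1 y0 yC; rewrite expr2 -mulrA; apply: ler_pM => //.
by rewrite (le_trans yC)// ler_piMr.
Qed.

(** As the wavelet is real, the real part of the inner product sees only [f1] and the imaginary part
    only [f2]; complex completeness is real completeness used twice. *)
Lemma meyer_wavelet_onb a b : meyer a b ->
  wavelet_onb (fun x => ft (3 / 2) b (x + 1 / 2)) (fun=> 0).
Proof.
move=> ab; have := ab => -[_ nb _ _ _ _ _ _ _ _ _].
have i0 : sqint setT (fun=> 0 : R).
  split; first exact: measurable_cst.
  by under eq_fun do rewrite expr0n; exact: integrable0.
have wE j k : wjk j k (fun x => ft (3 / 2) b (x + 1 / 2)) = wavelet_fun b j k by [].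
have w0 j k : wjk j k (fun=> 0 : R) = fun=> 0.
  by apply/funext => x; rewrite /wjk mulr0.
split; [|split].
- by split => //; exact: ft_shift_sqint.
- move=> j k j' k'; rewrite !wE !w0; split.
    rewrite /ipRe -(wavelet_orthonormal j k j' k' ab).
    by under eq_Rintegral do rewrite mulr0 addr0.
  rewrite /ipIm; under eq_Rintegral do rewrite mul0r mulr0 subr0.
  by rewrite /Rintegral integral0.
- move=> f1 f2 [sf1 sf2] H.
  have cmpl f : sqint setT f ->
      (forall j k : int, \int[mu]_y (f y * wavelet_fun b j k y) = 0) -> {ae mu, forall x, f x = 0}.
    move=> sf fw; apply: (wavelet_completeness ab sf) => j k.
    have s0 : Num.sqrt (2 : R) ^ j != 0 by rewrite expfz_neq0// gt_eqF// sqrtr_gt0.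
    apply: (mulfI s0); rewrite mulr0 -[RHS](fw j k).
    have l0 : 0 < (2 : R) ^ j by rewrite exprz_gt0.
    have [C C0 bC] := ft_decay nb.
    rewrite -RintegralZl//; first by apply: eq_Rintegral => y _; rewrite /wavelet_fun mulrCA.
    apply: (@dilated_decay_integrable _ f (2 ^ j) ((k%:~R - 1 / 2) / 2 ^ j) C) => //.
      apply: continuous_measurable_fun; apply: (continuous_fun_comp (ft_continuous nb)) => y.
      by apply: cvgD; [apply: cvgB; [apply: cvgMr; exact: cvg_id|exact: cvg_cst]|exact: cvg_cst].
    move=> y; apply: le_trans (bC _) _; rewrite le_eqVlt; apply/orP; left; apply/eqP.
    by congr (_ * (1 + _ ^+ 2)^-1); field; rewrite gt_eqF.
  have a1 : {ae mu, forall x, f1 x = 0}.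
    apply: cmpl => // j k; have [+ _] := H j k; rewrite /ipRe wE w0 => <-.
    by under [in RHS]eq_Rintegral do rewrite mulr0 addr0.
  have a2 : {ae mu, forall x, f2 x = 0}.
    apply: cmpl => // j k; have [_ +] := H j k; rewrite /ipIm wE w0 => <-.
    by under [in RHS]eq_Rintegral do rewrite mulr0 subr0.
  by apply: (filterS2 (F := almost_everywhere mu)) a1 a2 => x.
Qed.

(** The definition integrates [cos (x * t)] without [2 pi], hence the rescaled multiplier [B]. The
    translation by [c] becomes a modulation, which is the origin of [g2]; the imaginary part is an
    odd integral. *)
Lemma ft_shift_bandlimited A b c : nice A b ->
  bandlimited (fun x => ft A b (x + c)) (fun=> 0).
Proof.
move=> nb; have A0 := nice_gt0 nb; have cb := nice_continuous nb.
have p0 : 0 < 2 * pi :> R by rewrite mulr_gt0// pi_gt0.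
have pn0 : 2 * pi != 0 :> R by rewrite gt_eqF.
pose B s := (2 * pi)^-1 * b ((2 * pi)^-1 * s).
have linc r : continuous (fun s : R => r * s) by apply: continuous_funZ => ?; exact: cvg_id.
have ccos r : continuous (fun s : R => cos (r * s)).
  by apply: continuous_fun_comp; [exact: continuous_cos|exact: linc].
have csin r : continuous (fun s : R => sin (r * s)).
  by apply: continuous_fun_comp; [exact: continuous_sin|exact: linc].
have cB : continuous B by apply: continuous_funZ; apply: (continuous_fun_comp cb).
exists (2 * pi * A), (fun s => B s * cos (c * s)), (fun s => B s * sin (c * s)).
split; first by apply: sqint_continuous_itv; exact: continuous_funM.
split; first by apply: sqint_continuous_itv; exact: continuous_funM.
move=> x; split.
  pose F s := B s * cos ((x + c) * s).
  have cF : continuous F by exact: continuous_funM.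
  have AA : - A <= A by lra.
  have := integral_affine 0 AA p0 cF; rewrite !addr0 mulrN => E.
  rewrite (@eq_itv_Rintegral _ _ _ (fun t =>
      B t * cos (c * t) * cos (x * t) - B t * sin (c * t) * sin (x * t)) F).
    rewrite -[RHS](mulVKf pn0) -E -continuous_RintegralZ; last first.
      by apply: (continuous_fun_comp cF); exact: continuous_affine.
    apply: eq_itv_Rintegral => t _; rewrite addr0 /F /B mulKf// !mulrA mulfV// mul1r /cosp.
    by congr (_ * cos _); ring.
  by move=> t _; rewrite /F mulrDl cosD; ring.
rewrite (@eq_itv_Rintegral _ _ _ _ (fun s => B s * sin ((x + c) * s))).
  rewrite integral_odd//; first by rewrite mulr_ge0// ltW.
    exact: continuous_funM.
  by move=> t; rewrite /B !mulrN (nice_even nb) sinN mulrN.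
by move=> t _; rewrite mulrDl sinD; ring.
Qed.

End MeyerWavelet.

(** * Infinite convolutions of uniform densities *)

Section Averages.
Variable R : realType.
Local Notation mu := (@lebesgue_measure R).
Implicit Types (f g u v : R -> R) (a c l p q r s t x y L : R) (N m n : nat).

Lemma is_derive_comp_affine f (df : R -> R) c d x : (forall y, is_derive y 1 f (df y)) ->
  is_derive x 1 (fun y => f (c * y + d)) (c * df (c * x + d)).
Proof.
move=> dF; have h := @is_derive1_comp _ f _ x _ _ (dF (c * x + d)) (is_derive_affine c d x).
by apply: is_derive_eq; rewrite mulrC.
Qed.

Lemma is_derive_comp_addl f (df : R -> R) d x : (forall y, is_derive y 1 f (df y)) ->
  is_derive x 1 (fun y => f (d + y)) (df (d + x)).
Proof.
move=> dF; have := is_derive_comp_affine 1 d x dF.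
rewrite (_ : (fun y => f (1 * y + d)) = (fun y => f (d + y))) ?mul1r 1?addrC//.
by apply/funext => y; rewrite mul1r addrC.
Qed.

Definition average a u x : R := (2 * a)^-1 * \int[mu]_(s in `[(- a)%R, a]) u (x + s).

Lemma continuous_translate u x : continuous u -> continuous (fun s => u (x + s)).
Proof. by move=> cu; apply: (continuous_fun_comp cu); exact: continuous_addl. Qed.

Lemma averageB a u v x : continuous u -> continuous v ->
  average a (fun y => u y - v y) x = average a u x - average a v x.
Proof.
by move=> cu cv; rewrite /average -mulrBr -continuous_RintegralB//; exact: continuous_translate.
Qed.

Lemma average_translate a u c x : average a (fun y => u (c + y)) x = average a u (c + x).
Proof. by rewrite /average; under eq_Rintegral do rewrite addrA. Qed.

Lemma average_norm_le a u x M : 0 < a -> continuous u -> (forall s, `|s| <= a -> `|u (x + s)| <= M) ->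
  `|average a u x| <= M.
Proof.
move=> a0 cu uM.
have aa : - a <= a by lra.
have := integral_bound aa (@continuous_translate u x cu) (M := M).
move=> H; rewrite /average normrM gtr0_norm ?invr_gt0 ?mulr_gt0// ler_pdivrMl ?mulr_gt0//.
rewrite (_ : 2 * a * M = M * (a - - a)); last by ring.
by apply: H => s; rewrite -ler_norml; exact: uM.
Qed.

Lemma average_cst a r x : 0 < a -> average a (fun=> r) x = r.
Proof.
by move=> a0; rewrite /average itv_Rintegral_cst; [field; rewrite gt_eqF|lra].
Qed.

Lemma average_eq a u x r : 0 < a -> (forall s, `|s| <= a -> u (x + s) = r) -> average a u x = r.
Proof.
move=> a0 ur; rewrite -[RHS](average_cst r x a0) /average; congr (_ * _).
by apply: eq_itv_Rintegral => s; rewrite -ler_norml; exact: ur.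
Qed.

Lemma average_bounds a u x p q : 0 < a -> continuous u -> (forall y, p <= u y <= q) ->
  p <= average a u x <= q.
Proof.
move=> a0 cu upq.
have := @average_norm_le a (fun y => u y - (p + q) / 2) x ((q - p) / 2) a0.
rewrite averageB//; last exact: cst_continuous.
rewrite average_cst// => H.
have : `|average a u x - (p + q) / 2| <= (q - p) / 2.
  apply: H; first by apply: continuous_funB => //; exact: cst_continuous.
  by move=> s _; rewrite ler_norml; have := upq (x + s); lra.
by rewrite ler_norml; lra.
Qed.

Lemma average_reflect a u x r : 0 < a -> continuous u -> (forall y, u y + u (- y) = r) ->
  average a u x + average a u (- x) = r.
Proof.
move=> a0 cu ur; have aa : - a <= a by lra.
rewrite -[RHS](average_cst r x a0) /average -mulrDr; congr (_ * _).
have -> : \int[mu]_(s in `[(- a)%R, a]) u (- x + s) = \int[mu]_(s in `[(- a)%R, a]) u (- x - s).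
  have := integral_reflect 0 aa (@continuous_translate u (- x) cu); rewrite !sub0r opprK => <-.
  by under eq_Rintegral do rewrite sub0r.
rewrite -continuous_RintegralD.
- by apply: eq_itv_Rintegral => s _; rewrite -opprD.
- exact: continuous_translate.
- by apply: (continuous_fun_comp cu); exact: continuous_reflect.
Qed.

Definition lipschitz L u := forall x y, `|u x - u y| <= L * `|x - y|.

Lemma lipschitz_continuous_fun L u : lipschitz L u -> continuous u.
Proof. exact: lipschitz_continuous. Qed.

Lemma average_lipschitz a L u : 0 < a -> lipschitz L u -> lipschitz L (average a u).
Proof.
move=> a0 Lu x y; have cu := lipschitz_continuous_fun Lu.
have ct z := @continuous_translate u z cu.
have -> : average a u x - average a u y = average a (fun s => u (x + s) - u (y + s)) 0.
  by rewrite averageB// !average_translate !addr0.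
apply: average_norm_le => //; first exact: continuous_funB.
by move=> s _; rewrite add0r (_ : x - y = x + s - (y + s)) ?Lu//; ring.
Qed.

Lemma average_lipschitz_near a L u x : 0 < a -> 0 <= L -> lipschitz L u -> `|average a u x - u x| <= L * a.
Proof.
move=> a0 L0 Lu; have cu := lipschitz_continuous_fun Lu.
rewrite -[u x](average_cst (u x) x a0) -averageB//; last exact: cst_continuous.
apply: average_norm_le => //; first by apply: continuous_funB => //; exact: cst_continuous.
by move=> s sa; apply: le_trans (Lu _ _) _; rewrite addrAC subrr add0r ler_wpM2l.
Qed.

(** Averaging gains one derivative, a difference quotient of step [2 * a]. In supremum norm it costs
    a factor [1 / a], which is the source of all the derivative bounds. *)
Lemma is_derive_average a u x : 0 < a -> continuous u ->
  is_derive x 1 (average a u) ((2 * a)^-1 * (u (a + x) - u (- a + x))).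
Proof.
move=> a0 cu; have [U dU] := continuous_antiderivative cu.
have aa : - a <= a by lra.
have dUt (c z : R) : is_derive z 1 (fun s => U (c + s)) (u (c + z)) by exact: is_derive_comp_addl.
have -> : average a u = fun x => (2 * a)^-1 * (U (a + x) - U (- a + x)).
  apply/funext => z; rewrite /average (integral_antiderivative aa (@continuous_translate u z cu) (dUt z)).
  by rewrite !(addrC z).
have d1 := is_deriveB (dUt a x) (dUt (- a) x).
exact: (is_deriveZ (2 * a)^-1 d1).
Qed.

End Averages.

(** * Smoothing a ramp by infinitely many averages *)

Section IteratedAverages.
Variable R : realType.
Local Notation mu := (@lebesgue_measure R).
Implicit Types (f g u v : R -> R) (c l p q r s t x y L d : R) (N m n k : nat).

(** With [P] the partial sums of [d], both [P] and [P + w] are nondecreasing and bounded, so their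
    difference [w] converges. *)
Lemma cvgn_of_increments (w d : nat -> R) B M : (forall n, w n <= B) ->
  (forall n, `|w n.+1 - w n| <= d n) -> (forall N, \sum_(0 <= i < N) d i <= M) -> cvgn w.
Proof.
move=> wB wd dM; pose P n := \sum_(0 <= i < n) d i.
have d0 n : 0 <= d n by exact: le_trans (wd n).
have PS n : P n.+1 = P n + d n by rewrite /P big_nat_recr.
have cP : cvgn P.
  apply: nondecreasing_is_cvgn.
    by apply/nondecreasing_seqP => n; rewrite PS lerDl.
  by exists M => _ [n _ <-]; exact: dM.
have cQ : cvgn (fun n => P n + w n).
  apply: nondecreasing_is_cvgn.
    by apply/nondecreasing_seqP => n; rewrite PS; have := wd n; rewrite ler_norml; lra.
  by exists (M + B) => _ [n _ <-]; apply: lerD; [exact: dM|exact: wB].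
rewrite (_ : w = (fun n => (P n + w n) - P n)); first exact: is_cvgB.
by apply/funext => n; rewrite addrC addKr.
Qed.

(** Linear between [-1/12] and [1/12]; averages of total half-width at most [1/12] widen this to
    [[-1/6, 1/6]]. A ramp in place of a jump makes all iterates [3 pi]-Lipschitz, hence their limit
    as well. *)
Definition ramp x : R := Num.min (pi / 2) (Num.max 0 (3 * pi * (x + 1 / 12))).

Lemma ramp_lipschitz : lipschitz (3 * pi) ramp.
Proof.
move=> x y; have p0 := @pi_gt0 R.
have -> : 3 * pi * `|x - y| = `|3 * pi * (x + 1 / 12) - 3 * pi * (y + 1 / 12)|.
  by rewrite -mulrBr normrM ger0_norm ?opprD ?addrA ?[x + _ - y]addrAC ?addrK//; lra.
rewrite /ramp; move: (_ * (x + _)) (_ * (y + _)) => X Y.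
have h : - `|X - Y| <= X - Y <= `|X - Y| by rewrite -ler_norml.
have c0 : 0 < pi / 2 :> R by lra.
rewrite ler_norml !minEle !maxEle; move: (pi / 2) c0 => c c0.
have cN : (c <= 0) = false by apply/negbTE; rewrite -ltNge.
case: (leP 0 X) => h1; case: (leP 0 Y) => h2; rewrite ?cN;
  try case: (leP c X) => h3; try case: (leP c Y) => h4; lra.
Qed.

Lemma ramp_bounds x : 0 <= ramp x <= pi / 2.
Proof.
have p0 := @pi_gt0 R.
by rewrite /ramp le_min ge_min le_max !lexx /= andbT; apply/orP; left; lra.
Qed.

Lemma ramp_low x : x <= - (1 / 12) -> ramp x = 0.
Proof.
have p0 := @pi_gt0 R; move=> xl; rewrite /ramp (elimT max_idPl) ?(elimT min_idPr)//; first by lra.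
by nra.
Qed.

Lemma ramp_reflect x : ramp x + ramp (- x) = pi / 2.
Proof.
have p0 := @pi_gt0 R.
rewrite /ramp (_ : 3 * pi * (- x + 1 / 12) = pi / 2 - 3 * pi * (x + 1 / 12)); last by field.
move: (_ * (x + _)) => X; have c0 : 0 < pi / 2 :> R by lra.
rewrite !minEle !maxEle; move: (pi / 2) c0 => c c0.
have cN : (c <= 0) = false by apply/negbTE; rewrite -ltNge.
case: (leP 0 X) => h1; case: (leP 0 (c - X)) => h2; rewrite ?cN;
  try case: (leP c X) => h3; try case: (leP c (c - X)) => h4; lra.
Qed.

Variables (a : nat -> R) (a_gt0 : forall n, 0 < a n).
Variable a_sum : forall N, \sum_(0 <= i < N) a i <= 1 / 12.

(** The width [a n] is outermost and raising [m] inserts a new innermost average: the limit in [m]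
    can then be differentiated by peeling off [a n]. *)
Fixpoint iter_average n m : R -> R :=
  if m is m'.+1 then average (a n) (iter_average n.+1 m') else ramp.

Lemma iter_average_lipschitz n m : lipschitz (3 * pi) (iter_average n m).
Proof.
by elim: m n => [|m IH] n /=; [exact: ramp_lipschitz|exact: average_lipschitz].
Qed.

Lemma iter_average_continuous n m : continuous (iter_average n m).
Proof. exact: lipschitz_continuous_fun (@iter_average_lipschitz n m). Qed.

Lemma iter_average_bounds n m x : 0 <= iter_average n m x <= pi / 2.
Proof.
elim: m n x => [|m IH] n x /=; first exact: ramp_bounds.
by apply: average_bounds => //; exact: iter_average_continuous.
Qed.

Lemma iter_average_reflect n m x : iter_average n m x + iter_average n m (- x) = pi / 2.
Proof.
elim: m n x => [|m IH] n x /=; first exact: ramp_reflect.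
by apply: average_reflect => //; exact: iter_average_continuous.
Qed.

Lemma iter_average_low n m x : x <= - (1 / 12 + \sum_(n <= i < n + m) a i) -> iter_average n m x = 0.
Proof.
elim: m n x => [|m IH] n x; first by rewrite addn0 big_geq// addr0; exact: ramp_low.
rewrite addnS big_ltn ?ltnS ?leq_addr// => xl /=; apply: average_eq => // s sa.
by apply: IH; rewrite addSn; have := ler_norm s; lra.
Qed.

(** The two functions differ by one innermost average, which moves the Lipschitz ramp by at most
    [3 pi a (n + m)]; the outer averages do not increase the supremum norm. *)
Lemma iter_average_step n m x : `|iter_average n m.+1 x - iter_average n m x| <= 3 * pi * a (n + m)%N.
Proof.
have p0 := @pi_gt0 R.
elim: m n x => [|m IH] n x.
  by rewrite addn0; apply: average_lipschitz_near => //; [lra|exact: ramp_lipschitz].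
change (`|average (a n) (iter_average n.+1 m.+1) x - average (a n) (iter_average n.+1 m) x| <= 3 * pi
    * a (n + m.+1)%N).
rewrite -averageB; try exact: iter_average_continuous.
apply: average_norm_le => //.
  by apply: continuous_funB; exact: iter_average_continuous.
by move=> s _; rewrite addnS -addSn; exact: IH.
Qed.

(* [transition n] is the ramp smoothed by all the widths [a n, a n.+1, ...]; hence
   [transition n] is the average of [transition n.+1] over the width [a n]. *)
Definition transition n x : R := lim (iter_average n m x @[m --> \oo]).

Lemma transition_cvg n x : iter_average n m x @[m --> \oo] --> transition n x.
Proof.
have p0 := @pi_gt0 R.
suff : cvgn (fun m => iter_average n m x) by [].
apply: (@cvgn_of_increments _ (fun m => 3 * pi * a (n + m)%N) (pi / 2) (3 * pi * (1 / 12))).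
- by move=> m; case/andP: (iter_average_bounds n m x).
- by move=> m; exact: iter_average_step.
move=> N; rewrite -mulr_sumr ler_wpM2l//; first by lra.
apply: le_trans (a_sum (n + N)); rewrite (@big_cat_nat _ _ _ n 0 (n + N))//= ?leq_addr//.
rewrite -{3}(add0n n) big_addn addKn ler_wpDl//; first by apply: sumr_ge0 => i _; exact: ltW.
by under eq_bigr do rewrite addnC.
Qed.

Lemma transition_bounds n x : 0 <= transition n x <= pi / 2.
Proof.
have h := @transition_cvg n x; apply/andP; split.
  by apply: (limr_ge (cvgP _ h)); apply: nearW => m; case/andP: (iter_average_bounds n m x).
by apply: (limr_le (cvgP _ h)); apply: nearW => m; case/andP: (iter_average_bounds n m x).
Qed.

Lemma transition_lipschitz n : lipschitz (3 * pi) (transition n).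
Proof.
move=> x y; apply: (cvg_norm_le (cvgB (@transition_cvg n x) (@transition_cvg n y))) => m.
exact: iter_average_lipschitz.
Qed.

Lemma transition_continuous n : continuous (transition n).
Proof. exact: lipschitz_continuous_fun (@transition_lipschitz n). Qed.

Lemma transition_reflect n x : transition n x + transition n (- x) = pi / 2.
Proof.
apply: (cvg_unique (@Rhausdorff R) (cvgD (@transition_cvg n x) (@transition_cvg n (- x)))).
rewrite /= (_ : _ + _ = fun=> pi / 2); first exact: cvg_cst.
by apply/funext => m; exact: iter_average_reflect.
Qed.

Lemma transition_low x : x <= - (1 / 6) -> transition 0 x = 0.
Proof.
move=> xl; apply: (cvg_unique (@Rhausdorff R) (@transition_cvg 0%N x)).
rewrite (_ : (fun _ => _) = fun=> 0); first exact: cvg_cst.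
by apply/funext => m; apply: iter_average_low; have := a_sum m; rewrite add0n; lra.
Qed.

Lemma transition_high x : 1 / 6 <= x -> transition 0 x = pi / 2.
Proof. by move=> xh; rewrite -(transition_reflect 0 x) [transition 0 (- x)]transition_low ?addr0//; lra. Qed.

Lemma transition_average n : transition n = average (a n) (transition n.+1).
Proof.
apply/funext => x; have h := @transition_cvg n x.
have := h; rewrite -cvg_shiftS => h'.
have [|||||_ lim] := @Rintegral_dominated_cvg _ _ _ mu `[- a n, a n] (fun m s => iter_average n.+1 m (x + s))
  (fun s => transition n.+1 (x + s)) (fun=> pi / 2).
- exact: measurable_itv.
- move=> m; apply: measurable_funTS; apply: continuous_measurable_fun; apply: continuous_translate.
  exact: iter_average_continuous.
- by move=> s _; exact: transition_cvg.
- by apply: continuous_integrable; exact: cst_continuous.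
- by move=> m s _; have := iter_average_bounds n.+1 m (x + s); rewrite ler_norml; have := @pi_gt0 R; lra.
apply: (cvg_unique (@Rhausdorff R) h'); rewrite /= /average; exact: cvgMr.
Qed.

Lemma is_derive_transition n x : is_derive x 1 (transition n)
  ((2 * a n)^-1 * (transition n.+1 (a n + x) - transition n.+1 (- a n + x))).
Proof.
rewrite [transition n]transition_average; apply: is_derive_average => //; exact: transition_continuous.
Qed.

End IteratedAverages.

(** * Derivative bounds *)

Section DerivativeBounds.
Variable R : realType.
Implicit Types (f g u v df : R -> R) (bet gam : nat -> R) (c p q r s t x y d D : R) (n k i j : nat).

(** [f] is [n] times differentiable with continuous [n]-th derivative, and [bet k] bounds the [k]-th
    derivative. Derivatives are supplied as witnesses, so every closure property is a short
    induction on [n]. *)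
Fixpoint derivatives_le n f bet : Prop := (forall x, `|f x| <= bet 0%N) /\
  match n with
  | 0%N => continuous f
  | n'.+1 => exists2 df, forall x, is_derive x 1 f (df x) & derivatives_le n' df (fun k => bet k.+1)
  end.

Lemma derivatives_le_bound n f bet : derivatives_le n f bet -> forall x, `|f x| <= bet 0%N.
Proof. by case: n => [|n] []. Qed.

Lemma derivatives_le_continuous n f bet : derivatives_le n f bet -> continuous f.
Proof. by case: n => [[]//|n [_ [df dF _]]]; exact: is_derive_continuous dF. Qed.

Lemma derivatives_le_ge0 n f bet k : derivatives_le n f bet -> (k <= n)%N -> 0 <= bet k.
Proof.
elim: n f bet k => [|n IH] f bet [|k] [fb]// H kn; try exact: le_trans (fb 0).
by have [df _ /IH] := H; apply.
Qed.

Lemma derivatives_le_trans n f bet gam : derivatives_le n f bet ->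
  (forall k, (k <= n)%N -> bet k <= gam k) -> derivatives_le n f gam.
Proof.
elim: n f bet gam => [|n IH] f bet gam [fb H] bg; split => //; try by move=> x; exact: le_trans (bg _ _).
by have [df dF HF] := H; exists df => //; apply: IH HF _ => k kn; exact: bg.
Qed.

Lemma derivatives_leS n f bet : derivatives_le n.+1 f bet -> derivatives_le n f bet.
Proof.
elim: n f bet => [|n IH] f bet [fb [df dF H]]; split => //; first exact: is_derive_continuous dF.
by exists df => //; exact: IH.
Qed.

Lemma derivatives_leD n f g bet gam : derivatives_le n f bet -> derivatives_le n g gam ->
  derivatives_le n (fun x => f x + g x) (fun k => bet k + gam k).
Proof.
elim: n f g bet gam => [|n IH] f g bet gam [fb H] [gb K]; split;
  try (by move=> x; apply: le_trans (ler_normD _ _) _; exact: lerD).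
  exact: continuous_funD.
have [[df dF HF] [dg dG HG]] := (H, K); exists (fun x => df x + dg x); last exact: IH.
by move=> x; exact: is_deriveD.
Qed.

Lemma derivatives_leZ n r f bet : derivatives_le n f bet ->
  derivatives_le n (fun x => r * f x) (fun k => `|r| * bet k).
Proof.
elim: n f bet => [|n IH] f bet [fb H]; split;
  try (by move=> x; rewrite normrM ler_wpM2l).
  exact: continuous_funZ.
have [df dF HF] := H; exists (fun x => r * df x); last exact: IH.
by move=> x; exact: (is_deriveZ r (dF x)).
Qed.

Lemma derivatives_le_affine n c d f bet : `|c| <= 1 -> derivatives_le n f bet ->
  derivatives_le n (fun x => f (c * x + d)) bet.
Proof.
move=> c1; elim: n f bet => [|n IH] f bet [fb H]; split => //.
  by apply: (continuous_fun_comp H); exact: continuous_affine.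
have [df dF HF] := H; exists (fun x => c * df (c * x + d)).
  by move=> x; exact: is_derive_comp_affine.
apply: derivatives_le_trans (derivatives_leZ c (IH _ _ HF)) _ => k kn.
by rewrite ler_piMl//; exact: derivatives_le_ge0 HF kn.
Qed.

(* The recursion is the product rule itself, so no binomial coefficients are needed. *)
Fixpoint leibniz n bet gam : R :=
  if n is n'.+1 then leibniz n' (fun k => bet k.+1) gam + leibniz n' bet (fun k => gam k.+1)
  else bet 0%N * gam 0%N.

Lemma derivatives_leM n f g bet gam : derivatives_le n f bet -> derivatives_le n g gam ->
  derivatives_le n (fun x => f x * g x) (fun k => leibniz k bet gam).
Proof.
elim: n f g bet gam => [|n IH] f g bet gam H K.
  split; last by apply: continuous_funM; [case: H|case: K].
  by move=> x; rewrite normrM ler_pM// ?(derivatives_le_bound H) ?(derivatives_le_bound K).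
split; first by move=> x; rewrite normrM ler_pM// ?(derivatives_le_bound H) ?(derivatives_le_bound K).
have [[_ [df dF HF]] [_ [dg dG HG]]] := (H, K).
exists (fun x => df x * g x + f x * dg x).
  by move=> x; apply: is_derive_eq; rewrite addrC [g x *: _]mulrC.
apply: derivatives_leD; apply: IH => //; exact: derivatives_leS.
Qed.

(* The constant comes from [sum_r C(k,r) (i+r)! (j+k-r)! = i! j! (i+j+k+1)! / (i+j+1)!]. *)
Lemma leibniz_factorial k i j bet gam (M N P : nat -> R) :
  (forall n, bet n = n`!%:R * M n) -> (forall n, gam n = n`!%:R * N n) ->
  (forall m n, M m * N n <= P (m + n)%N) ->
  leibniz k (fun n => bet (i + n)%N) (fun n => gam (j + n)%N) <=
  i`!%:R * j`!%:R * (i + j + k).+1`!%:R / (i + j).+1`!%:R * P (i + j + k)%N.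
Proof.
move=> bM gN MNP; elim: k i j => [|k IH] i j /=.
  rewrite !addn0 bM gN mulfK ?pnatr_eq0 -?lt0n ?fact_gt0//.
  by rewrite mulrACA ler_wpM2l ?mulr_ge0.
have := IH i.+1 j; have := IH i j.+1.
rewrite (_ : (fun n => bet (i.+1 + n)%N) = (fun n => bet (i + n.+1)%N)); last by apply/funext => n;
    rewrite addSnnS.
rewrite (_ : (fun n => gam (j.+1 + n)%N) = (fun n => gam (j + n.+1)%N)); last by apply/funext => n;
    rewrite addSnnS.
rewrite !addnS !addSn => h1 h2; apply: le_trans (lerD h2 h1) _.
(* Both bounds carry the same [P] and the same large factorial; what remains is [(i+1)! j! + i!
   (j+1)! = (i + j + 2) i! j!]. *)
move: (P _) (_ .+2`!)%N => p q; rewrite !factS !natrM le_eqVlt; apply/orP; left; apply/eqP.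
have [i0 j0] : 0 <= i%:R :> R /\ 0 <= j%:R :> R by split.
field; rewrite pnatr_eq0 -lt0n fact_gt0 /=; apply/andP; split; apply: lt0r_neq0; lra.
Qed.

Lemma derivatives_le_derivative n f df bet : (forall x, is_derive x 1 f (df x)) ->
  derivatives_le n.+1 f bet -> derivatives_le n df (fun k => bet k.+1).
Proof.
move=> dF [_ [g dG H]]; rewrite (_ : df = g)//; apply/funext => x.
by rewrite -(@derive_val _ _ _ _ _ _ _ (dF x)) -(@derive_val _ _ _ _ _ _ _ (dG x)).
Qed.

(** Since [sin f] and [cos f] have derivatives [cos f * f'] and [- sin f * f'], a simultaneous
    induction closes once [bet] dominates its own Leibniz product with the bounds for [f']. This
    replaces the formula for higher derivatives of a composition. *)
Lemma derivatives_le_trig n f df bet gam : (forall x, is_derive x 1 f (df x)) ->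
  (forall n, derivatives_le n df gam) -> 1 <= bet 0%N ->
  (forall k, leibniz k bet gam <= bet k.+1) ->
  derivatives_le n (fun x => sin (f x)) bet /\ derivatives_le n (fun x => cos (f x)) bet.
Proof.
move=> dF dfb b0 lb; have cf := is_derive_continuous dF.
have sb x : `|sin (f x)| <= bet 0%N by apply: le_trans b0; rewrite ler_norml sin_geN1 sin_le1.
have cb x : `|cos (f x)| <= bet 0%N by apply: le_trans b0; rewrite ler_norml cos_geN1 cos_le1.
have dsin x : is_derive x 1 (fun x => sin (f x)) (cos (f x) * df x).
  exact: (@is_derive1_comp _ _ _ _ _ _ (is_derive_sin (f x)) (dF x)).
have dcos x : is_derive x 1 (fun x => cos (f x)) (-1 * (sin (f x) * df x)).
  have h := @is_derive1_comp _ _ _ _ _ _ (is_derive_cos (f x)) (dF x).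
  by apply: is_derive_eq; rewrite mulN1r mulNr.
elim: n => [|n [IHs IHc]].
  split; split => //; apply: continuous_fun_comp => //; [exact: continuous_sin|exact: continuous_cos].
split; split => //.
  exists (fun x => cos (f x) * df x) => //.
  by apply: derivatives_le_trans (derivatives_leM IHc (dfb n)) _ => k _; exact: lb.
exists (fun x => -1 * (sin (f x) * df x)) => //.
apply: derivatives_le_trans (derivatives_leZ (-1) (derivatives_leM IHs (dfb n))) _ => k _.
by rewrite normrN1 mul1r; exact: lb.
Qed.

End DerivativeBounds.

(** * Derivatives of the angle and of the multipliers *)

Section MeyerAngle.
Variable R : realType.
Implicit Types (f g u v df : R -> R) (p q r s t x y : R) (n m k i j : nat).

Lemma transition_derivatives_le (a : nat -> R) n m : (forall n, 0 < a n) ->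
  (forall N, \sum_(0 <= i < N) a i <= 1 / 12) ->
  derivatives_le n (transition a m) (fun k => pi / 2 * \prod_(m <= i < m + k) (a i)^-1).
Proof.
move=> a0 asum; elim: n m => [|n IH] m.
  split; last exact: transition_continuous.
  move=> x; rewrite addn0 big_geq// mulr1 ler_norml.
  by have := transition_bounds a0 asum m x; have := @pi_gt0 R; lra.
split.
  move=> x; rewrite addn0 big_geq// mulr1 ler_norml.
  by have := transition_bounds a0 asum m x; have := @pi_gt0 R; lra.
exists (fun x => (2 * a m)^-1 * (transition a m.+1 (1 * x + a m) + -1 * transition a m.+1 (1 * x + - a m))).
  move=> x; have := is_derive_transition a0 asum m x.
  by rewrite !mul1r mulN1r !(addrC x).
have n1 : `|1 : R| <= 1 by rewrite normr1.
have h1 := derivatives_le_affine (a m) n1 (IH m.+1).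
have h2 := derivatives_leZ (-1) (derivatives_le_affine (- a m) n1 (IH m.+1)).
apply: derivatives_le_trans (derivatives_leZ (2 * a m)^-1 (derivatives_leD h1 h2)) _ => k _.
have am := a0 m; rewrite addnS (@big_ltn _ _ _ m) ?ltnS ?leq_addr// addSn normrN1.
rewrite ger0_norm; last by rewrite invr_ge0 mulr_ge0// ltW.
by rewrite le_eqVlt; apply/orP; left; apply/eqP; field; rewrite gt_eqF.
Qed.

Variables (nu : nat -> R) (del : R).
Hypothesis nu_ge1 : forall n, 1 <= nu n.
Hypothesis nu_mono : forall m n, (m <= n)%N -> nu m <= nu n.
Hypothesis del_gt0 : 0 < del.
Hypothesis nu_sum : forall N, \sum_(0 <= i < N) (i.+1%:R * nu i)^-1 <= (12 * del)^-1.

Definition width i : R := del / (i.+1%:R * nu i).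

Lemma width_gt0 i : 0 < width i.
Proof. by rewrite divr_gt0// mulr_gt0// (lt_le_trans ltr01). Qed.

Lemma width_sum N : \sum_(0 <= i < N) width i <= 1 / 12.
Proof.
rewrite /width -mulr_sumr; apply: le_trans (ler_wpM2l (ltW del_gt0) (nu_sum N)) _.
by rewrite le_eqVlt; apply/orP; left; apply/eqP; field; rewrite gt_eqF.
Qed.

(* The coefficients [1] and [-1] are kept so that [derivatives_le_affine] applies. *)
Definition angle t : R := transition width 0 (1 * t + - (1 / 2)) + transition width 0 (-1 * t + - (1 / 2)).

Definition weight k : R := \prod_(0 <= i < k) nu i.

Lemma weightS k : weight k.+1 = weight k * nu k.
Proof. by rewrite /weight big_nat_recr. Qed.

Lemma weight_gt0 k : 0 < weight k.
Proof.
elim: k => [|k IH]; first by rewrite /weight big_geq.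
by rewrite weightS mulr_gt0// (lt_le_trans ltr01).
Qed.

(** Monotonicity of [nu] makes the weights supermultiplicative, which is what [leibniz_factorial]
    needs to return bounds of the same form. *)
Lemma weightM m n : weight m * weight n <= weight (m + n).
Proof.
elim: n => [|n IH]; first by rewrite addn0 {2}/weight big_geq// mulr1.
rewrite addnS !weightS mulrA; apply: ler_pM => //.
- by rewrite mulr_ge0// ltW// weight_gt0.
- exact: le_trans ler01 _.
- by apply: nu_mono; exact: leq_addl.
Qed.

(** The factor [4] comes from [pi * (k + 1) <= 4^(k+1)]: it absorbs the constant [pi] and one factor
    of [(k + 1)!] in the bound for the derivative of the angle. *)
Definition rate : R := 4 / del.

Definition trig_bound k : R := k`!%:R * (rate ^+ k * weight k).

Lemma angle_derivatives_le n : derivatives_le n angle (fun k => pi * (k`!%:R * del ^- k * weight k)).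
Proof.
have h := transition_derivatives_le n 0 width_gt0 width_sum.
have n1 : `|1 : R| <= 1 by rewrite normr1.
have nN1 : `|-1 : R| <= 1 by rewrite normrN1.
apply: derivatives_le_trans (derivatives_leD (derivatives_le_affine _ n1 h) (derivatives_le_affine _
    nN1 h)) _ => k _.
rewrite -mulrDl -splitr add0n (_ : \prod_(0 <= i < k) (width i)^-1 = k`!%:R * del ^- k * weight k)//.
elim: k => [|k IH]; first by rewrite /weight !big_geq// fact0 expr0 invr1 !mulr1.
rewrite big_nat_recr//= IH /weight [in RHS]big_nat_recr//= factS natrM exprS /width.
field; rewrite expf_neq0 ?gt_eqF//= ?(lt_le_trans ltr01)//.
Qed.

(** The derivative of the angle is bounded with [k!] in place of [(k + 1)!]; its Leibniz product
    with [trig_bound] then yields exactly the factor [(k + 1)!] of [trig_bound k.+1], and the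
    induction loses nothing. *)
Lemma angle_trig_derivatives_le n :
  derivatives_le n (fun t => sin (angle t)) trig_bound /\ derivatives_le n (fun t => cos (angle t)) trig_bound.
Proof.
have [_ [df dF _]] := angle_derivatives_le 1.
apply: (derivatives_le_trig n dF (gam := fun k => k`!%:R * (rate ^+ k.+1 * weight k.+1))).
- move=> m; apply: derivatives_le_trans (derivatives_le_derivative dF (angle_derivatives_le m.+1)) _ => k _.
  have p4 : pi <= 4 :> R by have := @pihalf_lt2 R; lra.
  have k4 : k.+1%:R <= 4 ^+ k :> R by rewrite -natrX ler_nat ltn_expl.
  have e : rate ^+ k.+1 = 4 ^+ k.+1 * del ^- k.+1 by rewrite expr_div_n.
  have w0 : 0 <= weight k.+1 by rewrite ltW// weight_gt0.
  have d0 : 0 <= del ^- k.+1 by rewrite invr_ge0 exprn_ge0// ltW.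
  rewrite e factS natrM !mulrA ler_wpM2r// ler_wpM2r//.
  rewrite -mulrA mulrCA mulrA [leRHS]mulrC ler_wpM2r// mulrC exprS.
  by apply: ler_pM => //; exact: pi_ge0.
- by rewrite /trig_bound fact0 expr0 /weight big_geq// !mulr1.
move=> k.
have := @leibniz_factorial _ k 0 0 trig_bound (fun k => k`!%:R * (rate ^+ k.+1 * weight k.+1))
  (fun k => rate ^+ k * weight k) (fun k => rate ^+ k.+1 * weight k.+1) (fun k => rate ^+ k.+1 * weight k.+1).
rewrite !fact0 !mul1r !add0n invr1 mulr1 /trig_bound; apply => //.
move=> i j; rewrite mulrACA -exprD addnS ler_wpM2l//; last by rewrite -addnS; exact: weightM.
by rewrite exprn_ge0// ltW// divr_gt0.
Qed.

Definition scaling_multiplier t : R := cos (angle t).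
Definition wavelet_multiplier t : R := sin (angle t) * cos (angle (t / 2)).

Lemma scaling_multiplier_derivatives_le n : derivatives_le n scaling_multiplier trig_bound.
Proof. by have [] := angle_trig_derivatives_le n. Qed.

(** The product costs a factor [k + 1 <= 2^k], which doubles the rate; halving the argument does not
    increase derivatives. *)
Lemma wavelet_multiplier_derivatives_le n :
  derivatives_le n wavelet_multiplier (fun k => k`!%:R * ((2 * rate) ^+ k * weight k)).
Proof.
have [hs hc] := angle_trig_derivatives_le n.
have h2 : `|1 / 2 : R| <= 1 by rewrite ger0_norm; lra.
have := derivatives_leM hs (derivatives_le_affine 0 h2 hc).
rewrite (_ : (fun x => _) = wavelet_multiplier); last first.
  by apply/funext => t; rewrite /wavelet_multiplier; congr (_ * cos (angle _)); field.
move=> /derivatives_le_trans; apply => k _.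
have r0 : 0 <= rate by rewrite ltW// divr_gt0.
have := @leibniz_factorial _ k 0 0 trig_bound trig_bound
  (fun k => rate ^+ k * weight k) (fun k => rate ^+ k * weight k) (fun k => rate ^+ k * weight k).
rewrite !fact0 !mul1r !add0n invr1 mulr1 => H.
apply: le_trans (H _ _ _) _ => //.
  by move=> i j; rewrite mulrACA -exprD ler_wpM2l ?exprn_ge0//; exact: weightM.
rewrite factS natrM -mulrA mulrCA (exprMn _ 2 rate) -[2 ^+ k * _ * _]mulrA; apply: ler_wpM2l => //.
apply: ler_wpM2r; first by rewrite mulr_ge0 ?exprn_ge0// ltW// weight_gt0.
by rewrite -natrX ler_nat ltn_expl.
Qed.

End MeyerAngle.

(** * Meyer multipliers from an angle *)

Section MeyerConstruction.
Variable R : realType.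
Local Notation mu := (@lebesgue_measure R).
Implicit Types (f g u v df th : R -> R) (bet gam : nat -> R) (A c p q r s t x y phi : R) (n m k i j : nat).

Lemma nice_of_derivatives f bet A A0 : derivatives_le 2 f bet -> (forall t, f (- t) = f t) ->
  0 < A0 < A -> (forall t, A0 <= `|t| -> f t = 0) -> nice A f.
Proof.
move=> fb fe A0A f0; split => //; first by exists A0.
have [b0 b1 b2] : [/\ 0 <= bet 0%N, 0 <= bet 1%N & 0 <= bet 2%N].
  by split; exact: derivatives_le_ge0 fb _.
have [h0 [f1 d1 [h1 [f2 d2 [h2 c2]]]]] := fb.
exists f1, f2, (bet 0%N + bet 1%N + bet 2%N); split => // t.
by split; [apply: le_trans (h0 t) _|apply: le_trans (h1 t) _|apply: le_trans (h2 t) _]; lra.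
Qed.

(** Outside [1/3 < |t| < 2/3] the sine and cosine of the angle are [0] or [1]; inside, the
    reflection [t -> 1 - t] exchanges them. Every relation follows by cases from these two facts. *)
Lemma meyer_of_angle th bet gam : (forall t, th (- t) = th t) ->
  (forall t, `|t| <= 1 / 3 -> th t = 0) -> (forall t, 2 / 3 <= `|t| -> th t = pi / 2) ->
  (forall t, 1 / 3 <= t <= 2 / 3 -> th t + th (1 - t) = pi / 2) ->
  derivatives_le 2 (fun t => cos (th t)) bet ->
  derivatives_le 2 (fun t => sin (th t) * cos (th (t / 2))) gam ->
  meyer (fun t => cos (th t)) (fun t => sin (th t) * cos (th (t / 2))).
Proof.
move=> the thlow thhigh threfl da db.
have clow t : `|t| <= 1 / 3 -> cos (th t) = 1 by move=> /thlow ->; exact: cos0.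
have slow t : `|t| <= 1 / 3 -> sin (th t) = 0 by move=> /thlow ->; exact: sin0.
have chigh t : 2 / 3 <= `|t| -> cos (th t) = 0 by move=> /thhigh ->; exact: cos_pihalf.
have shigh t : 2 / 3 <= `|t| -> sin (th t) = 1 by move=> /thhigh ->; exact: sin_pihalf.
have half t : `|t / 2| = `|t| / 2 by rewrite normrM [`|2^-1|]ger0_norm.
have refl t : 1 / 3 <= t <= 2 / 3 -> th (1 - t) = pi / 2 - th t.
  by move=> /threfl; lra.
have crefl t : 1 / 3 <= t <= 2 / 3 -> cos (th (1 - t)) = sin (th t).
  by move=> /refl ->; rewrite cosB cos_pihalf sin_pihalf mul0r mul1r add0r.
have srefl t : 1 / 3 <= t <= 2 / 3 -> sin (th (1 - t)) = cos (th t).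
  by move=> /refl ->; rewrite sinB cos_pihalf sin_pihalf mul0r mul1r subr0.
have blow t : `|t| <= 1 / 3 -> sin (th t) * cos (th (t / 2)) = 0 by move=> /slow ->; rewrite mul0r.
have bhigh t : 4 / 3 <= `|t| -> sin (th t) * cos (th (t / 2)) = 0.
  by move=> t4; rewrite (chigh (t / 2)) ?mulr0// half; lra.
have cs t : cos (th t) ^+ 2 + sin (th t) ^+ 2 = 1 by exact: cos2Dsin2.
have big_norm r x : r <= x \/ r <= - x -> r <= `|x| by rewrite ler_normr => -[] ->; rewrite ?orbT.
(* Unless [-2/3 < t < -1/3], each of the two products has a vanishing factor; only that interval,
   where [t + 1] is the reflection of [-t], requires the angle relation. *)
have disjoint t : t <= - (2 / 3) \/ - (1 / 3) <= t -> cos (th t) * cos (th (t + 1)) = 0 /\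
    (sin (th t) * cos (th (t / 2))) * (sin (th (t + 1)) * cos (th ((t + 1) / 2))) = 0.
  move=> [tl|tl].
    rewrite (chigh t); last by apply: big_norm; right; lra.
    split; first by rewrite mul0r.
    have [t4|t4] := leP t (- (4 / 3)); first by rewrite (bhigh t) ?mul0r//; apply: big_norm; right; lra.
    by rewrite (blow (t + 1)) ?mulr0// ler_norml; lra.
  rewrite (chigh (t + 1)); last by apply: big_norm; left; lra.
  split; first by rewrite mulr0.
  have [t4|t4] := leP t (1 / 3); first by rewrite (blow t) ?mul0r// ler_norml; lra.
  by rewrite (bhigh (t + 1)) ?mulr0//; apply: big_norm; left; lra.
have middle t : - (2 / 3) < t -> t < - (1 / 3) -> cos (th t) * cos (th (t + 1)) = sin (th t) * sin (th (t + 1)).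
  move=> t1 t2; rewrite -(the t) (_ : t + 1 = 1 - - t); last by ring.
  by rewrite crefl ?srefl 1?mulrC//; lra.
split.
- by apply: (nice_of_derivatives da (A0 := 2 / 3)) => [t||t]; rewrite ?the//; [lra|exact: chigh].
- apply: (nice_of_derivatives db (A0 := 4 / 3)) => [t||t]; rewrite ?mulNr ?the//; [lra|exact: bhigh].
- by rewrite clow// normr0; lra.
- move=> t; rewrite exprMn.
  have [t3|t3] := leP (2 / 3) `|t|; first by rewrite (chigh t t3) (shigh t t3) expr0n expr1n mul1r subr0.
  rewrite (clow (t / 2)) ?half; last by lra.
  by have := cs t; lra.
- move=> t; have [t1|t1] := leP t (- (2 / 3)); first by have [-> ->] := disjoint t (or_introl t1).
  have [t2|t2] := leP (- (1 / 3)) t; first by have [-> ->] := disjoint t (or_intror t2).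
  rewrite middle// (clow (t / 2)) ?(clow ((t + 1) / 2)) ?mulr1// ler_norml; lra.
- move=> t; rewrite (_ : (t + 2) / 2 = t / 2 + 1); last by field.
  rewrite mulrACA [RHS]mulrC.
  have [t1|t1] := leP (t / 2) (- (2 / 3)); first by have [-> _] := disjoint _ (or_introl t1); rewrite mul0r.
  have [t2|t2] := leP (- (1 / 3)) (t / 2); first by have [-> _] := disjoint _ (or_intror t2); rewrite mul0r.
  rewrite (shigh t) ?(shigh (t + 2)) ?mulr1//; apply: big_norm; [left|right]; lra.
- exact: blow.
- exact: bhigh.
- move=> t t3; rewrite (clow (t / 2)) ?(clow ((1 - t) / 2)) ?half ?ger0_norm; try lra.
  by rewrite srefl// !mulr1 addrC cs.
- move=> t t3.
  rewrite (shigh t) ?(shigh (2 - t)) ?ger0_norm; try lra.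
  rewrite (_ : (2 - t) / 2 = 1 - t / 2); last by field.
  by rewrite crefl ?mul1r ?cs//; lra.
- move=> t t3.
  rewrite (shigh t) ?(shigh (2 - t)) ?ger0_norm; try lra.
  rewrite (_ : (2 - t) / 2 = 1 - t / 2); last by field.
  rewrite crefl ?srefl; try lra.
  rewrite (clow (t / 2 / 2)) ?(clow ((1 - t / 2) / 2)) ?half ?ger0_norm; try lra.
Qed.

End MeyerConstruction.

(** * Decay *)

Section Decay.
Variable R : realType.
Local Notation mu := (@lebesgue_measure R).
Implicit Types (f g u v df lam : R -> R) (bet gam : nat -> R) (A c p q r s t x y phi T : R) (n m k i j : nat).

(** The power of the frequency stands on the left, so that [c = 0] needs no separate statement. The
    phase is arbitrary because each integration by parts shifts it. *)
Lemma oscillatory_bound n f bet A A0 c phi : derivatives_le n f bet -> 0 < A0 < A ->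
  (forall t, A0 < `|t| -> f t = 0) ->
  `|\int[mu]_(t in `[(- A)%R, A]) (f t * cosp (c * t + phi))| * (2 * pi * `|c|) ^+ n <= 2 * A * bet n.
Proof.
move=> fb A0A; have AA : - A <= A by lra.
elim: n f bet phi fb => [|n IH] f bet phi fb f0.
  rewrite expr0 mulr1 (_ : 2 * A * bet 0%N = bet 0%N * (A - - A)); last by ring.
  apply: integral_bound => //.
    by apply: continuous_funM; [exact: derivatives_le_continuous fb|exact: cosp_continuous].
  move=> t _; rewrite normrM -[leRHS]mulr1 ler_pM//; [exact: derivatives_le_bound fb _|exact: cosp_max].
have [->|c0] := eqVneq c 0.
  rewrite normr0 mulr0 expr0n mulr0 !mulr_ge0//; first by lra.
  exact: derivatives_le_ge0 fb _.
have [_ [df dF dfb]] := fb.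
have An : A0 < `|A| by rewrite ger0_norm; lra.
have k0 : 0 < 2 * pi * `|c| by rewrite !mulr_gt0 ?pi_gt0// normr_gt0.
have AA0 : 0 <= A by lra.
rewrite (@by_parts_cosp _ f df A c phi AA0 c0 dF (derivatives_le_continuous dfb)) ?f0 ?normrN//.
rewrite normrM normrN normfV normrM (gtr0_norm (_ : 0 < 2 * pi)) ?mulr_gt0 ?pi_gt0//.
rewrite exprS mulrACA mulVf ?gt_eqF// [leLHS]mul1r.
exact: (IH df (fun k => bet k.+1) _ dfb (derivative_support dF f0)).
Qed.

Lemma exists_decaying_meyer_wavelet lam T : (forall x, 1 <= lam x) ->
  (forall x y, 0 <= x -> x <= y -> lam x <= lam y) -> 1 <= T ->
  (forall N, \sum_(0 <= i < N) (i.+1%:R * lam i.+1%:R)^-1 <= T) ->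
  exists u, bandlimited_orthogonal_wavelet u (fun=> 0) /\
    forall x, `|u x| <= 3 * expR 1 * expR (- (`|x| / (96 * expR 1 * T * lam `|x|))).
Proof.
move=> lam1 lam_mono T1 lamT.
have A32 : 0 < (4 / 3 : R) < 3 / 2 by lra.
(* With this [del] the half-widths sum to at most [1/12]; together with the ramp, the transition
   around [1/2] stays within [[1/3, 2/3]]. *)
pose nu i := lam i.+1%:R; pose del := (12 * T)^-1.
have nu1 n : 1 <= nu n by exact: lam1.
have num m n : (m <= n)%N -> nu m <= nu n by move=> mn; apply: lam_mono => //; rewrite ler_nat.
have T0 : 0 < T by lra.
have d0 : 0 < del by rewrite invr_gt0 mulr_gt0.
have nus N : \sum_(0 <= i < N) (i.+1%:R * nu i)^-1 <= (12 * del)^-1.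
  by rewrite (_ : (12 * del)^-1 = T) ?lamT// /del; field; rewrite gt_eqF.
pose a := width nu del.
have a0 i : 0 < a i by exact: width_gt0.
have asum N : \sum_(0 <= i < N) a i <= 1 / 12 by exact: width_sum.
pose th := angle nu del.
have the t : th (- t) = th t by rewrite /th /angle addrC; congr (transition _ _ _ + transition _ _ _); ring.
have thlow t : `|t| <= 1 / 3 -> th t = 0.
  by rewrite ler_norml => /andP[t1 t2]; rewrite /th /angle !transition_low ?addr0//; lra.
have thhigh t : 2 / 3 <= `|t| -> th t = pi / 2.
  rewrite ler_normr => /orP[t3|t3]; rewrite /th /angle.
    by rewrite (transition_high a0 asum) ?(transition_low a0 asum) ?addr0//; lra.
  by rewrite (transition_low a0 asum) ?(transition_high a0 asum) ?add0r//; lra.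
have threfl t : 1 / 3 <= t <= 2 / 3 -> th t + th (1 - t) = pi / 2.
  move=> t3; rewrite /th /angle.
  rewrite [X in _ + X + _](transition_low a0 asum) ?[X in _ + (_ + X)](transition_low a0 asum); [|lra|lra].
  rewrite !addr0 -(transition_reflect a0 asum 0 (1 * t + - (1 / 2))).
  by congr (_ + transition _ _ _); lra.
have db n := @wavelet_multiplier_derivatives_le R nu del nu1 num d0 nus n.
have ab := meyer_of_angle the thlow thhigh threfl (@scaling_multiplier_derivatives_le R nu del nu1
    num d0 nus 2) (db 2).
pose b := wavelet_multiplier nu del.
have [_ nb _ _ _ _ _ bhigh _ _ _] := ab.
exists (fun x => ft (3 / 2) b (x + 1 / 2)); split.
  by split; [exact: ft_shift_bandlimited|exact: meyer_wavelet_onb ab].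
move=> x; set X := `|x|.
have X0 : 0 <= X by exact: normr_ge0.
have l0 : 0 < lam X by apply: lt_le_trans (lam1 X).
have e1 : 1 <= expR 1 :> R by have := expR_ge1Dx (1 : R); lra.
pose K := 96 * expR 1 * T * lam X.
have K0 : 0 < K by rewrite !mulr_gt0// expR_gt0.
have K1 : 1 <= K by rewrite !mulr_ege1//; lra.
(* [n] makes the bound [n! (96 T)^n lam(1) ... lam(n) / |x|^n <= (n K / (e |x|))^n] of order [exp (- n)]. *)
pose n := Num.truncn (X / K).
have /andP[nX Xn] : n%:R <= X / K < n.+1%:R by apply: truncn_itv; rewrite divr_ge0// ltW.
have nK : n%:R * K <= X by rewrite -ler_pdivlMr.
have b0 t : 4 / 3 < `|t| -> b t = 0 by move=> /ltW/bhigh.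
have := oscillatory_bound (x + 1 / 2) 0 (db n) A32 b0.
under eq_Rintegral do rewrite addr0.
rewrite -/(ft (3 / 2) b (x + 1 / 2)).
set U := `|ft _ _ _| => H.
have fn : n`!%:R <= n%:R ^+ n :> R.
  rewrite -natrX ler_nat.
  have : forall m, (m <= n)%N -> (m`! <= n ^ m)%N.
    by elim=> // m IH mn; rewrite factS expnS leq_mul// IH// ltnW.
  by apply.
(* The factors are [lam 1, ..., lam n], and [n <= X] because [K >= 1]. *)
have wn : weight nu n <= lam X ^+ n.
  have nX' : n%:R <= X by apply: le_trans nK; rewrite ler_peMr.
  have : forall m, (m <= n)%N -> weight nu m <= lam X ^+ m.
    elim=> [|m IH] mn; first by rewrite /weight big_geq.
    rewrite weightS exprSr ler_pM// ?(ltW (weight_gt0 _ _))//.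
    - exact: le_trans ler01 _.
    - by apply: IH; exact: ltnW.
    - by apply: lam_mono => //; apply: le_trans nX'; rewrite ler_nat.
  by apply.
(* For [n > 0] one has [X >= K >= 1], and then the factor [2 pi] outweighs the loss of [1/2] from
   the translation. *)
have Xc : X ^+ n <= (2 * pi * `|x + 1 / 2|) ^+ n.
  have [n0|n0] := posnP n; first by rewrite n0 !expr0.
  have X1 : 1 <= X.
    by apply: le_trans nK; rewrite mulr_ege1// ler1n.
  have p1 := @pihalf_ge1 R.
  have h : X - 1 / 2 <= `|x + 1 / 2|.
    have h2 : 0 <= 1 / 2 :> R by lra.
    have := ler_normD (x + 1 / 2) (- (1 / 2)).
    by rewrite addrK normrN (ger0_norm h2) lerBlDr.
  rewrite lerXn2r ?nnegrE//; first by rewrite mulr_ge0//; lra.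
  by move: (`|x + _|) h => z h; nra.
have U0 : 0 <= U by exact: normr_ge0.
have main : U <= 3 * expR (- n%:R).
  rewrite expRN -[in expR n%:R](mulr1 n%:R) expRM_natl.
  have q0 : 0 < expR 1 ^+ n :> R by rewrite exprn_gt0// expR_gt0.
  have Xn0 : 0 < X ^+ n.
    have [->|n0] := posnP n; first by rewrite expr0.
    by rewrite exprn_gt0//; apply: lt_le_trans nK; rewrite mulr_gt0// ltr0n.
  rewrite ler_pdivlMr// -(ler_pM2r Xn0) mulrAC.
  (* Here [3] is the length of the frequency interval and [96 * T] is [2 * rate del]. Multiplied by
     [expR 1], the base of the power is [n K], which is at most [X]. *)
  apply: (@le_trans _ _ (3 * (n%:R * (96 * T) * lam X) ^+ n * expR 1 ^+ n)).
    rewrite ler_wpM2r ?(ltW q0)//; apply: le_trans (ler_wpM2l U0 Xc) _; apply: le_trans H _.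
    rewrite (_ : 2 * (3 / 2) = 3); last by field.
    rewrite (_ : 2 * rate del = 96 * T); last by rewrite /rate /del invrK; ring.
    have c0 : 0 <= (96 * T) ^+ n by rewrite exprn_ge0//; lra.
    rewrite ler_wpM2l// (exprMn n (n%:R * (96 * T))) (exprMn n n%:R) -mulrA.
    have w0 : 0 <= weight nu n by rewrite ltW// weight_gt0.
    by rewrite ler_pM// ?(mulr_ge0 c0)// ler_wpM2l.
  rewrite -mulrA ler_wpM2l// -exprMn lerXn2r ?nnegrE ?mulr_ge0 ?expR_ge0//; try lra.
  by apply: le_trans nK; rewrite le_eqVlt; apply/orP; left; apply/eqP; rewrite /K; ring.
(* As [n + 1 > X / K], rounding down costs the factor [expR 1]. *)
apply: le_trans main _; rewrite -mulrA -expRD ler_wpM2l// ler_expR.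
move: Xn; rewrite -natr1 -/K; lra.
Qed.

End Decay.

(** * Iterated logarithms *)

Section IteratedLogarithms.
Variable R : realType.
Implicit Types (a b c eps x y z : R) (l i k N : nat).

Lemma ln_increment a b : 0 < a -> 0 < b -> (b - a) / b <= ln b - ln a.
Proof.
move=> a0 b0; have := expR_ge1Dx (ln a - ln b); rewrite expRD expRN !lnK ?posrE//.
by rewrite mulrBl divff ?gt_eqF//; lra.
Qed.

Lemma ln_le_sub1 a : 0 < a -> ln a <= a - 1.
Proof. by move=> a0; have := expR_ge1Dx (ln a); rewrite lnK ?posrE//; lra. Qed.

Lemma lnitS i y : lnit i.+1 y = ln (lnit i y).
Proof. by []. Qed.

Lemma lnitSr i y : lnit i.+1 y = lnit i (ln y).
Proof. exact: iterSr. Qed.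

Lemma expitS i : expit R i.+1 = expR (expit R i).
Proof. by []. Qed.

Lemma expit_ge1 i : 1 <= expit R i.
Proof.
elim: i => [|i IH]; first by [].
by rewrite expitS; have := expR_ge1Dx (expit R i); lra.
Qed.

Lemma expit_le i j : (i <= j)%N -> expit R i <= expit R j.
Proof.
elim: j => [|j IH]; first by rewrite leqn0 => /eqP ->.
rewrite leq_eqVlt => /predU1P[->//|/IH h]; apply: le_trans h _.
by rewrite expitS; have := expR_ge1Dx (expit R j); lra.
Qed.

Lemma lnit_le i y z : expit R i <= y -> y <= z -> 1 <= lnit i y <= lnit i z.
Proof.
elim: i y z => [|i IH] y z yi yz; first by rewrite yi.
have y0 : 0 < y by apply: lt_le_trans yi; exact: expR_gt0.
rewrite !lnitSr; apply: IH; last by rewrite ler_ln ?posrE//; exact: lt_le_trans yz.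
by rewrite -[leLHS]expRK ler_ln ?posrE// expR_gt0.
Qed.

Lemma lnit_ge1 i y : expit R i <= y -> 1 <= lnit i y.
Proof. by move=> iy; have /andP[] := lnit_le iy (lexx y). Qed.

Lemma lnit_mono i y z : expit R i <= y -> y <= z -> lnit i y <= lnit i z.
Proof. by move=> iy yz; have /andP[] := lnit_le iy yz. Qed.

Lemma lnit_expit i : lnit i (expit R i) = 1.
Proof. by elim: i => // i IH; rewrite lnitSr expitS expRK. Qed.

(** For one logarithm, [ln c <= c - 1] and [ln y >= 1] give [ln c + ln y <= c ln y]. The lemma
    serves to compare iterated logarithms with different shifts. *)
Lemma lnit_scale i c y : 1 <= c -> expit R i <= y -> lnit i (c * y) <= c * lnit i y.
Proof.
move=> c1; elim: i => [|i IH] iy; first by [].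
have iy' : expit R i <= y by apply: le_trans iy; exact: expit_le.
have g0 : 0 < lnit i y by apply: lt_le_trans (lnit_ge1 iy').
have c0 : 0 < c by lra.
have h : 0 < lnit i (c * y).
  apply: lt_le_trans ltr01 _; apply: lnit_ge1; apply: le_trans iy' _.
  by rewrite ler_peMl// (le_trans _ iy)// (le_trans ler01)// expit_ge1.
rewrite lnitS; apply: (@le_trans _ _ (ln (c * lnit i y))).
  by rewrite ler_ln ?posrE ?mulr_gt0// IH.
rewrite lnM ?posrE//; have := ln_le_sub1 c0; have := lnit_ge1 iy; rewrite lnitS.
by move: (ln (lnit i y)) => L; nra.
Qed.

(** A discrete chain rule: the left side is the derivative [1 / (y ln y ... ln_(i-1) y)] of the
    iterated logarithm, taken at the right end point [y + 1]. *)
Lemma lnit_increment i y : expit R i <= y -> 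
  \prod_(0 <= j < i) (lnit j (y + 1))^-1 <= lnit i (y + 1) - lnit i y.
Proof.
elim: i => [|i IH] iy; first by rewrite big_geq// /lnit /=; lra.
have iy' : expit R i <= y by apply: le_trans iy; exact: expit_le.
have yy : y <= y + 1 by lra.
have /andP[g1 g2] := lnit_le iy' yy.
rewrite big_nat_recr// 2!lnitS; apply: le_trans (ln_increment _ _); [|lra|lra].
by rewrite ler_wpM2r ?IH// invr_ge0; lra.
Qed.

(** The same principle for [- y^(-eps)]: write [a^(-eps)] as [b^(-eps) exp (eps (ln b - ln a))] and
    bound the exponential below by its tangent. *)
Lemma powR_increment eps a b : 0 < a -> a <= b -> 0 < eps ->
  eps * ((b - a) / b `^ (1 + eps)) <= a `^ (- eps) - b `^ (- eps).
Proof.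
move=> a0 ab e0; have b0 : 0 < b by lra.
rewrite /powR !gt_eqF//.
have -> : expR ((1 + eps) * ln b) = b * (expR (- eps * ln b))^-1.
  by rewrite mulrDl mul1r expRD lnK ?posrE// mulNr expRN invrK.
have -> : expR (- eps * ln a) = expR (- eps * ln b) * expR (eps * (ln b - ln a)).
  by rewrite -expRD; congr expR; ring.
have h1 := expR_ge1Dx (eps * (ln b - ln a)); have h2 := ln_increment a0 b0.
have h3 : 0 < expR (- eps * ln b) by exact: expR_gt0.
have := ler_wpM2l (ltW e0) h2; rewrite invfM invrK.
move: (expR (- eps * ln b)) h3 => z z0 h3.
rewrite (_ : eps * ((b - a) * (b^-1 * z)) = z * (eps * ((b - a) / b))); last by ring.
move: (expR (eps * (ln b - ln a))) h1 => w h1.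
rewrite (_ : z * w - z = z * (w - 1)) ?ler_pM2l//; [lra|ring].
Qed.

End IteratedLogarithms.

(** * Monotonicity of the denominators and the sum of the widths *)

Section DenominatorSum.
Variable R : realType.
Implicit Types (a b c eps x y z : R) (l i k N : nat).

Lemma denomL_factor_ge1 i x : 1 <= lnit i (expit R i + `|x|).
Proof. by apply: lnit_ge1; rewrite lerDl. Qed.

Lemma denomL_prod_ge1 l x : 1 <= \prod_(1 <= i < l.+1) lnit i (expit R i + `|x|).
Proof.
elim: l => [|l IH]; first by rewrite big_geq.
by rewrite big_nat_recr// mulr_ege1// denomL_factor_ge1.
Qed.

Lemma denomL_ge1 l eps x : 0 < eps -> 1 <= denomL l eps x.
Proof.
move=> e0; rewrite /denomL mulr_ege1//; first exact: denomL_prod_ge1.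
rewrite -[leLHS](powRr0 (lnit l.+1 (expit R l.+1 + `|x|))) ler_powR//; last by lra.
exact: denomL_factor_ge1.
Qed.

Lemma denomL_homo l eps x y : 0 < eps -> 0 <= x -> x <= y -> denomL l eps x <= denomL l eps y.
Proof.
move=> e0 x0 xy; have y0 : 0 <= y by lra.
have g0 i z : 0 <= lnit i (expit R i + `|z|) by apply: le_trans ler01 (denomL_factor_ge1 _ _).
have g i : lnit i (expit R i + `|x|) <= lnit i (expit R i + `|y|).
  by apply: lnit_mono; rewrite ?lerDl// !ger0_norm// lerD2l.
rewrite /denomL ler_pM//.
- exact: le_trans ler01 (denomL_prod_ge1 _ _).
- exact: powR_ge0.
- by apply: ler_prod => i _; rewrite g0 g.
- by apply: ge0_ler_powR; rewrite ?nnegrE//; lra.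
Qed.

(** The factors of [denomL] have different shifts [expit i], whereas the telescoping increments use
    the single shift [E]. Aligning the [l] products costs [E ^+ l], replacing [E + k + 1] by [k + 1]
    costs [E + 1], and the telescoped powers sum to at most [1] because [H 0 = 1]. *)
Lemma denomL_sum l eps N : 0 < eps -> 
  \sum_(0 <= k < N) (k.+1%:R * denomL l eps k.+1%:R)^-1 <= (expit R l.+1 + 1) * expit R l.+1 ^+ l / eps.
Proof.
move=> e0; set E := expit R l.+1.
have E1 : 1 <= E by exact: expit_ge1.
pose H k := lnit l.+1 (E + k%:R).
have H1 k : 1 <= H k by apply: lnit_ge1; rewrite lerDl.
have step k : (k.+1%:R * denomL l eps k.+1%:R)^-1 <=
    (E + 1) * E ^+ l / eps * (H k `^ (- eps) - H k.+1 `^ (- eps)).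
  pose K : R := k.+1%:R; pose y := E + k%:R.
  have K1 : 1 <= K by rewrite ler1n.
  have yK : y + 1 = E + K by rewrite /y /K -addrA natr1.
  have yE : E <= y by rewrite lerDl.
  have ab : H k <= H k.+1.
    by apply: lnit_mono => //; rewrite -/K -yK; lra.
  pose q := H k.+1 `^ (1 + eps).
  have q0 : 0 < q by rewrite powR_gt0// (lt_le_trans ltr01).
  pose Q := \prod_(1 <= i < l.+1) lnit i (expit R i + `|K|).
  have Q1 : 1 <= Q by exact: denomL_prod_ge1.
  have KK : `|K| = K by rewrite ger0_norm//; lra.
  have DE : denomL l eps K = Q * q by rewrite /denomL /Q KK.
  (* For each factor [E + K <= E (expit i + K)], and [lnit_scale] takes the factor [E] out of the
     logarithms. *)
  have PQ m : (m <= l)%N -> 1 <= \prod_(1 <= i < m.+1) lnit i (E + K) <=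
      E ^+ m * \prod_(1 <= i < m.+1) lnit i (expit R i + `|K|).
    elim: m => [|m IH] ml; first by rewrite !big_geq// expr0 mulr1 lexx.
    have /andP[P1 P2] := IH (ltnW ml).
    rewrite big_nat_recr// [X in _ <= _ <= _ * X]big_nat_recr// exprSr mulrACA.
    have mE : expit R m.+1 <= E by apply: expit_le; exact: ltnW.
    have m1 := expit_ge1 R m.+1.
    have g1 : 1 <= lnit m.+1 (E + K) by apply: lnit_ge1; lra.
    apply/andP; split; first exact: mulr_ege1 P1 g1.
    apply: ler_pM P2 _; [exact: le_trans ler01 P1|exact: le_trans ler01 g1|].
    rewrite KK.
    apply: le_trans (lnit_scale E1 _); last by lra.
    by apply: lnit_mono; [lra|nra].
  have /andP[P1 P2] := PQ l (leqnn l).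
  have inc := @lnit_increment R l.+1 y yE.
  have pinc := powR_increment (lt_le_trans ltr01 (H1 k)) ab e0.
  have C0 : 0 <= (E + 1) * E ^+ l by rewrite mulr_ge0 ?exprn_ge0//; lra.
  rewrite -/K DE.
  apply: (@le_trans _ _ ((E + 1) * E ^+ l * ((H k.+1 - H k) / q))); last first.
    rewrite -(mulrA _ eps^-1) ler_wpM2l// ler_pdivlMl//.
  rewrite yK prodfV big_ltn// /= in inc.
  pose P := (E + K) * \prod_(1 <= i < l.+1) lnit i (E + K).
  have P0 : 0 < P by rewrite mulr_gt0//; lra.
  have KQ0 : 0 < K * Q by rewrite mulr_gt0//; lra.
  have PKQ : P <= (E + 1) * E ^+ l * (K * Q).
    rewrite mulrACA; apply: ler_pM P2; [lra|exact: le_trans ler01 P1|nra].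
  rewrite mulrA [leRHS]mulrA invfM ler_pM2r ?invr_gt0//.
  apply: (@le_trans _ _ ((E + 1) * E ^+ l * P^-1)); last by rewrite ler_wpM2l.
  by rewrite ler_pdivlMr// mulrC ler_pdivrMr.
apply: (@le_trans _ _ (\sum_(0 <= k < N) (E + 1) * E ^+ l / eps * (H k `^ (- eps) - H k.+1 `^ (- eps)))).
  by apply: ler_sum => k _; exact: step.
rewrite -mulr_sumr -[leRHS]mulr1; apply: ler_wpM2l.
  by rewrite !mulr_ge0 ?exprn_ge0 ?invr_ge0//; lra.
under eq_bigr do rewrite -opprB.
rewrite sumrN telescope_sumr// opprB /H addr0 lnit_expit powR1.
by rewrite gerBl powR_ge0.
Qed.

End DenominatorSum.

(** * The estimate with its constants *)

Section MainEstimate.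
Variable R : realType.
Implicit Types (l : nat) (eps x : R).

(** The widths are normalised by [T = S / eps], with [S] depending only on [l], so [1 / T]
    contributes exactly the factor [eps] of the exponent; [eps <= 1] ensures [T >= 1]. The prefactor
    obtained is [3 * expR 1]. *)
Lemma exists_wavelet_denomL l : exists c' : R, 0 < c' /\
  forall eps, 0 < eps -> eps <= 1 ->
  exists (c : R) (u v : R -> R), bandlimited_orthogonal_wavelet u v /\
    forall x, cmod u v x <= c * expR (- (c' * eps * `|x|) / denomL l eps x).
Proof.
pose S : R := (expit R l.+1 + 1) * expit R l.+1 ^+ l.
have S1 : 1 <= S.
  by have := expit_ge1 R l.+1 => E1; rewrite mulr_ege1 ?exprn_ege1//; lra.
have S0 : 0 < S by lra.
have e0 : 0 < expR 1 :> R by exact: expR_gt0.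
exists (96 * expR 1 * S)^-1; split; first by rewrite invr_gt0 mulr_gt0// mulr_gt0.
move=> eps eps0 eps1.
have T1 : 1 <= S / eps by rewrite ler_pdivlMr// mul1r; lra.
have [u [uw ub]] := exists_decaying_meyer_wavelet (fun x => @denomL_ge1 R l eps x eps0)
  (fun x y => @denomL_homo R l eps x y eps0) T1 (fun N => @denomL_sum R l eps N eps0).
exists (3 * expR 1), u, (fun=> 0); split => // x.
rewrite /cmod expr0n addr0 sqrtr_sqr; apply: le_trans (ub x) _.
rewrite le_eqVlt; apply/orP; left; apply/eqP; congr (_ * expR _).
have -> : denomL l eps `|x| = denomL l eps x by rewrite /denomL normr_id.
have D0 : denomL l eps x != 0 by rewrite gt_eqF// (lt_le_trans ltr01)// denomL_ge1.
by rewrite mulNr; congr (- _); field; rewrite D0 !gt_eqF.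
Qed.

End MainEstimate.

Local Close Scope classical_set_scope.

Theorem theorem2p3 (R : realType) :
  (exists c' : R, 0 < c' /\
    forall eps : R, 0 < eps -> eps <= 1 ->
    exists (c : R) (u v : R -> R),
      bandlimited_orthogonal_wavelet u v /\
      forall x : R,
        cmod u v x <= c * expR (- (c' * eps * `|x|) / denom0 eps x)) /\
  (forall l : nat, (1 <= l)%N ->
    exists c' : R, 0 < c' /\
    forall eps : R, 0 < eps -> eps <= 1 ->
    exists (c : R) (u v : R -> R),
      bandlimited_orthogonal_wavelet u v /\
      forall x : R,
        cmod u v x <= c * expR (- (c' * eps * `|x|) / denomL l eps x)).
Proof.
split; last by move=> l _; exact: exists_wavelet_denomL.
(* The first estimate is the case [l = 0], where the product is empty; its [c'] is then absolute. *)
have E (eps x : R) : denomL 0 eps x = denom0 eps x by rewrite /denomL big_geq// mul1r.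
have [c' [c'0 H]] := exists_wavelet_denomL R 0; exists c'; split => // eps eps0 eps1.
have [c [u [v [uw ub]]]] := H eps eps0 eps1; exists c, u, v; split => // x.
by rewrite -E.
Qed.
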